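(* For every $\rho\in\mathbb{R}_{>0}^n$, the category $\mathscr{C}_\rho$ is an abelian category.
   Context: Fix a prime $p$, a complete nonarchimedean field $K$ of mixed characteristic $(0,p)$ with $|p|=p^{-1}$, and an integer $n\ge1$. A closed polysegment is $J=[\alpha,\beta]=\prod_{i=1}^n[\alpha_i,\beta_i]\subset\mathbb{R}_{>0}^n$. $K_{J,n}$ is the ring of Laurent series $f=\sum_{i\in\mathbb{Z}^n}f_it^i$, $f_i\in K$, with $\lim_{|i|\to\infty}|f_i|\rho^i=0$ for all $\rho\in J$ (where $|i|=\sum_j|i_j|$, $\rho^i=\prod_j\rho_j^{i_j}$); $|f|_\rho=\max_i|f_i|\rho^i$ and $|f|_J=\max_{\rho\in J}|f|_\rho$; these norms extend to series with coefficients in $K(\Gamma)$, and norms of matrices are maxima over entries. $R_\rho=\varinjlim_JK_{J,n}$ over closed polysegments $J$ containing $\rho$ in their interior (ordered by inverse inclusion). $\Gamma_s$ is the group of $p^s$-th roots of unity in a fixed algebraic closure of $K$ and $\Gamma=\bigcup_{s>0}\Gamma_s$. $\zeta\in\Gamma^n$ acts on $K_{J,n}\otimes_KK(\Gamma)$ and on $R_\rho\otimes_KK(\Gamma)$ by $\zeta^*(f(t))=f(\zeta t)$, $\zeta t=(\zeta_1t_1,\dots,\zeta_nt_n)$. The category $\mathscr{C}_\rho$: objects are finite free $R_\rho$-modules $P$ endowed with a semilinear group action of $\Gamma^n$ on $P\otimes_KK(\Gamma)$ (so $\zeta^*(fx)=\zeta^*(f)\zeta^*(x)$) such that: (1) $P$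 is extended from a finite free $K_{J,n}$-module $P'$ for some closed polysegment $J$ containing $\rho$ in its interior, and the action is induced from a semilinear group action of $\Gamma^n$ on $P'\otimes_KK(\Gamma)$; (2) $\sigma(\zeta^*(x))=\sigma(\zeta)^*(\sigma(x))$ for all $\sigma\in\mathrm{Gal}(K(\Gamma)/K)$, $\zeta\in\Gamma^n$, $x\in P\otimes_KK(\Gamma)$; (3) for some basis $e_1,\dots,e_m$ of $P'$ there is $l>0$ such that for each positive integer $k$ and each $\zeta\in\Gamma^n_k$ the matrix $E(\zeta)$ of $\zeta^*$ in this basis ($\zeta^*(e_1,\dots,e_m)=(e_1,\dots,e_m)E(\zeta)$) satisfies $|E(\zeta)|_J\le p^{lk}$. Morphisms $f:P\to Q$ are $R_\rho$-module homomorphisms with $\zeta^*((f\otimes\mathrm{id})(x))=(f\otimes\mathrm{id})(\zeta^*(x))$ for all $\zeta\in\Gamma^n$, $x\in P\otimes_KK(\Gamma)$. *)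

(* Defs.v *)
From HB Require Import structures.
From mathcomp Require Import all_boot all_order all_algebra generic_quotient finmap.
From mathcomp Require Import zify ring lra.
From mathcomp Require Import boolp classical_sets reals constructive_ereal ereal exp.

Set Implicit Arguments.
Unset Strict Implicit.
Unset Printing Implicit Defensive.

Import Order.TTheory GRing.Theory Num.Theory.
Local Open Scope ring_scope.

Record nonarch_abs (R : realType) (F : fieldType) := NonarchAbs {
  nabs :> F -> R;
  nabs_ge0 : forall x, 0 <= nabs x;
  nabs_eq0 : forall x, (nabs x == 0) = (x == 0);
  nabsM : forall x y, nabs (x * y) = nabs x * nabs y;
  nabs_ultra : forall x y, nabs (x + y) <= Num.max (nabs x) (nabs y)
}.

Definition complete_for (R : realType) (F : fieldType) (v : F -> R) :=
  forall u : nat -> F,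
    (forall e, 0 < e -> exists N, forall j k, (N <= j)%N -> (N <= k)%N ->
       v (u j - u k) < e) ->
    exists l, forall e, 0 < e -> exists N, forall j, (N <= j)%N -> v (u j - l) < e.

Record complete_abs (R : realType) (F : fieldType) := CompleteAbs {
  cabs :> nonarch_abs R F;
  cabs_complete : complete_for cabs
}.

Section AbsTheory.
Variables (R : realType) (F : fieldType) (v : nonarch_abs R F).

Lemma nabs0 : v 0 = 0.
Proof. by apply/eqP; rewrite nabs_eq0. Qed.

Lemma nabs1 : v 1 = 1.
Proof.
have h : v 1 != 0 by rewrite nabs_eq0 oner_neq0.
by apply: (mulfI h); rewrite -nabsM !mulr1.
Qed.

Lemma nabsN x : v (- x) = v x.
Proof.
have h : v (-1) ^+ 2 = 1 by rewrite expr2 -nabsM mulrNN mulr1 nabs1.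
have {}h : v (-1) = 1.
  by apply/eqP; rewrite -(@eqrXn2 _ 2) ?nabs_ge0 ?ler01 // expr1n h.
by rewrite -mulN1r nabsM h mul1r.
Qed.

Lemma nabsD_le x y c : v x <= c -> v y <= c -> v (x + y) <= c.
Proof. by move=> hx hy; apply: (le_trans (nabs_ultra v x y)); rewrite ge_max hx. Qed.

Lemma nabsB_le x y c : v x <= c -> v y <= c -> v (x - y) <= c.
Proof. by move=> hx hy; apply: nabsD_le; rewrite ?nabsN. Qed.

Lemma nabsD_lt x y c : v x < c -> v y < c -> v (x + y) < c.
Proof. by move=> hx hy; apply: (le_lt_trans (nabs_ultra v x y)); rewrite gt_max hx. Qed.

Lemma nabsB_lt x y c : v x < c -> v y < c -> v (x - y) < c.
Proof. by move=> hx hy; apply: nabsD_lt; rewrite ?nabsN. Qed.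

Lemma nabs_sum_le (I : Type) (s : seq I) (P : pred I) (a : I -> F) c :
  0 <= c -> (forall i, P i -> v (a i) <= c) -> v (\sum_(i <- s | P i) a i) <= c.
Proof.
move=> c0 h; elim/big_rec: _ => [|i x Pi hx]; first by rewrite nabs0.
exact: nabsD_le (h _ Pi) hx.
Qed.

Lemma nabs_small_eq x y : (forall e, 0 < e -> v (x - y) <= e) -> x = y.
Proof.
move=> h; apply/eqP; rewrite -subr_eq0 -(nabs_eq0 v); apply/eqP/le_anti.
rewrite nabs_ge0 andbT; apply/ler_addgt0Pl => e e0.
by rewrite addr0; apply: h.
Qed.

End AbsTheory.

Section Sums.
Variables (R : realType) (K : fieldType) (v : complete_abs R K).

Definition null_family (I : choiceType) (a : I -> K) :=
  forall e, 0 < e -> exists F : {fset I}, forall i, i \notin F -> v (a i) < e.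

Definition has_sum (I : choiceType) (a : I -> K) (s : K) :=
  forall e, 0 < e -> exists F : {fset I}, forall G : {fset I}, (F `<=` G)%fset ->
    v (\sum_(i <- G) a i - s) < e.

(* the limit of the sums over finite subsets of I *)
Definition nsum (I : choiceType) (a : I -> K) : K := xget 0 [set s | has_sum a s].

Section OneIndex.
Variables (I : choiceType).
Implicit Types (a b : I -> K) (F G : {fset I}).

Lemma fsum_sub a F G : (F `<=` G)%fset ->
  \sum_(i <- G) a i = \sum_(i <- F) a i + \sum_(i <- (G `\` F)%fset) a i.
Proof.
move=> FG; rewrite (big_fsetID _ (mem F)) /=; congr (_ + _).
  by apply: eq_fbigl => i; rewrite !inE /= -in_fsetI (fsetIidPr FG).
by apply: eq_fbigl => i; rewrite !inE /= andbC.
Qed.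

Lemma fsum_off a F G c : 0 <= c -> (forall i, i \notin F -> v (a i) <= c) ->
  v (\sum_(i <- (G `\` F)%fset) a i) <= c.
Proof.
move=> c0 h; rewrite big_seq; apply: nabs_sum_le => // i.
by rewrite inE => /andP[/h].
Qed.

Lemma has_sum_uniq a s t : has_sum a s -> has_sum a t -> s = t.
Proof.
move=> hs ht; apply: (@nabs_small_eq _ _ v) => e e0.
have [F hF] := hs e e0; have [G hG] := ht e e0.
have := hG (F `|` G)%fset (fsubsetUr _ _); have := hF (F `|` G)%fset (fsubsetUl _ _).
set S := \sum_(i <- _) _ => h1 h2; have -> : s - t = (S - t) - (S - s) by ring.
exact/ltW/nabsB_lt.
Qed.

Lemma null_has_sum a : null_family a -> exists s, has_sum a s.
Proof.
move=> ha.
have e0 k : 0 < (k.+1%:R : R)^-1 by rewrite invr_gt0 ltr0Sn.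
pose F k : {fset I} := sval (cid (ha _ (e0 k))).
have hF k i : i \notin F k -> v (a i) < k.+1%:R^-1 by exact: (svalP (cid (ha _ (e0 k)))).
have big e : 0 < e -> exists N, forall k, (N <= k)%N -> (k.+1%:R : R)^-1 < e.
  move=> he; have [N] : exists N, e^-1 < (N%:R : R).
    by exists (Num.bound e^-1); apply: archi_boundP; rewrite invr_ge0 ltW.
  move=> hN; exists N => k hk; rewrite invf_plt ?posrE ?ltr0Sn //.
  by apply: lt_trans hN _; rewrite ltr_nat.
have near k G : (F k `<=` G)%fset -> v (\sum_(i <- G) a i - \sum_(i <- F k) a i) <= k.+1%:R^-1.
  move=> sub; rewrite (fsum_sub _ sub) addrAC subrr add0r.
  by apply: (@fsum_off _ _ _ _ (ltW (e0 k))) => i /hF/ltW.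
have [|l hl] := @cabs_complete _ _ v (fun k => \sum_(i <- F k) a i).
  move=> e he; have [N hN] := big e he; exists N => j k hj hk.
  have h1 := near j _ (fsubsetUl (F j) (F k)).
  have h2 := near k _ (fsubsetUr (F j) (F k)).
  have := nabsB_lt (le_lt_trans h2 (hN _ hk)) (le_lt_trans h1 (hN _ hj)).
  by rewrite (_ : _ - _ - _ = \sum_(i <- F j) a i - \sum_(i <- F k) a i) //; ring.
exists l => e he; have [N hN] := big e he; have [M hM] := hl e he.
exists (F (maxn N M)) => G sub.
have h1 := le_lt_trans (near _ _ sub) (hN _ (leq_maxl _ _)).
have := nabsD_lt h1 (hM _ (leq_maxr N M)).
by rewrite addrA subrK.
Qed.

Lemma nsumP a : null_family a -> has_sum a (nsum a).
Proof. by move=> ha; have [s hs] := null_has_sum ha; apply: xgetI hs. Qed.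

Lemma nsum_tail a F c : null_family a -> 0 <= c ->
  (forall i, i \notin F -> v (a i) <= c) -> v (nsum a - \sum_(i <- F) a i) <= c.
Proof.
move=> ha c0 h; apply/ler_addgt0Pr => e e0.
have [G hG] := nsumP ha e0.
have h1 := hG (F `|` G)%fset (fsubsetUr _ _).
have h2 : v (\sum_(i <- (F `|` G)%fset) a i - \sum_(i <- F) a i) <= c.
  by rewrite (fsum_sub _ (fsubsetUl F G)) addrAC subrr add0r fsum_off.
have le1 : v (\sum_(i <- (F `|` G)%fset) a i - nsum a) <= c + e.
  by rewrite (le_trans (ltW h1)) // lerDr.
have le2 : v (\sum_(i <- (F `|` G)%fset) a i - \sum_(i <- F) a i) <= c + e.
  by rewrite (le_trans h2) // lerDl ltW.
have := nabsB_le le2 le1.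
by rewrite (_ : _ - _ - _ = nsum a - \sum_(i <- F) a i) //; ring.
Qed.

Lemma nsum_le a c : null_family a -> 0 <= c -> (forall i, v (a i) <= c) -> v (nsum a) <= c.
Proof.
move=> ha c0 h; have := @nsum_tail a fset0 c ha c0 (fun i _ => h i).
by rewrite big_seq_fset0 subr0.
Qed.

Lemma nsum_eq a s : null_family a ->
  (forall e, 0 < e -> exists F,
     (forall i, i \notin F -> v (a i) <= e) /\ v (s - \sum_(i <- F) a i) <= e) ->
  nsum a = s.
Proof.
move=> ha h; apply: (@nabs_small_eq _ _ v) => e e0; have [F [hF hs]] := h e e0.
have := nabsB_le (nsum_tail ha (ltW e0) hF) hs.
by rewrite opprB addrA subrK.
Qed.

Lemma null_sub a b : null_family a -> null_family b ->
  forall e, 0 < e -> exists F : {fset I},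
   (forall i, i \notin F -> v (a i) <= e) /\ (forall i, i \notin F -> v (b i) <= e).
Proof.
move=> ha hb e e0; have [F hF] := ha e e0; have [G hG] := hb e e0.
by exists (F `|` G)%fset; split=> i; rewrite inE negb_or => /andP[/hF h1 /hG h2]; apply: ltW.
Qed.

Lemma null_add a b : null_family a -> null_family b -> null_family (fun i => a i + b i).
Proof.
move=> ha hb e e0; have [F hF] := ha e e0; have [G hG] := hb e e0.
exists (F `|` G)%fset => i; rewrite inE negb_or => /andP[/hF h1 /hG h2].
exact: nabsD_lt.
Qed.

Lemma nsum_add a b : null_family a -> null_family b ->
  nsum (fun i => a i + b i) = nsum a + nsum b.
Proof.
move=> ha hb; apply: nsum_eq; first exact: null_add.
move=> e e0; have [F [h1 h2]] := null_sub ha hb e0; exists F; split.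
  by move=> i hi; apply: nabsD_le; [apply: h1|apply: h2].
rewrite big_split /= opprD addrACA.
by apply: nabsD_le; apply: nsum_tail => //; apply: ltW.
Qed.

Lemma null_scale k a : null_family a -> null_family (fun i => k * a i).
Proof.
move=> ha e e0; have [->|k0] := eqVneq k 0.
  by exists fset0 => i _; rewrite mul0r nabs0.
have vk : 0 < v k by rewrite lt_def nabs_ge0 nabs_eq0 k0.
have [F hF] := ha (e / v k) (divr_gt0 e0 vk); exists F => i /hF.
by rewrite nabsM ltr_pdivlMr // mulrC.
Qed.

Lemma nsum_scale k a : null_family a -> nsum (fun i => k * a i) = k * nsum a.
Proof.
move=> ha; apply: nsum_eq; first exact: null_scale.
move=> e e0; have [k0|k0] := eqVneq k 0.
  exists fset0; split=> [i _|]; first by rewrite k0 mul0r nabs0 ltW.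
  by rewrite big_seq_fset0 k0 mul0r subr0 nabs0 ltW.
have vk : 0 < v k by rewrite lt_def nabs_ge0 nabs_eq0 k0.
have [F hF] := ha (e / v k) (divr_gt0 e0 vk); exists F.
have hF' i : i \notin F -> v (a i) <= e / v k by move/hF/ltW.
split=> [i /hF'|]; first by rewrite nabsM ler_pdivlMr // mulrC.
rewrite -mulr_sumr -mulrBr nabsM mulrC -ler_pdivlMr //.
by apply: nsum_tail => //; apply/ltW/divr_gt0.
Qed.

Lemma nsum_single a i0 : (forall i, i != i0 -> a i = 0) -> nsum a = a i0.
Proof.
have key e i : 0 < e -> (forall i, i != i0 -> a i = 0) -> i \notin [fset i0]%fset -> v (a i) < e.
  by move=> e0 h; rewrite inE => /h ->; rewrite nabs0.
move=> h; apply: nsum_eq => [e e0|e e0]; exists [fset i0]%fset.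
  by move=> i; apply: key.
by split=> [i hi|]; rewrite ?big_seq_fset1 ?subrr ?nabs0 ltW // key.
Qed.

Lemma null_zero : null_family (fun _ : I => 0).
Proof. by move=> e e0; exists fset0 => i _; rewrite nabs0. Qed.

End OneIndex.

Lemma null_reindex (I J : choiceType) (a : I -> K) (h : J -> I) (h' : I -> J) :
  cancel h h' -> null_family a -> null_family (a \o h).
Proof.
move=> hK ha e e0; have [F hF] := ha e e0.
exists [fset h' i | i in F]%fset => j; apply: contraNlt => /= hj.
apply/imfsetP; exists (h j); rewrite ?hK //=.
by apply: contraLR hj => /hF; rewrite ltNge.
Qed.

Lemma nsum_reindex (I J : choiceType) (a : I -> K) (h : J -> I) (h' : I -> J) :
  cancel h h' -> cancel h' h -> null_family a -> nsum (a \o h) = nsum a.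
Proof.
move=> hK h'K ha; apply: nsum_eq; first exact: null_reindex hK ha.
move=> e e0; have [F hF] := ha e e0.
have hF' i : i \notin F -> v (a i) <= e by move/hF/ltW.
exists [fset h' i | i in F]%fset; split=> [j hj|].
  apply: hF'; apply: contra hj => hj; apply/imfsetP; exists (h j); rewrite ?hK //=.
rewrite big_imfset /=; last by move=> x y _ _; apply: (can_inj h'K).
under eq_bigr => i _ do rewrite h'K.
by apply: nsum_tail; rewrite // ltW.
Qed.

Lemma null_fst (I J : choiceType) (a : I * J -> K) i :
  null_family a -> null_family (fun j => a (i, j)).
Proof.
move=> ha e e0; have [F hF] := ha e e0.
exists [fset x.2 | x in F]%fset => j hj; apply: hF; apply: contra hj => hj.
by apply/imfsetP; exists (i, j).
Qed.

Lemma nsum_pair (I J : choiceType) (a : I * J -> K) : null_family a ->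
  null_family (fun i => nsum (fun j => a (i, j))) /\
  nsum (fun i => nsum (fun j => a (i, j))) = nsum a.
Proof.
move=> ha.
have hb e : 0 < e -> exists F : {fset I * J}, (forall x, x \notin F -> v (a x) <= e) /\
    forall i, i \notin [fset x.1 | x in F]%fset -> v (nsum (fun j => a (i, j))) <= e.
  move=> e0; have [F hF] := ha e e0; exists F; split=> [x /hF/ltW //|i hi].
  apply: nsum_le; [exact: null_fst|exact: ltW|].
  move=> j; apply/ltW/hF; apply: contra hi => hi.
  by apply/imfsetP; exists (i, j).
have hn : null_family (fun i => nsum (fun j => a (i, j))).
  move=> e e0; have e20 : 0 < e / 2 by rewrite divr_gt0.
  have [F [_ hF]] := hb _ e20; exists [fset x.1 | x in F]%fset => i /hF h.
  by apply: le_lt_trans h _; rewrite ltr_pdivrMr // mulr_natr mulr2n ltrDl.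
split=> //; apply: nsum_eq => // e e0.
have [F [hF' hF]] := hb e e0; set H := [fset x.1 | x in F]%fset in hF *.
exists H; split=> //.
pose c i := \sum_(x <- F | x.1 == i) a x.
have -> : nsum a - \sum_(i <- H) nsum (fun j => a (i, j)) =
  (nsum a - \sum_(x <- F) a x) - (\sum_(i <- H) (nsum (fun j => a (i, j)) - c i)).
  rewrite sumrB /c (exchange_big_dep xpredT) //=.
  have -> : \sum_(x <- F) \sum_(i <- H | x.1 == i) a x = \sum_(x <- F) a x; last by ring.
  apply: eq_big_seq => x xF; under eq_bigl => i do rewrite eq_sym.
  rewrite -big_filter filter_pred1_uniq ?big_seq1 ?fset_uniq //.
  by apply/imfsetP; exists x.
apply: nabsB_le; first by apply: nsum_tail => //; apply: ltW.
apply: nabs_sum_le => [|i _]; first exact: ltW.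
pose F' : {fset I * J} := [fset x in F | x.1 == i]%fset.
have -> : c i = \sum_(j <- [fset x.2 | x in F']%fset) a (i, j).
  rewrite big_imfset /=; last first.
    by move=> [x1 x2] [y1 y2]; rewrite !inE /= => /andP[_ /eqP->] /andP[_ /eqP->] ->.
  rewrite /c big_fset_condE; apply: eq_big_seq => -[x1 x2].
  by rewrite !inE /= => /andP[_ /eqP ->].
apply: nsum_tail; [exact: null_fst|exact: ltW|].
move=> j hj; apply: hF'; apply: contra hj => hj; apply/imfsetP; exists (i, j) => //=.
by rewrite !inE hj /=.
Qed.
End Sums.

Notation multi_index n := {ffun 'I_n -> int}.

Definition msize (n : nat) (i : multi_index n) : nat := \sum_(j < n) `|i j|%N.

Definition monomial (F : fieldType) (n : nat) (x : 'I_n -> F) (i : multi_index n) : F :=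
  \prod_(j < n) x j ^ i j.

Lemma monomialD (F : fieldType) n (x : 'I_n -> F) (i j : multi_index n) :
  (forall k, x k != 0) -> monomial x (i + j) = monomial x i * monomial x j.
Proof.
move=> h; rewrite /monomial -big_split /=; apply: eq_bigr => k _.
by rewrite ffunE expfzDr.
Qed.

Lemma monomial_gt0 (R : realType) n (x : 'I_n -> R) (i : multi_index n) :
  (forall k, 0 < x k) -> 0 < monomial x i.
Proof. by move=> h; apply: prodr_gt0 => k _; apply: exprz_gt0. Qed.

Section Laurent.
Variables (R : realType) (K : fieldType) (v : complete_abs R K) (n : nat).
Local Notation mi := (multi_index n).
Local Notation laurent := (mi -> K).

Definition converges_at (rho : 'I_n -> R) (f : laurent) :=
  forall e, 0 < e -> exists N, forall i, (N <= msize i)%N -> v (f i) * monomial rho i < e.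

Definition lmul (f g : laurent) : laurent := fun i => nsum v (fun j => f j * g (i - j)).

Definition lone : laurent := fun i => if i == 0 then 1 else 0.

Lemma bounded_fset N : exists F : {fset mi}, forall i : mi, (msize i < N)%N -> i \in F.
Proof.
pose h (k : {ffun 'I_n -> 'I_(N.*2.+1)}) : mi := [ffun j => (k j)%:Z - N%:Z].
exists [fset h k | k in predT]%fset => i hi.
have hj j : (`|i j| < N)%N.
  by apply: leq_ltn_trans hi; rewrite /msize (bigD1 j) //= leq_addr.
apply/imfsetP; exists [ffun j => inord (absz (i j + N%:Z)%R)] => //=.
apply/ffunP => j; rewrite !ffunE inordK; have := hj j.
  by case: (i j) => k; lia.
rewrite -addnn; lia.
Qed.

Lemma msize_bound (F : {fset mi}) : exists N, forall i, (N <= msize i)%N -> i \notin F.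
Proof.
exists (\max_(i <- F) msize i).+1 => i; apply: contraL => iF.
by rewrite -ltnNge ltnS; apply: (@leq_bigmax_seq _ _ xpredT).
Qed.

Section OneRadius.
Variables (rho : 'I_n -> R) (rho0 : forall k, 0 < rho k).

Let rhoN0 k : rho k != 0. Proof. by rewrite gt_eqF. Qed.
Let mon0 i : 0 < monomial rho i. Proof. exact: monomial_gt0. Qed.
Let nv (f : laurent) i := v (f i) * monomial rho i.

Let nv0 f i : 0 <= nv f i.
Proof. by rewrite mulr_ge0 ?nabs_ge0 // ltW. Qed.

Let convF f : converges_at rho f <->
  forall e, 0 < e -> exists F : {fset mi}, forall i, i \notin F -> nv f i < e.
Proof.
split=> h e e0.
  have [N hN] := h e e0; have [F hF] := bounded_fset N; exists F => i iF.
  by apply: hN; rewrite leqNgt; apply: contra iF => /hF.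
have [F hF] := h e e0; have [N hN] := msize_bound F; exists N => i /hN; exact: hF.
Qed.

Let conv_bounded f : converges_at rho f -> exists2 M, 0 < M & forall i, nv f i <= M.
Proof.
move/convF/(_ 1 ltr01) => [F hF].
have s0 : 0 <= \sum_(j <- F) nv f j by apply: sumr_ge0.
exists (1 + \sum_(j <- F) nv f j) => [|i]; first by rewrite ltr_pwDl.
have [iF|iF] := boolP (i \in F).
  rewrite (big_fsetD1 i) //= addrCA lerDl addr_ge0 //; exact: sumr_ge0.
by rewrite (le_trans (ltW (hF _ iF))) // lerDl.
Qed.

Lemma null_mul_term f g i : converges_at rho f -> converges_at rho g ->
  null_family v (fun j => f j * g (i - j)).
Proof.
move=> /convF hf /conv_bounded[M M0 hM] e e0.
have e'0 : 0 < e * monomial rho i / M by rewrite divr_gt0 // mulr_gt0.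
have [F hF] := hf _ e'0; exists F => j /hF; rewrite ltr_pdivlMr // => hj.
rewrite nabsM -(ltr_pM2r (mon0 i)); apply: le_lt_trans hj.
have -> : monomial rho i = monomial rho j * monomial rho (i - j).
  by rewrite -monomialD // addrC subrK.
by rewrite mulrACA; apply: ler_wpM2l; [apply: nv0|apply: hM].
Qed.

Lemma null_mul3 f g h i :
  converges_at rho f -> converges_at rho g -> converges_at rho h ->
  null_family v (fun x : mi * mi => f x.1 * (g x.2 * h (i - x.1 - x.2))).
Proof.
move=> cf cg ch e e0; have [M M0 hM] := conv_bounded cf.
have [N N0 hN] := conv_bounded cg; have [P P0 hP] := conv_bounded ch.
move/convF: cf => cf; move/convF: cg => cg.
have e1 : 0 < e * monomial rho i / (N * P) by rewrite divr_gt0 // mulr_gt0.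
have e2 : 0 < e * monomial rho i / (M * P) by rewrite divr_gt0 // mulr_gt0.
have [F hF] := cf _ e1; have [G hG] := cg _ e2.
exists (F `*` G)%fset => -[k m] /=; rewrite inE negb_and /= => H.
rewrite -(ltr_pM2r (mon0 i)).
have -> : v (f k * (g m * h (i - k - m))) * monomial rho i =
    nv f k * (nv g m * nv h (i - k - m)).
  have -> : monomial rho i = monomial rho k * (monomial rho m * monomial rho (i - k - m)).
    by rewrite -!monomialD //; congr (monomial _ _); rewrite [m + _]addrC subrK addrC subrK.
  by rewrite !nabsM /nv; ring.
case/orP: H => [/hF|/hG]; rewrite ltr_pdivlMr ?mulr_gt0 //; apply: le_lt_trans.
  by apply: ler_wpM2l; [apply: nv0|apply: ler_pM; rewrite ?nv0 ?hN ?hP].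
rewrite mulrCA; apply: ler_wpM2l; first exact: nv0.
by apply: ler_pM; rewrite ?nv0 ?hM ?hP.
Qed.

Lemma convergesM f g : converges_at rho f -> converges_at rho g ->
  converges_at rho (lmul f g).
Proof.
move=> cf cg; apply/convF => e e0; have [M M0 hM] := conv_bounded cf.
have [N N0 hN] := conv_bounded cg.
have cf' := cf; have cg' := cg; move/convF: cf' => cf'; move/convF: cg' => cg'.
have h0 : 0 < e / 2 by rewrite divr_gt0.
have e1 : 0 < e / 2 / N by rewrite divr_gt0.
have e2 : 0 < e / 2 / M by rewrite divr_gt0.
have [F hF] := cf' _ e1; have [G hG] := cg' _ e2.
exists [fset (x + y)%R | x in F, y in G]%fset => i hi.
have lt2 : e / 2 < e by rewrite ltr_pdivrMr // mulr_natr mulr2n ltrDl.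
apply: le_lt_trans lt2; rewrite /nv -ler_pdivlMr //; apply: nsum_le.
- exact: null_mul_term.
- by rewrite ltW // divr_gt0.
move=> j; rewrite ler_pdivlMr // nabsM.
have -> : monomial rho i = monomial rho j * monomial rho (i - j).
  by rewrite -monomialD // addrC subrK.
rewrite mulrACA -/(nv f j) -/(nv g (i - j)).
have : (j \notin F) || (i - j \notin G).
  rewrite -negb_and; apply: contra hi => /andP[jF kG].
  by apply/imfset2P; exists j => //; exists (i - j) => //; rewrite addrC subrK.
case/orP => [/hF|/hG]; rewrite ltr_pdivlMr // => /ltW; apply: le_trans.
  by apply: ler_wpM2l; [apply: nv0|apply: hN].
by rewrite mulrC; apply: ler_wpM2l; [apply: nv0|apply: hM].
Qed.

Lemma lmulC f g : converges_at rho f -> converges_at rho g -> lmul f g = lmul g f.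
Proof.
move=> cf cg; apply/funext => i; rewrite /lmul.
rewrite -(@nsum_reindex _ _ _ _ _ _ (fun j => i - j) (fun j => i - j)).
- by congr nsum; apply/funext => j /=; rewrite subKr mulrC.
- by move=> j; rewrite subKr.
- by move=> j; rewrite subKr.
- exact: null_mul_term.
Qed.

Lemma lmulA f g h : converges_at rho f -> converges_at rho g -> converges_at rho h ->
  lmul f (lmul g h) = lmul (lmul f g) h.
Proof.
move=> cf cg ch; apply/funext => i; rewrite /lmul.
pose U (x : mi * mi) := f x.1 * (g x.2 * h (i - x.1 - x.2)).
have hU : null_family v U by exact: null_mul3.
have -> : (fun j => f j * nsum v (fun j0 => g j0 * h (i - j - j0))) =
          (fun j => nsum v (fun m => U (j, m))).
  by apply/funext => j; rewrite -nsum_scale //; apply: null_mul_term.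
rewrite (nsum_pair hU).2.
pose s (x : mi * mi) : mi * mi := (x.2, x.1 - x.2).
pose t (x : mi * mi) : mi * mi := (x.1 + x.2, x.1).
have sK : cancel s t by case=> a b; rewrite /s /t /= addrC subrK.
have tK : cancel t s by case=> a b; rewrite /s /t /= addrAC subrr add0r.
rewrite -(nsum_reindex sK tK hU) -(nsum_pair (null_reindex sK hU)).2.
congr nsum; apply/funext => j; rewrite mulrC -nsum_scale; last exact: null_mul_term.
congr nsum; apply/funext => k; rewrite /U /=.
by rewrite [h _ * _]mulrC mulrA; congr (_ * h _); rewrite opprB addrA subrK.
Qed.

Lemma lmul1 f : lmul lone f = f.
Proof.
apply/funext => i; rewrite /lmul (@nsum_single _ _ _ _ _ 0) /lone ?eqxx ?mul1r ?subr0 //.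
by move=> j /negPf ->; rewrite mul0r.
Qed.

Lemma lmulDl f g h : converges_at rho f -> converges_at rho g -> converges_at rho h ->
  lmul (fun i => f i + g i) h = fun i => lmul f h i + lmul g h i.
Proof.
move=> cf cg ch; apply/funext => i; rewrite /lmul.
rewrite -nsum_add; try exact: null_mul_term.
by congr nsum; apply/funext => j; rewrite -mulrDl.
Qed.

Lemma lmulZl k f g : converges_at rho f -> converges_at rho g ->
  lmul (fun i => k * f i) g = fun i => k * lmul f g i.
Proof.
move=> cf cg; apply/funext => i; rewrite /lmul -nsum_scale; last exact: null_mul_term.
by congr nsum; apply/funext => j; rewrite mulrA.
Qed.

Lemma convergesD f g : converges_at rho f -> converges_at rho g ->
  converges_at rho (fun i => f i + g i).
Proof.
move=> /convF cf /convF cg; apply/convF => e e0.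
have [F hF] := cf e e0; have [G hG] := cg e e0; exists (F `|` G)%fset => i.
rewrite inE negb_or => /andP[/hF hf /hG hg]; rewrite /nv -ltr_pdivlMr //.
by apply: nabsD_lt; rewrite ltr_pdivlMr.
Qed.

Lemma convergesZ k f : converges_at rho f -> converges_at rho (fun i => k * f i).
Proof.
move=> /convF cf; apply/convF => e e0.
have k0 : 0 < v k + 1 by rewrite ltr_wpDl ?nabs_ge0.
have [F hF] := cf _ (divr_gt0 e0 k0); exists F => i /hF.
rewrite ltr_pdivlMr //; apply: le_lt_trans; rewrite /nv nabsM -mulrA mulrC.
by rewrite ler_wpM2l ?lerDl // nv0.
Qed.

Lemma converges1 : converges_at rho lone.
Proof.
apply/convF => e e0; exists [fset 0]%fset => i; rewrite inE /nv /lone => /negPf ->.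
by rewrite nabs0 mul0r.
Qed.

Lemma converges_mask (D : pred mi) f : converges_at rho f ->
  converges_at rho (fun i => if D i then f i else 0).
Proof.
move=> /convF cf; apply/convF => e e0; have [F hF] := cf e e0.
by exists F => i /hF; rewrite /nv; case: ifP => // _ _; rewrite nabs0 mul0r.
Qed.

End OneRadius.
End Laurent.

Section LaurentClass.
Variables (R : realType) (K : fieldType) (v : complete_abs R K) (n : nat).
Local Notation mi := (multi_index n).

(* K_{J,n} and R_rho are both of this form. A common radius of convergence is what
   the ring laws need; lmem_mask (keeping only part of the monomials) is what makes
   zeta^* well defined after tensoring with K(Gamma), see gsubst. *)
Record laurent_class := LaurentClass {
  lmem :> (mi -> K) -> Prop;
  lrad : 'I_n -> R;
  lrad_gt0 : forall k, 0 < lrad k;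
  lmem_conv : forall f, lmem f -> converges_at v lrad f;
  lmemD : forall f g, lmem f -> lmem g -> lmem (fun i => f i + g i);
  lmemZ : forall c f, lmem f -> lmem (fun i => c * f i);
  lmemM : forall f g, lmem f -> lmem g -> lmem (lmul v f g);
  lmem1 : lmem (@lone K n);
  lmem_mask : forall (D : pred mi) f, lmem f -> lmem (fun i => if D i then f i else 0)
}.

Record laurent_ring (C : laurent_class) := LaurentRing {
  lcoef :> mi -> K;
  lcoefP : C lcoef
}.

Variable C : laurent_class.
Local Notation A := (laurent_ring C).

HB.instance Definition _ := gen_eqMixin A.
HB.instance Definition _ := gen_choiceMixin A.

Lemma lring_inj (f g : A) : (forall i, f i = g i) -> f = g.
Proof.
case: f g => f hf [g hg] /= /funext h; rewrite h in hf *.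
by congr LaurentRing; apply: Prop_irrelevance.
Qed.

Let cv (f : A) : converges_at v (lrad C) f. Proof. exact/lmem_conv/lcoefP. Qed.

Definition lring_add (f g : A) : A := LaurentRing (lmemD (lcoefP f) (lcoefP g)).
Definition lring_scale (c : K) (f : A) : A := LaurentRing (lmemZ c (lcoefP f)).
Definition lring_zero : A := lring_scale 0 (LaurentRing (lmem1 C)).
Definition lring_opp (f : A) : A := lring_scale (-1) f.

Fact lring_addA : associative lring_add.
Proof. by move=> f g h; apply: lring_inj => i /=; rewrite addrA. Qed.
Fact lring_addC : commutative lring_add.
Proof. by move=> f g; apply: lring_inj => i /=; rewrite addrC. Qed.
Fact lring_add0 : left_id lring_zero lring_add.
Proof. by move=> f; apply: lring_inj => i /=; rewrite mul0r add0r. Qed.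
Fact lring_addN : left_inverse lring_zero lring_opp lring_add.
Proof. by move=> f; apply: lring_inj => i /=; rewrite mulN1r mul0r addNr. Qed.

HB.instance Definition _ :=
  GRing.isZmodule.Build A lring_addA lring_addC lring_add0 lring_addN.

Definition lring_one : A := LaurentRing (lmem1 C).
Definition lring_mul (f g : A) : A := LaurentRing (lmemM (lcoefP f) (lcoefP g)).

Fact lring_mulA : associative lring_mul.
Proof.
move=> f g h; apply: lring_inj => i /=.
by rewrite (lmulA (@lrad_gt0 C) (cv f) (cv g) (cv h)).
Qed.
Fact lring_mulC : commutative lring_mul.
Proof.
by move=> f g; apply: lring_inj => i /=; rewrite (lmulC (@lrad_gt0 C) (cv f) (cv g)).
Qed.
Fact lring_mul1 : left_id lring_one lring_mul.
Proof. by move=> f; apply: lring_inj => i /=; rewrite lmul1. Qed.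
Fact lring_mulDl : left_distributive lring_mul lring_add.
Proof.
move=> f g h; apply: lring_inj => i /=.
by rewrite (lmulDl (@lrad_gt0 C) (cv f) (cv g) (cv h)).
Qed.
Fact lring_one_neq0 : lring_one != 0.
Proof.
apply/eqP => /(congr1 (fun f : A => f 0)) /=; rewrite mul0r /lone eqxx.
by apply/eqP; rewrite oner_eq0.
Qed.

HB.instance Definition _ := GRing.Zmodule_isComNzRing.Build A
  lring_mulA lring_mulC lring_mul1 lring_mulDl lring_one_neq0.

Fact lring_scaleA a b f : lring_scale a (lring_scale b f) = lring_scale (a * b) f.
Proof. by apply: lring_inj => i /=; rewrite mulrA. Qed.
Fact lring_scale1 : left_id 1 lring_scale.
Proof. by move=> f; apply: lring_inj => i /=; rewrite mul1r. Qed.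
Fact lring_scaleDr : right_distributive lring_scale +%R.
Proof. by move=> a f g; apply: lring_inj => i /=; rewrite mulrDr. Qed.
Fact lring_scaleDl f : {morph lring_scale^~ f : a b / a + b}.
Proof. by move=> a b; apply: lring_inj => i /=; rewrite mulrDl. Qed.

HB.instance Definition _ := GRing.Zmodule_isLmodule.Build K A
  lring_scaleA lring_scale1 lring_scaleDr lring_scaleDl.

Fact lring_scaleAl (a : K) (f g : A) : a *: (f * g) = a *: f * g.
Proof.
by apply: lring_inj => i /=; rewrite (lmulZl (@lrad_gt0 C) a (cv f) (cv g)).
Qed.

HB.instance Definition _ := GRing.Lmodule_isLalgebra.Build K A lring_scaleAl.
HB.instance Definition _ := GRing.Lalgebra_isComAlgebra.Build K A.

Lemma lcoefD (f g : A) i : (f + g) i = f i + g i. Proof. by []. Qed.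
Lemma lcoefZ c (f : A) i : (c *: f) i = c * f i. Proof. by []. Qed.
Lemma lcoef0 i : (0 : A) i = 0. Proof. by rewrite /= mul0r. Qed.
Lemma lcoefM (f g : A) i : (f * g) i = nsum v (fun j => f j * g (i - j)).
Proof. by []. Qed.
Lemma lcoef1 i : (1 : A) i = if i == 0 then 1 else 0. Proof. by []. Qed.

Definition lmask (D : pred mi) (f : A) : A := LaurentRing (lmem_mask D (lcoefP f)).

End LaurentClass.

Record polysegment (R : realType) (n : nat) := Polysegment {
  plower : 'I_n -> R;
  pupper : 'I_n -> R;
  plower_gt0 : forall k, 0 < plower k;
  plower_le_upper : forall k, plower k <= pupper k
}.

Definition in_polysegment (R : realType) n (J : polysegment R n) (rho : 'I_n -> R) :=
  forall k, plower J k <= rho k <= pupper J k.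

Definition in_interior (R : realType) n (J : polysegment R n) (rho : 'I_n -> R) :=
  forall k, plower J k < rho k < pupper J k.

Section Rings.
Local Open Scope classical_set_scope.
Variables (R : realType) (K : fieldType) (v : complete_abs R K) (n : nat).
Local Notation mi := (multi_index n).

Definition converges_on (J : polysegment R n) (f : mi -> K) :=
  forall rho, in_polysegment J rho -> converges_at v rho f.

Lemma in_polysegment_gt0 (J : polysegment R n) rho k : in_polysegment J rho -> 0 < rho k.
Proof. by move=> /(_ k)/andP[h _]; apply: lt_le_trans h; apply: plower_gt0. Qed.

Fact KJ_rad J : converges_on J `<=` converges_at v (plower J).
Proof. by move=> f; apply => k; rewrite lexx plower_le_upper. Qed.

Fact KJ_add J f g : converges_on J f -> converges_on J g ->
  converges_on J (fun i => f i + g i).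
Proof.
move=> hf hg r hr; apply: convergesD (hf _ hr) (hg _ hr) => k.
exact: in_polysegment_gt0 hr.
Qed.

Fact KJ_scale J c f : converges_on J f -> converges_on J (fun i => c * f i).
Proof.
by move=> hf r hr; apply: convergesZ (hf _ hr) => k; apply: in_polysegment_gt0 hr.
Qed.

Fact KJ_mul J f g : converges_on J f -> converges_on J g -> converges_on J (lmul v f g).
Proof.
move=> hf hg r hr; apply: convergesM (hf _ hr) (hg _ hr) => k.
exact: in_polysegment_gt0 hr.
Qed.

Fact KJ_one J : converges_on J (@lone K n).
Proof. by move=> r hr; apply: converges1. Qed.

Fact KJ_mask J (D : pred mi) f : converges_on J f ->
  converges_on J (fun i => if D i then f i else 0).
Proof. by move=> hf r hr; apply: converges_mask (hf _ hr). Qed.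

Definition KJ_class (J : polysegment R n) : laurent_class v n :=
  @LaurentClass R K v n (converges_on J) (plower J) (@plower_gt0 R n J) (@KJ_rad J)
    (@KJ_add J) (@KJ_scale J) (@KJ_mul J) (@KJ_one J) (@KJ_mask J).

Definition KJ J := laurent_ring (KJ_class J).

Section Germs.
Variables (rho : 'I_n -> R) (rho0 : forall k, 0 < rho k).

(* The transition maps K_{J,n} -> K_{J',n}, for J' contained in J, are the identity
   on coefficients, so that their direct limit is a union of sets of series. *)
Definition converges_near (f : mi -> K) :=
  exists2 J : polysegment R n, in_interior J rho & converges_on J f.

Lemma interior_in J : in_interior J rho -> in_polysegment J rho.
Proof. by move=> h k; have /andP[/ltW -> /ltW ->] := h k. Qed.

Lemma interior_meet (J1 J2 : polysegment R n) : in_interior J1 rho -> in_interior J2 rho ->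
  exists J : polysegment R n, [/\ in_interior J rho,
    forall r, in_polysegment J r -> in_polysegment J1 r &
    forall r, in_polysegment J r -> in_polysegment J2 r].
Proof.
move=> h1 h2.
pose lo k := Num.max (plower J1 k) (plower J2 k); pose hi k := Num.min (pupper J1 k) (pupper J2 k).
have int k : lo k < rho k < hi k.
  rewrite /lo /hi gt_max lt_min.
  by have /andP[-> ->] := h1 k; have /andP[-> ->] := h2 k.
have lo0 k : 0 < lo k by rewrite /lo lt_max plower_gt0.
have lohi k : lo k <= hi k by have /andP[a b] := int k; apply: ltW (lt_trans a b).
exists (Polysegment lo0 lohi); split=> // r hr k; have := hr k; rewrite /= /lo /hi ge_max le_min.
  by case/andP => /andP[-> _] /andP[-> _].
by case/andP => /andP[_ ->] /andP[_ ->].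
Qed.

Lemma interior_ex : exists J : polysegment R n, in_interior J rho.
Proof.
have l0 k : 0 < rho k / 2 by rewrite divr_gt0.
have lt k : rho k / 2 < rho k < rho k * 2.
  by rewrite ltr_pdivrMr // mulr_natr mulr2n ltrDl rho0.
have lh k : rho k / 2 <= rho k * 2 by have /andP[a b] := lt k; apply: ltW (lt_trans a b).
by exists (Polysegment l0 lh).
Qed.

Fact Rrho_rad : converges_near `<=` converges_at v rho.
Proof. by move=> f [J /interior_in hJ]; apply. Qed.

Fact Rrho_add f g : converges_near f -> converges_near g ->
  converges_near (fun i => f i + g i).
Proof.
move=> [J1 h1 c1] [J2 h2 c2]; have [J [h s1 s2]] := interior_meet h1 h2.
by exists J => //; apply: KJ_add => r hr; [apply/c1/s1|apply/c2/s2].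
Qed.

Fact Rrho_scale c f : converges_near f -> converges_near (fun i => c * f i).
Proof. by move=> [J h1 c1]; exists J => //; apply: KJ_scale. Qed.

Fact Rrho_mul f g : converges_near f -> converges_near g -> converges_near (lmul v f g).
Proof.
move=> [J1 h1 c1] [J2 h2 c2]; have [J [h s1 s2]] := interior_meet h1 h2.
by exists J => //; apply: KJ_mul => r hr; [apply/c1/s1|apply/c2/s2].
Qed.

Fact Rrho_one : converges_near (@lone K n).
Proof. by have [J hJ] := interior_ex; exists J => //; apply: KJ_one. Qed.

Fact Rrho_mask (D : pred mi) f : converges_near f ->
  converges_near (fun i => if D i then f i else 0).
Proof. by move=> [J h1 c1]; exists J => //; apply: KJ_mask. Qed.

Definition Rrho_class : laurent_class v n :=
  @LaurentClass R K v n converges_near rho rho0 Rrho_rad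
    Rrho_add Rrho_scale Rrho_mul Rrho_one Rrho_mask.

Definition Rrho := laurent_ring Rrho_class.

Definition germ J (hJ : in_interior J rho) (f : KJ J) : Rrho :=
  @LaurentRing _ _ _ _ Rrho_class (lcoef f) (ex_intro2 _ _ J hJ (lcoefP f)).

End Germs.
End Rings.

Section Tensor.
Local Open Scope quotient_scope.
Variables (B : Type) (V W : zmodType) (aV : B -> V -> V) (aW : B -> W -> W).

Definition balanced (Z : zmodType) (b : V -> W -> Z) : Prop :=
  [/\ forall x x' y, b (x + x') y = b x y + b x' y,
      forall x y y', b x (y + y') = b x y + b x y' &
      forall k x y, b (aV k x) y = b x (aW k y)].

Definition formal_eval (Z : zmodType) (b : V -> W -> Z) (s : seq (V * W)) : Z :=
  \sum_(u <- s) b u.1 u.2.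

(* V (x)_B W: formal sums of pure tensors, two of which are identified when no
   balanced map to an abelian group separates them. For B commutative, with both
   V and W viewed as left B-modules. *)
Definition tens_rel (s t : seq (V * W)) : bool :=
  `[< forall (Z : zmodType) (b : V -> W -> Z),
        balanced b -> formal_eval b s = formal_eval b t >].

Fact tens_rel_refl : reflexive tens_rel.
Proof. by move=> s; apply/asboolP. Qed.
Fact tens_rel_sym : symmetric tens_rel.
Proof. by move=> s t; apply/asboolP/asboolP => h Z b /h. Qed.
Fact tens_rel_trans : transitive tens_rel.
Proof.
by move=> t s u /asboolP h1 /asboolP h2; apply/asboolP => Z b hb; rewrite h1 ?h2.
Qed.
Canonical tens_equiv := EquivRel tens_rel tens_rel_refl tens_rel_sym tens_rel_trans.

Definition tens : Type := {eq_quot tens_equiv}.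
HB.instance Definition _ := EqQuotient.on tens.
HB.instance Definition _ := Choice.on tens.

Definition tpi (s : seq (V * W)) : tens := \pi_tens s.
Definition tpure (x : V) (y : W) : tens := tpi [:: (x, y)].

Lemma tpiP s t : tpi s = tpi t <-> (forall (Z : zmodType) (b : V -> W -> Z),
  balanced b -> formal_eval b s = formal_eval b t).
Proof.
rewrite /tpi; split=> [/eqP|h]; last by apply/eqP; rewrite piE; apply/asboolP.
by rewrite piE => /asboolP.
Qed.

Lemma tpi_repr x : tpi (repr x) = x. Proof. exact: reprK. Qed.

Definition tlift (Z : zmodType) (b : V -> W -> Z) (x : tens) : Z :=
  formal_eval b (repr x).

Lemma tlift_pi (Z : zmodType) (b : V -> W -> Z) s :
  balanced b -> tlift b (tpi s) = formal_eval b s.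
Proof. by move=> hb; apply: (tpiP _ _).1 => //; apply: tpi_repr. Qed.

Lemma formal_eval_cat (Z : zmodType) (b : V -> W -> Z) s t :
  formal_eval b (s ++ t) = formal_eval b s + formal_eval b t.
Proof. by rewrite /formal_eval big_cat. Qed.

Lemma balanced0l (Z : zmodType) (b : V -> W -> Z) y : balanced b -> b 0 y = 0.
Proof. by case=> h _ _; apply: (addIr (b 0 y)); rewrite -h !add0r. Qed.

Lemma balanced0r (Z : zmodType) (b : V -> W -> Z) x : balanced b -> b x 0 = 0.
Proof. by case=> _ h _; apply: (addIr (b x 0)); rewrite -h !add0r. Qed.

Lemma balancedNl (Z : zmodType) (b : V -> W -> Z) x y : balanced b -> b (- x) y = - b x y.
Proof.
move=> hb; apply: (addIr (b x y)); rewrite addNr; case: (hb) => <- _ _.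
by rewrite addNr balanced0l.
Qed.

Definition formal_opp (s : seq (V * W)) := [seq (- u.1, u.2) | u <- s].

Lemma formal_eval_opp (Z : zmodType) (b : V -> W -> Z) s :
  balanced b -> formal_eval b (formal_opp s) = - formal_eval b s.
Proof.
move=> hb; rewrite /formal_eval big_map -sumrN; apply: eq_bigr => u _ /=.
exact: balancedNl.
Qed.

Definition tens_add (x y : tens) : tens := tpi (repr x ++ repr y).
Definition tens_opp (x : tens) : tens := tpi (formal_opp (repr x)).
Definition tens_zero : tens := tpi [::].

Lemma tens_addE s t : tens_add (tpi s) (tpi t) = tpi (s ++ t).
Proof.
by apply/tpiP => Z b hb; rewrite !formal_eval_cat -!/(tlift b _) !tlift_pi.
Qed.

Lemma tens_oppE s : tens_opp (tpi s) = tpi (formal_opp s).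
Proof.
by apply/tpiP => Z b hb; rewrite !formal_eval_opp // -!/(tlift b _) !tlift_pi.
Qed.

Fact tens_addA : associative tens_add.
Proof.
by move=> x y z; rewrite -(tpi_repr x) -(tpi_repr y) -(tpi_repr z) !tens_addE catA.
Qed.
Fact tens_addC : commutative tens_add.
Proof.
move=> x y; rewrite -(tpi_repr x) -(tpi_repr y) !tens_addE; apply/tpiP => Z b _.
by rewrite !formal_eval_cat addrC.
Qed.
Fact tens_add0 : left_id tens_zero tens_add.
Proof. by move=> x; rewrite -(tpi_repr x) tens_addE. Qed.
Fact tens_addN : left_inverse tens_zero tens_opp tens_add.
Proof.
move=> x; rewrite -(tpi_repr x) tens_oppE tens_addE; apply/tpiP => Z b hb.
by rewrite formal_eval_cat formal_eval_opp // addNr /formal_eval big_nil.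
Qed.

HB.instance Definition _ :=
  GRing.isZmodule.Build tens tens_addA tens_addC tens_add0 tens_addN.

Lemma tpi_cat s t : tpi (s ++ t) = tpi s + tpi t.
Proof. by rewrite -tens_addE. Qed.

Lemma tpi_sum s : tpi s = \sum_(u <- s) tpure u.1 u.2.
Proof.
elim: s => [|[x y] s IH]; first by rewrite big_nil.
by rewrite big_cons -IH /tpure -tpi_cat.
Qed.

Lemma tens_ind (P : tens -> Prop) : P 0 -> (forall x y, P x -> P y -> P (x + y)) ->
  (forall x y, P (tpure x y)) -> forall x, P x.
Proof.
move=> P0 PD Pp x; rewrite -(tpi_repr x) tpi_sum.
by elim/big_ind: _ => // -[a b] _; apply: Pp.
Qed.

Lemma tliftD (Z : zmodType) (b : V -> W -> Z) x y :
  balanced b -> tlift b (x + y) = tlift b x + tlift b y.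
Proof.
move=> hb; rewrite -(tpi_repr x) -(tpi_repr y) -tpi_cat !tlift_pi //.
exact: formal_eval_cat.
Qed.

Lemma tlift0 (Z : zmodType) (b : V -> W -> Z) : balanced b -> tlift b 0 = 0.
Proof. by move=> hb; rewrite -[0]/(tpi [::]) tlift_pi // /formal_eval big_nil. Qed.

Lemma tlift_pure (Z : zmodType) (b : V -> W -> Z) x y :
  balanced b -> tlift b (tpure x y) = b x y.
Proof. by move=> hb; rewrite tlift_pi // /formal_eval big_seq1. Qed.

Lemma balanced_tpure : balanced tpure.
Proof.
split=> [x x' y|x y y'|k x y]; rewrite -?tpi_cat; apply/tpiP => Z b [h1 h2 h3];
  by rewrite /formal_eval !unlock /= ?addr0 ?h1 ?h2 ?h3.
Qed.

Lemma tpureDl x x' y : tpure (x + x') y = tpure x y + tpure x' y.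
Proof. by case: balanced_tpure. Qed.
Lemma tpureDr x y y' : tpure x (y + y') = tpure x y + tpure x y'.
Proof. by case: balanced_tpure. Qed.
Lemma tpure_bal k x y : tpure (aV k x) y = tpure x (aW k y).
Proof. by case: balanced_tpure. Qed.
Lemma tpure0l y : tpure 0 y = 0. Proof. exact/balanced0l/balanced_tpure. Qed.
Lemma tpure0r x : tpure x 0 = 0. Proof. exact/balanced0r/balanced_tpure. Qed.

Lemma tlift_add (Z : zmodType) (b c : V -> W -> Z) x :
  tlift (fun u w => b u w + c u w) x = tlift b x + tlift c x.
Proof. by rewrite /tlift /formal_eval big_split. Qed.

Lemma eq_tlift (Z : zmodType) (b c : V -> W -> Z) x :
  (forall u w, b u w = c u w) -> tlift b x = tlift c x.
Proof. by move=> h; apply: eq_bigr => u _. Qed.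

End Tensor.

Definition tmap (B B' : Type) (V W V' W' : zmodType) (aV : B -> V -> V) (aW : B -> W -> W)
    (aV' : B' -> V' -> V') (aW' : B' -> W' -> W') (f : V -> V') (g : W -> W') :
    tens aV aW -> tens aV' aW' :=
  tlift (fun x y => tpure aV' aW' (f x) (g y)).

Section ScalarExtension.
Variables (K : fieldType) (L : comAlgType K).

Definition mod_ext (A : comAlgType K) (P : lmodType A) : Type :=
  tens (fun (k : K) (x : P) => k%:A *: x) (fun (k : K) (l : L) => k *: l).

Definition mpure (A : comAlgType K) (P : lmodType A) (x : P) (l : L) : mod_ext P :=
  tpure _ _ x l.

Section Action.
Variables (A : comAlgType K) (P : lmodType A).
HB.instance Definition _ := GRing.Zmodule.on (mod_ext P).

Definition ext_act (f : mod_ext (A^o : lmodType A)) (x : mod_ext P) : mod_ext P :=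
  tlift (fun (a : A) l => tlift (fun (u : P) m => mpure (a *: u) (l * m)) x) f.

Fact ext_act_bal1 (a : A) (l : L) :
  balanced (fun (k : K) (x : P) => k%:A *: x) (fun (k : K) (l : L) => k *: l)
    (fun (u : P) m => mpure (a *: u) (l * m)).
Proof.
split=> [x x' y|x y y'|k x y]; rewrite /mpure.
- by rewrite scalerDr tpureDl.
- by rewrite mulrDr tpureDr.
- by rewrite scalerA mulrC -scalerA tpure_bal scalerAr.
Qed.

Fact ext_act_bal2 (x : mod_ext P) :
  balanced (fun (k : K) (x : A^o) => k%:A *: x) (fun (k : K) (l : L) => k *: l)
    (fun (a : A) l => tlift (fun (u : P) m => mpure (a *: u) (l * m)) x).
Proof.
split=> [a b l|a l m|k a l].
- by rewrite -tlift_add; apply: eq_tlift => u m; rewrite scalerDl /mpure tpureDl.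
- by rewrite -tlift_add; apply: eq_tlift => u n; rewrite mulrDl /mpure tpureDr.
- by apply: eq_tlift => u m; rewrite -scalerA /mpure tpure_bal scalerAl.
Qed.

Lemma ext_act_pure (a : A) l (u : P) m :
  ext_act (mpure (a : A^o) l) (mpure u m) = mpure (a *: u) (l * m).
Proof.
by rewrite /ext_act (tlift_pure _ _ (ext_act_bal2 _)) (tlift_pure _ _ (ext_act_bal1 _ _)).
Qed.

Lemma ext_actDl f g x : ext_act (f + g) x = ext_act f x + ext_act g x.
Proof. exact: tliftD (ext_act_bal2 _). Qed.

Lemma ext_actDr f x y : ext_act f (x + y) = ext_act f x + ext_act f y.
Proof.
by rewrite -tlift_add; apply: eq_tlift => a l; apply: tliftD (ext_act_bal1 _ _).
Qed.

Lemma ext_act0l x : ext_act 0 x = 0.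
Proof. exact: tlift0 (ext_act_bal2 _). Qed.

Lemma ext_act0r f : ext_act f 0 = 0.
Proof. by apply: (addIr (ext_act f 0)); rewrite -ext_actDr !add0r. Qed.

Lemma ext_act1 x : ext_act (mpure (1 : A^o) 1) x = x.
Proof.
elim/tens_ind: x => [|x y hx hy|u m]; first exact: ext_act0r.
  by rewrite ext_actDr hx hy.
by rewrite ext_act_pure scale1r mul1r.
Qed.

End Action.

Section ExtTheory.
Variables (A : comAlgType K) (P : lmodType A).

Lemma ext_actA f g (x : mod_ext P) : ext_act f (ext_act g x) = ext_act (ext_act f g) x.
Proof.
elim/tens_ind: f => [|f f' hf hf'|a l]; first by rewrite !ext_act0l.
  by rewrite !ext_actDl hf hf'.
elim/tens_ind: g => [|g g' hg hg'|b m]; first by rewrite ext_act0r !ext_act0l ext_act0r.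
  by rewrite !(ext_actDl, ext_actDr) hg hg'.
elim/tens_ind: x => [|x x' hx hx'|u n]; first by rewrite !ext_act0r.
  by rewrite !ext_actDr hx hx'.
by rewrite !ext_act_pure scalerA mulrA.
Qed.

Lemma ext_actC f g : ext_act f g = ext_act g f :> mod_ext (A^o : lmodType A).
Proof.
elim/tens_ind: f => [|f f' hf hf'|a l]; first by rewrite ext_act0l ext_act0r.
  by rewrite ext_actDl ext_actDr hf hf'.
elim/tens_ind: g => [|g g' hg hg'|b m]; first by rewrite ext_act0l ext_act0r.
  by rewrite ext_actDl ext_actDr hg hg'.
by rewrite !ext_act_pure [l * _]mulrC; congr mpure; apply: mulrC.
Qed.

End ExtTheory.

Definition alg_ext (A : comAlgType K) : Type := mod_ext (A^o : lmodType A).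

Section Ring.
Variable A : comAlgType K.
HB.instance Definition _ := GRing.Zmodule.on (alg_ext A).

Definition apure (a : A) (l : L) : alg_ext A := mpure (a : A^o) l.

HB.instance Definition _ := GRing.Zmodule_isComPzRing.Build (alg_ext A)
  (@ext_actA A A^o) (@ext_actC A) (@ext_act1 A A^o) (fun f g h => @ext_actDl A A^o f g h).

Variable P : lmodType A.

HB.instance Definition _ := GRing.Zmodule_isLmodule.Build (alg_ext A) (mod_ext P)
  (@ext_actA A P) (@ext_act1 A P) (@ext_actDr A P) (fun x f g => ext_actDl f g x).

Lemma apureM (a b : A) l m : apure a l * apure b m = apure (a * b) (l * m).
Proof. exact: (@ext_act_pure A A^o). Qed.

Lemma apureZ (a : A) l (u : P) m : apure a l *: mpure u m = mpure (a *: u) (l * m).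
Proof. exact: ext_act_pure. Qed.

End Ring.

End ScalarExtension.

Section RootsOfUnity.
Variables (p : nat) (K : fieldType) (Kbar : closedFieldType) (iota : {rmorphism K -> Kbar}).

Definition is_subfield (S : Kbar -> Prop) : Prop :=
  [/\ S 1, forall x y, S x -> S y -> S (x - y) & forall x y, S x -> S y -> S (x / y)].

(* K(Gamma): the smallest subfield of Kbar containing K and the p-power roots of unity *)
Definition KGamma_pred : {pred Kbar} := fun x =>
  `[< forall S : Kbar -> Prop, is_subfield S -> (forall a, S (iota a)) ->
        (forall s z, (0 < s)%N -> z ^+ (p ^ s) = 1 -> S z) -> S x >].

Fact KGamma_closed : divring_closed KGamma_pred.
Proof.
split=> [|x y /asboolP hx /asboolP hy|x y /asboolP hx /asboolP hy];
  apply/asboolP => S hS hK hG; case: (hS) => // _ hB hD.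
  by apply: hB; [apply: hx|apply: hy].
by apply: hD; [apply: hx|apply: hy].
Qed.

HB.instance Definition _ := GRing.isDivringClosed.Build Kbar KGamma_pred KGamma_closed.

Lemma KGamma_iota a : iota a \in KGamma_pred.
Proof. by apply/asboolP => S _ + _; apply. Qed.

Definition KGamma : Type := {x : Kbar | x \in KGamma_pred}.

HB.instance Definition _ := SubChoice.on KGamma.
HB.instance Definition _ := [SubChoice_isSubComUnitRing of KGamma by <:].
HB.instance Definition _ := [SubComUnitRing_isSubIntegralDomain of KGamma by <:].
HB.instance Definition _ := [SubIntegralDomain_isSubField of KGamma by <:].

Definition KGamma_in (a : K) : KGamma := Sub (iota a) (KGamma_iota a).
Definition KGamma_scale (a : K) (x : KGamma) : KGamma := KGamma_in a * x.

Fact KGamma_scaleA a b x : KGamma_scale a (KGamma_scale b x) = KGamma_scale (a * b) x.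
Proof. by apply: val_inj; rewrite /= rmorphM mulrA. Qed.
Fact KGamma_scale1 : left_id 1 KGamma_scale.
Proof. by move=> x; apply: val_inj; rewrite /= rmorph1 mul1r. Qed.
Fact KGamma_scaleDr : right_distributive KGamma_scale +%R.
Proof. by move=> a x y; rewrite /KGamma_scale mulrDr. Qed.
Fact KGamma_scaleDl x : {morph KGamma_scale^~ x : a b / a + b}.
Proof. by move=> a b; apply: val_inj; rewrite /= rmorphD mulrDl. Qed.

HB.instance Definition _ := GRing.Zmodule_isLmodule.Build K KGamma
  KGamma_scaleA KGamma_scale1 KGamma_scaleDr KGamma_scaleDl.

Fact KGamma_scaleAl (a : K) (x y : KGamma) : a *: (x * y) = a *: x * y.
Proof. exact: mulrA. Qed.

HB.instance Definition _ := GRing.Lmodule_isLalgebra.Build K KGamma KGamma_scaleAl.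
HB.instance Definition _ := GRing.Lalgebra_isComAlgebra.Build K KGamma.

Record Gamma_tuple (n : nat) := GammaTuple {
  gtup :> 'I_n -> KGamma;
  gtupP : forall j, exists2 s, (0 < s)%N & gtup j ^+ (p ^ s) = 1
}.

Definition Gamma_level n (k : nat) (z : Gamma_tuple n) : Prop :=
  forall j, z j ^+ (p ^ k) = 1.

Fact gtup1P n (j : 'I_n) : exists2 s, (0 < s)%N & (1 : KGamma) ^+ (p ^ s) = 1.
Proof. by exists 1%N; rewrite // expr1n. Qed.

Fact gtupMP n (z w : Gamma_tuple n) j : exists2 s, (0 < s)%N & (z j * w j) ^+ (p ^ s) = 1.
Proof.
have [s s0 hs] := gtupP z j; have [t t0 ht] := gtupP w j.
exists (s + t)%N; first by rewrite addn_gt0 s0.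
by rewrite exprMn expnD exprM hs mulnC exprM ht !expr1n mulr1.
Qed.

Fact gtup_galP n (sigma : {rmorphism KGamma -> KGamma}) (z : Gamma_tuple n) j :
  exists2 s, (0 < s)%N & (sigma (z j)) ^+ (p ^ s) = 1.
Proof. by have [s s0 hs] := gtupP z j; exists s => //; rewrite -rmorphXn hs rmorph1. Qed.

Definition gtup1 n : Gamma_tuple n := GammaTuple (@gtup1P n).
Definition gtupM n (z w : Gamma_tuple n) : Gamma_tuple n := GammaTuple (gtupMP z w).
Definition gtup_gal n (sigma : {rmorphism KGamma -> KGamma}) (z : Gamma_tuple n) :
  Gamma_tuple n := GammaTuple (gtup_galP sigma z).

Definition is_galois (sigma : {rmorphism KGamma -> KGamma}) : Prop :=
  bijective sigma /\ forall a : K, sigma a%:A = a%:A.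

End RootsOfUnity.

Section Substitution.
Variables (p : nat) (R : realType) (K : fieldType) (v : complete_abs R K).
Variables (Kbar : closedFieldType) (iota : {rmorphism K -> Kbar}) (n : nat).
Local Notation KG := (KGamma p iota).
Local Notation mi := (multi_index n).
Variable C : laurent_class v n.
Local Notation A := (laurent_ring C).

(* the coefficient of t^i, in K(Gamma), of an element of A (x)_K K(Gamma) *)
Definition ext_coef (i : mi) (x : alg_ext KG A) : KG :=
  tlift (fun (f : A) (l : KG) => f i *: l) x.

Fact ext_coef_bal i : balanced (fun (k : K) (x : A^o) => k%:A *: x)
  (fun (k : K) (l : KG) => k *: l) (fun (f : A) (l : KG) => f i *: l).
Proof.
split=> [f g l|f l m|k f l]; first by rewrite -scalerDl.
  by rewrite scalerDr.
have -> : (k%:A : A) *: (f : A^o) = k *: f :> A by rewrite -[LHS]scalerAl mul1r.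
by rewrite scalerA mulrC.
Qed.

Lemma ext_coefD i x y : ext_coef i (x + y) = ext_coef i x + ext_coef i y.
Proof. exact: tliftD (ext_coef_bal i). Qed.

Lemma ext_coef0 i : ext_coef i 0 = 0.
Proof. exact: tlift0 (ext_coef_bal i). Qed.

Lemma ext_coef_pure i (f : A) l : ext_coef i (apure f l) = f i *: l.
Proof. exact: tlift_pure (ext_coef_bal i). Qed.

Lemma ext_coef_sum (I : Type) (s : seq I) (F : I -> alg_ext KG A) i :
  ext_coef i (\sum_(k <- s) F k) = \sum_(k <- s) ext_coef i (F k).
Proof.
by elim/big_rec2: _ => [|k x y _ <-]; rewrite ?ext_coef0 ?ext_coefD.
Qed.

Lemma ext_coefB i x y : ext_coef i (x - y) = ext_coef i x - ext_coef i y.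
Proof. by apply/eqP; rewrite eq_sym subr_eq -ext_coefD subrK. Qed.

Lemma ext_coef_inj x y : (forall i, ext_coef i x = ext_coef i y) -> x = y.
Proof.
pose aV (k : K) (x : A^o) := k%:A *: x; pose aW (k : K) (l : KG) := k *: l.
suff key N (s : seq (A^o * KG)) : (size s <= N)%N ->
    (forall i, ext_coef i (tpi aV aW s) = 0) -> tpi aV aW s = 0.
  move=> h; apply/eqP; rewrite -subr_eq0; apply/eqP; rewrite -[x - y]tpi_repr.
  by apply: key (leqnn _) _ => i; rewrite tpi_repr ext_coefB h subrr.
elim: N s => [|N IH] [|[f l] s] //= hs h.
have coefE i t : ext_coef i (tpi aV aW t) = \sum_(u <- t) (u.1 : A) i *: u.2.
  exact: tlift_pi (ext_coef_bal i).
have {}h i : f i *: l + \sum_(u <- s) (u.1 : A) i *: u.2 = 0.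
  by rewrite -[RHS](h i) coefE big_cons.
have [[i fi]|f0] := pselect (exists i, (f : A) i != 0); last first.
  have {}f0 : f = 0.
    apply: lring_inj => i; rewrite lcoef0; apply/eqP/negP => /negP fi.
    by apply: f0; exists i.
  rewrite -cat1s tpi_cat -/(tpure aV aW f l) f0 tpure0l add0r; apply: IH => // i.
  by rewrite coefE -[RHS](h i) f0 lcoef0 scale0r add0r.
pose q (u : A^o * KG) : A^o * KG := ((u.1 : A) - ((u.1 : A) i / f i) *: (f : A), u.2).
have lE : l = - \sum_(u <- s) ((u.1 : A) i / f i) *: u.2.
  apply: (scalerI fi); rewrite scalerN scaler_sumr.
  rewrite -[LHS](addrK (\sum_(u <- s) (u.1 : A) i *: u.2)) h sub0r.
  by congr (- _); apply: eq_bigr => u _; rewrite scalerA mulrC divfK.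
have sE : tpi aV aW ((f, l) :: s) = tpi aV aW (map q s).
  rewrite !tpi_sum big_cons big_map /= lE.
  have bal := balanced_tpure aV aW.
  have -> : tpure aV aW f (- \sum_(u <- s) ((u.1 : A) i / f i) *: u.2) =
     \sum_(u <- s) tpure aV aW (- ((u.1 : A) i / f i *: (f : A))) u.2.
    rewrite -sumrN; elim: (s) => [|u t IHt]; first by rewrite !big_nil tpure0r.
    rewrite !big_cons tpureDr IHt; congr (_ + _).
    rewrite -scaleNr -[_ *: u.2]/(aW _ _) -tpure_bal /aV; congr tpure.
    by rewrite -scaleNr -[LHS]scalerAl mul1r.
  rewrite -big_split; apply: eq_bigr => u _ /=.
  by rewrite -tpureDl addrC.
rewrite sE; apply: IH => [|j]; first by rewrite size_map.
rewrite coefE big_map /=.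
have := h j; rewrite {1}lE scalerN scaler_sumr addrC -sumrB => hj; rewrite -[RHS]hj.
apply: eq_bigr => u _; rewrite scalerA -scalerBl; congr (_ *: _).
by rewrite /= mulN1r [f j * _]mulrC.
Qed.

(* zeta^*(f(t)) = f(zeta t) multiplies the coefficient of t^i by zeta^i. Such an
   element of the tensor product exists (gsubst_ex) and is unique (ext_coef_inj). *)
Definition is_gsubst (z : Gamma_tuple p iota n) (f g : alg_ext KG A) : Prop :=
  forall i, ext_coef i g = monomial z i * ext_coef i f.

Definition gsubst (z : Gamma_tuple p iota n) (f : alg_ext KG A) : alg_ext KG A :=
  xget 0 (is_gsubst z f).

Lemma Gamma_uniform (z : Gamma_tuple p iota n) : exists k, forall j, z j ^+ (p ^ k) = 1.
Proof.
pose s j := sval (cid2 (gtupP z j)).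
exists (\sum_j s j)%N => j; rewrite (bigD1 j) //= expnD exprM.
by rewrite /s; case: cid2 => t _ /= ->; rewrite expr1n.
Qed.

Lemma gsubst_ex z f : (0 < p)%N -> exists g, is_gsubst z f g.
Proof.
move=> p0; have [k hk] := Gamma_uniform z; pose N := (p ^ k)%N.
have N0 : (0 < N)%N by rewrite expn_gt0 p0.
have z0 j : z j != 0.
  by apply/eqP => zj; move/eqP: (hk j); rewrite zj expr0n gtn_eqF // eq_sym oner_eq0.
elim/tens_ind: f => [|f f' [g hg] [g' hg']|f l].
- by exists 0 => i; rewrite -[LHS]/(ext_coef i 0) ext_coef0 mulr0.
- by exists (g + g') => i; rewrite !ext_coefD hg hg' -mulrDr.
pose I := {ffun 'I_n -> 'I_N}.
pose D (r : I) (i : mi) := [forall j, (r j : nat) == absz (i j %% N%:Z)%Z].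
pose zr (r : I) : KG := \prod_j z j ^+ r j.
exists (\sum_(r : I) apure (lmask (D r) (f : A)) (zr r * l)) => i.
have modlt j : (absz (i j %% N%:Z)%Z < N)%N.
  have : (0 <= (i j %% N%:Z)%Z < N%:Z)%R.
    by rewrite modz_ge0 ?ltz_pmod // ?gtn_eqF //; apply/eqP; lia.
  by lia.
pose r0 : I := [ffun j => Ordinal (modlt j)].
rewrite ext_coef_sum (bigD1 r0) //= big1 ?addr0 => [|r rr0]; last first.
  rewrite ext_coef_pure /=; case: ifP; rewrite ?scale0r // => /forallP hr.
  case/eqP: rr0; apply/ffunP => j; apply: val_inj; rewrite ffunE /=.
  exact/eqP.
rewrite ext_coef_pure /= ifT; last by apply/forallP => j; rewrite ffunE.
have -> : ext_coef i (tpure _ _ f l) = (f : A) i *: l by exact: ext_coef_pure.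
rewrite -scalerAr; congr (_ *: (_ * l)); apply: eq_bigr => j _.
rewrite ffunE /=.
have m0 : (0 <= i j %% N%:Z)%Z by rewrite modz_ge0 // lt0r_neq0 // ltz_nat.
rewrite [in RHS](divz_eq (i j) N%:Z) expfzDr // [(_ %/ _)%Z * _]mulrC -exprz_exp.
by rewrite -[z j ^ N%:Z]/(z j ^+ N) hk exp1rz mul1r -[in RHS](gez0_abs m0).
Qed.

Lemma gsubstE z f i : (0 < p)%N -> ext_coef i (gsubst z f) = monomial z i * ext_coef i f.
Proof. by move=> p0; have [g hg] := gsubst_ex z f p0; apply: (xgetI _ hg). Qed.

Definition semilinear_action (P : lmodType A)
    (act : Gamma_tuple p iota n -> mod_ext KG P -> mod_ext KG P) : Prop :=
  [/\ forall x, act (gtup1 p iota n) x = x,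
      forall z w x, act (gtupM z w) x = act z (act w x),
      forall z x y, act z (x + y) = act z x + act z y &
      forall z f x, act z (f *: x) = gsubst z f *: act z x].

End Substitution.

Section Norms.
Variables (p : nat) (R : realType) (K : fieldType) (v : complete_abs R K).
Variables (Kbar : closedFieldType) (iota : {rmorphism K -> Kbar}).
Variables (w : nonarch_abs R Kbar) (n : nat).
Local Notation KG := (KGamma p iota).
Local Open Scope classical_set_scope.

(* The norms take values in the extended reals so that no finiteness is presupposed. *)
Definition gauss_norm (C : laurent_class v n) (rho : 'I_n -> R)
    (f : alg_ext KG (laurent_ring C)) : \bar R :=
  ereal_sup [set (w (val (ext_coef i f)) * monomial rho i)%:E | i in [set: multi_index n]].

Definition normJ (J : polysegment R n) (f : alg_ext KG (KJ v J)) : \bar R :=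
  ereal_sup [set gauss_norm rho f | rho in [set r | in_polysegment J r]].

Definition mxnormJ (J : polysegment R n) (m m' : nat)
    (E : 'M[alg_ext KG (KJ v J)]_(m, m')) : \bar R :=
  \big[maxe/0%E]_i \big[maxe/0%E]_j normJ (E i j).

End Norms.

Definition is_basis (A : pzRingType) (P : lmodType A) (m : nat) (e : 'I_m -> P) : Prop :=
  forall x, exists! c : {ffun 'I_m -> A}, x = \sum_i c i *: e i.

Definition finite_free (A : pzRingType) (P : lmodType A) : Prop :=
  exists m (e : 'I_m -> P), is_basis e.

Section Objects.
Variables (p : nat) (R : realType) (K : fieldType) (v : complete_abs R K).
Variables (Kbar : closedFieldType) (iota : {rmorphism K -> Kbar}).
Variables (w : nonarch_abs R Kbar) (n : nat).
Variables (rho : 'I_n -> R) (rho0 : forall k, 0 < rho k).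
Local Notation KG := (KGamma p iota).
Local Notation Rr := (Rrho v rho0).
Local Notation gtuple := (Gamma_tuple p iota n).
Local Notation ext := (mod_ext KG).

Definition ext_map (A B : comAlgType K) (P : lmodType A) (Q : lmodType B) (f : P -> Q) :
    ext P -> ext Q :=
  tmap _ _ f id.

Definition gal_map (A : comAlgType K) (P : lmodType A) (sigma : {rmorphism KG -> KG}) :
    ext P -> ext P :=
  tmap _ _ id sigma.

(* P is extended from P' along j: the map R_rho (x)_{K_{J,n}} P' -> P given by
   r (x) x |-> r j(x) is an isomorphism. *)
Definition extended_from (J : polysegment R n) (hJ : in_interior J rho)
    (P' : lmodType (KJ v J)) (P : lmodType Rr) (j : P' -> P) : Prop :=
  [/\ forall x y, j (x + y) = j x + j y,
      forall a x, j (a *: x) = germ rho0 hJ a *: j x &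
      bijective (tlift (fun (r : Rr) (x : P') => r *: j x) :
        tens (fun (a : KJ v J) (r : Rr) => germ rho0 hJ a * r)
             (fun (a : KJ v J) (x : P') => a *: x) -> P)].

Definition growth_bound (J : polysegment R n) (P' : lmodType (KJ v J))
    (act : gtuple -> ext P' -> ext P') : Prop :=
  exists m (e : 'I_m -> P'), is_basis e /\
  exists2 l : R, 0 < l & forall k (z : gtuple), (0 < k)%N -> Gamma_level k z ->
    exists2 E : 'M[alg_ext KG (KJ v J)]_m,
      forall j, act z (mpure (e j) 1) = \sum_i E i j *: mpure (e i) 1 &
      (mxnormJ w E <= (p%:R `^ (l * k%:R))%:E)%E.

Record Crho_obj := CrhoObj {
  Cmod :> lmodType Rr;
  Cact : gtuple -> ext Cmod -> ext Cmod;
  Cfree : finite_free Cmod;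
  Csemilinear : semilinear_action Cact;
  Cextended : exists (J : polysegment R n) (hJ : in_interior J rho)
      (P' : lmodType (KJ v J)) (act' : gtuple -> ext P' -> ext P') (j : P' -> Cmod),
    [/\ finite_free P', extended_from hJ j, semilinear_action act',
        forall z x, Cact z (ext_map j x) = ext_map j (act' z x) &
        growth_bound act'];
  Cgalois : forall (sigma : {rmorphism KG -> KG}), is_galois sigma ->
    forall z x, gal_map sigma (Cact z x) = Cact (gtup_gal sigma z) (gal_map sigma x)
}.

Section ExtMap.
Variables (A : comAlgType K) (P Q T : lmodType A).
Implicit Types (f g : P -> Q) (h : Q -> T).

Lemma ext_map_bal f : linear f ->
  balanced (fun (k : K) (x : P) => k%:A *: x) (fun (k : K) (l : KG) => k *: l)
    (fun x l => mpure (f x) l).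
Proof.
move=> hf; split=> [x x' y|x y y'|k x y]; rewrite /mpure.
- by rewrite -[x]scale1r hf !scale1r tpureDl.
- by rewrite tpureDr.
- have -> : f (k%:A *: x) = k%:A *: f x.
    have f0 : f 0 = 0.
      by apply: (addIr (f 0)); rewrite -{1}[f 0]scale1r -hf scale1r !add0r.
    by rewrite -[_ *: x]addr0 hf f0 addr0.
  exact: tpure_bal.
Qed.

Lemma ext_map_pure f x l : linear f -> ext_map f (mpure x l) = mpure (f x) l.
Proof. by move=> hf; apply: tlift_pure (ext_map_bal hf). Qed.

Lemma ext_mapD f x y : linear f -> ext_map f (x + y) = ext_map f x + ext_map f y.
Proof. by move=> hf; apply: tliftD (ext_map_bal hf). Qed.

Lemma ext_map0 f : linear f -> ext_map f 0 = 0.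
Proof. by move=> hf; apply: tlift0 (ext_map_bal hf). Qed.

Lemma ext_map_add f g x :
  ext_map (fun u => f u + g u) x = ext_map f x + ext_map g x.
Proof.
rewrite -[RHS]tlift_add; apply: eq_tlift => u l; exact: tpureDl.
Qed.

Lemma ext_map_zero x : ext_map (fun _ : P => 0 : Q) x = 0.
Proof.
have h : linear (fun _ : P => 0 : Q) by move=> a u u'; rewrite scaler0 addr0.
elim/tens_ind: x => [|x y hx hy|u l]; first exact: ext_map0.
  by rewrite ext_mapD // hx hy addr0.
by rewrite (ext_map_pure _ _ h); apply: tpure0l.
Qed.

End ExtMap.

Lemma ext_map_id (A : comAlgType K) (P : lmodType A) (x : ext P) :
  ext_map (fun u : P => u) x = x.
Proof.
have h : linear (fun u : P => u) by [].
elim/tens_ind: x => [|x y hx hy|u l]; first exact: ext_map0.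
  by rewrite ext_mapD // hx hy.
exact: ext_map_pure.
Qed.

Lemma linear_comp (A : pzRingType) (P Q T : lmodType A) (g : Q -> T) (f : P -> Q) :
  linear g -> linear f -> linear (fun x => g (f x)).
Proof. by move=> hg hf a x y; rewrite hf hg. Qed.

Lemma ext_map_comp (A : comAlgType K) (P Q T : lmodType A) (g : Q -> T) (f : P -> Q) x :
  linear g -> linear f -> ext_map (fun u => g (f u)) x = ext_map g (ext_map f x).
Proof.
move=> hg hf; have h := linear_comp hg hf.
elim/tens_ind: x => [|x y hx hy|u l]; first by rewrite !ext_map0.
  by rewrite !ext_mapD // hx hy.
by rewrite -/(mpure u l) !ext_map_pure.
Qed.

Lemma CactD (P : Crho_obj) z x y : Cact (c := P) z (x + y) = Cact z x + Cact z y.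
Proof. by case: (Csemilinear P) => _ _ h _; apply: h. Qed.

Lemma Cact0 (P : Crho_obj) z : Cact (c := P) z 0 = 0.
Proof. by apply: (addIr (Cact z 0)); rewrite -CactD !add0r. Qed.

Section Hom.
Variables P Q : Crho_obj.

Record Crho_hom := CrhoHom {
  Cfun :> P -> Q;
  Clinear : linear Cfun;
  Cequiv : forall z x, Cact z (ext_map Cfun x) = ext_map Cfun (Cact z x)
}.

HB.instance Definition _ := gen_eqMixin Crho_hom.
HB.instance Definition _ := gen_choiceMixin Crho_hom.

Lemma Crho_hom_inj (f g : Crho_hom) : (forall x, f x = g x) -> f = g.
Proof.
case: f g => f lf ef [g lg eg] /= /funext h; rewrite h in lf ef *.
by congr CrhoHom; apply: Prop_irrelevance.
Qed.

Fact hom_zero_linear : linear (fun _ : P => 0 : Q).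
Proof. by move=> a u u'; rewrite scaler0 addr0. Qed.

Fact hom_zero_equiv z x :
  Cact z (ext_map (fun _ : P => 0 : Q) x) = ext_map (fun _ : P => 0 : Q) (Cact z x).
Proof. by rewrite !ext_map_zero Cact0. Qed.

Definition hom_zero : Crho_hom := CrhoHom hom_zero_linear hom_zero_equiv.

Fact hom_add_linear (f g : Crho_hom) : linear (fun x => f x + g x).
Proof. by move=> a x y; rewrite !Clinear scalerDr addrACA. Qed.

Fact hom_add_equiv (f g : Crho_hom) z x :
  Cact z (ext_map (fun x => f x + g x) x) = ext_map (fun x => f x + g x) (Cact z x).
Proof. by rewrite !ext_map_add CactD !Cequiv. Qed.

Definition hom_add (f g : Crho_hom) : Crho_hom :=
  CrhoHom (hom_add_linear f g) (hom_add_equiv f g).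

Fact hom_opp_linear (f : Crho_hom) : linear (fun x => - f x).
Proof. by move=> a x y; rewrite Clinear opprD scalerN. Qed.

Fact hom_opp_equiv (f : Crho_hom) z x :
  Cact z (ext_map (fun x => - f x) x) = ext_map (fun x => - f x) (Cact z x).
Proof.
have opp y : ext_map (fun x => - f x) y = - ext_map f y.
  apply: (addIr (ext_map f y)); rewrite -ext_map_add addNr -[RHS](ext_map_zero Q y).
  by congr ext_map; apply/funext => u; rewrite addNr.
apply: (addIr (Cact z (ext_map f x))); rewrite -CactD !opp addNr Cact0.
by rewrite Cequiv addNr.
Qed.

Definition hom_opp (f : Crho_hom) : Crho_hom :=
  CrhoHom (hom_opp_linear f) (hom_opp_equiv f).

Fact hom_addA : associative hom_add.
Proof. by move=> f g h; apply: Crho_hom_inj => x /=; rewrite addrA. Qed.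
Fact hom_addC : commutative hom_add.
Proof. by move=> f g; apply: Crho_hom_inj => x /=; rewrite addrC. Qed.
Fact hom_add0 : left_id hom_zero hom_add.
Proof. by move=> f; apply: Crho_hom_inj => x /=; rewrite add0r. Qed.
Fact hom_addN : left_inverse hom_zero hom_opp hom_add.
Proof. by move=> f; apply: Crho_hom_inj => x /=; rewrite addNr. Qed.

HB.instance Definition _ :=
  GRing.isZmodule.Build Crho_hom hom_addA hom_addC hom_add0 hom_addN.

End Hom.

Fact hom_id_equiv (P : Crho_obj) z x :
  Cact (c := P) z (ext_map (fun u : P => u) x) = ext_map (fun u : P => u) (Cact z x).
Proof. by rewrite !ext_map_id. Qed.

Definition hom_id (P : Crho_obj) : Crho_hom P P :=
  CrhoHom (fun _ _ _ => erefl) (@hom_id_equiv P).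

Fact hom_comp_equiv (P Q T : Crho_obj) (g : Crho_hom Q T) (f : Crho_hom P Q) z x :
  Cact z (ext_map (fun u => g (f u)) x) = ext_map (fun u => g (f u)) (Cact z x).
Proof.
by rewrite !(ext_map_comp _ (Clinear g) (Clinear f)) !Cequiv.
Qed.

Definition hom_comp (P Q T : Crho_obj) (g : Crho_hom Q T) (f : Crho_hom P Q) :
  Crho_hom P T := CrhoHom (linear_comp (Clinear g) (Clinear f)) (hom_comp_equiv g f).

End Objects.

(* abelian categories in the sense of Mac Lane *)
Record preadditive_category := PreadditiveCategory {
  ob :> Type;
  hom : ob -> ob -> zmodType;
  idm : forall a, hom a a;
  cmp : forall a b c, hom b c -> hom a b -> hom a c;
  cmpA : forall a b c d (h : hom c d) (g : hom b c) (f : hom a b),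
    cmp h (cmp g f) = cmp (cmp h g) f;
  cmp1l : forall a b (f : hom a b), cmp (idm b) f = f;
  cmp1r : forall a b (f : hom a b), cmp f (idm a) = f;
  cmpDl : forall a b c (g g' : hom b c) (f : hom a b),
    cmp (g + g') f = cmp g f + cmp g' f;
  cmpDr : forall a b c (g : hom b c) (f f' : hom a b),
    cmp g (f + f') = cmp g f + cmp g f'
}.

Section Abelian.
Variable C : preadditive_category.
Implicit Types a b c x : C.

Definition is_zero_object (z : C) : Prop :=
  forall a, (forall f g : hom z a, f = g) /\ (forall f g : hom a z, f = g).

Definition is_biproduct a b (s : C) (i1 : hom a s) (i2 : hom b s)
    (p1 : hom s a) (p2 : hom s b) : Prop :=
  [/\ cmp p1 i1 = idm a, cmp p2 i2 = idm b, cmp p1 i2 = 0, cmp p2 i1 = 0 &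
      cmp i1 p1 + cmp i2 p2 = idm s].

Definition is_kernel a b (f : hom a b) (k : C) (i : hom k a) : Prop :=
  cmp f i = 0 /\
  forall x (g : hom x a), cmp f g = 0 -> exists! h : hom x k, cmp i h = g.

Definition is_cokernel a b (f : hom a b) (q : C) (r : hom b q) : Prop :=
  cmp r f = 0 /\
  forall x (g : hom b x), cmp g f = 0 -> exists! h : hom q x, cmp h r = g.

Definition is_mono a b (f : hom a b) : Prop :=
  forall x (g h : hom x a), cmp f g = cmp f h -> g = h.

Definition is_epi a b (f : hom a b) : Prop :=
  forall x (g h : hom b x), cmp g f = cmp h f -> g = h.

Definition is_abelian : Prop :=
  (exists z : C, is_zero_object z) /\
  (forall a b, exists s (i1 : hom a s) (i2 : hom b s) (p1 : hom s a) (p2 : hom s b),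
     is_biproduct i1 i2 p1 p2) /\
  (forall a b (f : hom a b), exists k (i : hom k a), is_kernel f i) /\
  (forall a b (f : hom a b), exists q (r : hom b q), is_cokernel f r) /\
  (forall a b (f : hom a b), is_mono f -> exists c (g : hom b c), is_kernel g f) /\
  (forall a b (f : hom a b), is_epi f -> exists c (g : hom c a), is_cokernel g f).

End Abelian.

Section Category.
Variables (p : nat) (R : realType) (K : fieldType) (v : complete_abs R K).
Variables (Kbar : closedFieldType) (iota : {rmorphism K -> Kbar}).
Variables (w : nonarch_abs R Kbar) (n : nat).
Variables (rho : 'I_n -> R) (rho0 : forall k, 0 < rho k).
Local Notation obj := (Crho_obj p v iota w rho0).

Fact Crho_cmpA (a b c d : obj) (h : Crho_hom c d) (g : Crho_hom b c) (f : Crho_hom a b) :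
  hom_comp h (hom_comp g f) = hom_comp (hom_comp h g) f.
Proof. exact: Crho_hom_inj. Qed.
Fact Crho_cmp1l (a b : obj) (f : Crho_hom a b) : hom_comp (hom_id b) f = f.
Proof. exact: Crho_hom_inj. Qed.
Fact Crho_cmp1r (a b : obj) (f : Crho_hom a b) : hom_comp f (hom_id a) = f.
Proof. exact: Crho_hom_inj. Qed.
Fact Crho_cmpDl (a b c : obj) (g g' : Crho_hom b c) (f : Crho_hom a b) :
  hom_comp (g + g') f = hom_comp g f + hom_comp g' f.
Proof. exact: Crho_hom_inj. Qed.
Fact Crho_cmpDr (a b c : obj) (g : Crho_hom b c) (f f' : Crho_hom a b) :
  hom_comp g (f + f') = hom_comp g f + hom_comp g f'.
Proof.
apply: Crho_hom_inj => x /=.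
by rewrite -{1}[f x]scale1r Clinear scale1r.
Qed.

Definition Crho : preadditive_category :=
  @PreadditiveCategory obj (fun P Q => Crho_hom P Q : zmodType)
    (@hom_id p R K v Kbar iota w n rho rho0) (@hom_comp p R K v Kbar iota w n rho rho0)
    Crho_cmpA Crho_cmp1l Crho_cmp1r Crho_cmpDl Crho_cmpDr.

End Category.

(* Main.v *)
Require Import Defs.
From HB Require Import structures.
From mathcomp Require Import all_boot all_order all_algebra finmap perm cyclic separable cyclotomic.
From mathcomp Require Import zify ring lra.
From mathcomp Require Import boolp classical_sets reals constructive_ereal ereal exp.

Set Implicit Arguments.
Unset Strict Implicit.
Unset Printing Implicit Defensive.

Import Order.TTheory GRing.Theory Num.Theory.
Local Open Scope ring_scope.

(** A morphism of the category is first of all a map of finite free modules over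
    [Rrho], and kernels and cokernels of such maps are in general neither free nor even
    projective. The action of the roots of unity is what makes them free, with bases in
    which the action is again of exponential growth; once this is known, the axioms of
    an abelian category are linear algebra.

    For a level [k], the average [proj] over the tuples of [p ^ k]-th roots of unity
    projects an object [P] with scalars extended to [K(Gamma)] onto the part where these
    tuples act through the character of an exponent modulo [p ^ k], and every vector is
    the sum of its components. The projectors commute with the Galois group of
    [K(Gamma)] over [K], whose fixed field is [K] ([galois_fixed]), so they are already
    defined on [P] ([proj_descent]); they commute with morphisms, so they preserve kernels
    and images.

    The key point is [eigen_basis]. Let [x] be a family of vectors of [P], as many as the
    rank, with nonzero determinant. Expanding the determinant along the components of the
    vectors, one of the terms, the determinant [d] of a family of eigenvectors, has a
    coefficient at least as large as a fixed nonzero coefficient of the determinant of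
    [x]. The eigenvector property shows that the ideal generated by [d] is stable under
    the substitutions by roots of unity of level [k], hence contains the part [h] of [d]
    with exponents in a single class modulo [p ^ k]. By the growth condition, [d] is
    bounded on a fixed polysegment by an exponential in [k], while two exponents in the
    same class are at distance at least [p ^ k]. Hence for large [k] a single term of [h]
    dominates near [rho], [h] is invertible ([dominant_unit]), and so is [d]: the
    eigenvectors form a basis.

    If the family [x] has as many members as possible in a submodule [S] stable under the
    projectors, then so does the basis, and it follows that [S] is spanned by the members
    in [S] ([adapted_basis]). Applied to images, this shows that they are direct summands
    ([pseudo_inverse]); applied to kernels and images, it gives block triangular matrices
    of the action, whose diagonal blocks describe the kernel and the cokernel
    ([kernel_data], [cokernel_data]). To turn blocks into objects, objects are translated
    into matrix cocycles and back ([presentation], [cocycle_realization]). *)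

(** * The Galois group of the cyclotomic tower *)

Section CyclotomicTower.
Variables (p : nat) (K : fieldType) (Kbar : closedFieldType) (iota : {rmorphism K -> Kbar}).
Hypotheses (p_prime : prime p) (K0 : [pchar K] =i pred0).
Local Notation KG := (KGamma p iota).
Local Notation "P ^i" := (map_poly iota P) (at level 2, format "P ^i").

Let p_gt0 : (0 < p)%N. Proof. exact: prime_gt0. Qed.

Lemma natr_neq0_ext n : (0 < n)%N -> n%:R != 0 :> Kbar.
Proof.
move=> n0; rewrite -(rmorph_nat iota) fmorph_eq0.
by move/pcharf0P: K0 => ->; rewrite -lt0n.
Qed.

Lemma prim_root_ex n : (0 < n)%N -> exists z : Kbar, n.-primitive_root z.
Proof.
move=> n0; pose P : {poly Kbar} := 'X^n - 1; have [r Dp] := closed_field_poly_normal P.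
rewrite (monicP _) ?monicXnsubC // scale1r in Dp.
have rn1: all n.-unity_root r by apply/allP=> z; rewrite -root_prod_XsubC -Dp.
have sz_r: (n < (size r).+1)%N.
  by rewrite -(size_prod_XsubC r id) -Dp size_XnsubC.
have [|z] := hasP (has_prim_root n0 rn1 _ sz_r); last by exists z.
by rewrite -separable_prod_XsubC -Dp separable_Xn_sub_1 // natr_neq0_ext.
Qed.

Lemma minpoly_ex (x : Kbar) : (exists2 P : {poly K}, P != 0 & root P^i x) ->
  exists2 M : {poly K}, M != 0 & forall P, root P^i x = (M %| P).
Proof.
move=> [P0 P0n P0x].
pose S k := `[< exists P : {poly K}, [/\ P != 0, root P^i x & size P = k] >].
have Sex : exists k, S k by exists (size P0); apply/asboolP; exists P0.
case: (ex_minnP Sex) => k /asboolP[M [Mn Mx szM]] mink.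
exists M => // P; apply/idP/idP => [Px|/dvdpP[Q ->]]; last first.
  by rewrite rmorphM rootM Mx orbT.
apply/eqP/eqP; apply: contraT => rn.
have : S (size (P %% M)).
  apply/asboolP; exists (P %% M); split=> //.
  move: Px; rewrite {1}(divp_eq P M) rmorphD rmorphM /= /root hornerD hornerM.
  by rewrite (rootP Mx) mulr0 add0r.
by move/mink; rewrite -szM leqNgt ltn_modp Mn.
Qed.

(** [y] is a conjugate of [x] over [K]; in this form the condition says directly that
    [P(x) |-> P(y)] is well defined. *)
Definition conj_roots (x y : Kbar) := forall P : {poly K}, root P^i x -> root P^i y.

(** Extending an embedding of [K(x ^ p)] to [K(x)]: the resultant in [X] of the
    minimal polynomial of [x] and [X ^ p - Y] is a polynomial in [Y] over [K]
    vanishing at [x ^ p], hence at each of its conjugates. *)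
Lemma conj_root_lift (x y : Kbar) : (exists2 P : {poly K}, P != 0 & root P^i x) ->
  conj_roots (x ^+ p) y -> exists2 z, z ^+ p = y & conj_roots x z.
Proof.
move=> /minpoly_ex[M M0 hM] xy.
pose M2 : {poly {poly K}} := M^:P.
pose Q2 : {poly {poly K}} := 'X^p - ('X)%:P.
pose ev (a : Kbar) : {rmorphism {poly K} -> Kbar} := horner_eval a \o map_poly iota.
have evM a : map_poly (ev a) M2 = M^i.
  rewrite /M2 -map_poly_comp; apply: eq_map_poly => c /=.
  by rewrite map_polyC /= /horner_eval hornerC.
have evQ a : map_poly (ev a) Q2 = 'X^p - a%:P.
  rewrite /Q2 rmorphB /= map_polyXn map_polyC /=.
  by rewrite map_polyX /horner_eval hornerX.
have lM a : ev a (lead_coef M2) != 0.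
  rewrite /M2 lead_coef_map_inj //; last exact: polyC_inj.
  by rewrite /= map_polyC /= /horner_eval hornerC fmorph_eq0 lead_coef_eq0.
have lQ a : ev a (lead_coef Q2) != 0.
  by rewrite (monicP (monicXnsubC _ p_gt0)) rmorph1 oner_neq0.
have resE a : (map_poly iota (resultant M2 Q2)).[a] = resultant M^i ('X^p - a%:P).
  by rewrite -(evM a) -(evQ a) -map_resultant.
have common (a : Kbar) : reflect (exists2 z, z ^+ p = a & root M^i z)
    (resultant M^i ('X^p - a%:P) == 0).
  rewrite resultant_eq0; apply: (iffP idP) => [sz|[z za Mz]].
    have : size (gcdp M^i ('X^p - a%:P)) != 1%N by apply: contraTneq sz => ->.
    move/closed_rootP => [z]; rewrite root_gcd => /andP[Mz].
    by rewrite /root !hornerE subr_eq0 => /eqP za; exists z.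
  have : root (gcdp M^i ('X^p - a%:P)) z by rewrite root_gcd Mz /root !hornerE za subrr.
  apply: root_size_gt1; rewrite gcdp_eq0 negb_and.
  by rewrite map_poly_eq0 M0.
have : root (map_poly iota (resultant M2 Q2)) y.
  apply: xy; rewrite /root resE; apply/common; exists x => //.
  by rewrite hM.
rewrite /root resE => /common[z zy Mz]; exists z => // P.
by rewrite hM => /dvdpP[T ->]; rewrite rmorphM rootM Mz orbT.
Qed.

(** A compatible system of primitive roots. It starts at an arbitrary level [k0] because
    the proof of [galois_fixed] needs the given element to lie at the bottom level. *)
Section Tower.
Variables (theta : nat -> Kbar) (k0 : nat).
Hypothesis k0_gt0 : (0 < k0)%N.
Hypothesis thetaS : forall j, theta j.+1 ^+ p = theta j.
Hypothesis theta0 : (p ^ k0).-primitive_root (theta 0).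

Let thetaX i j : theta (j + i) ^+ (p ^ i) = theta j.
Proof.
elim: i j => [|i IH] j; first by rewrite addn0 expn0 expr1.
by rewrite addnS expnSr exprM -addSn IH thetaS.
Qed.

Lemma tower_prim j : (p ^ (k0 + j)).-primitive_root (theta j).
Proof.
have h1 : theta j ^+ (p ^ (k0 + j)) = 1.
  by rewrite addnC expnD exprM -{1}[j]add0n thetaX prim_expr_order.
have [|m hm md] := prim_order_exists _ h1; first by rewrite expn_gt0 p_gt0.
have [i ij mE] := dvdn_pfactor _ _ p_prime md; rewrite mE in hm.
suff /eqP <- : i == (k0 + j)%N by [].
rewrite eqn_leq ij leqNgt /=; apply/negP => ilt.
have : theta 0 ^+ (p ^ k0.-1) = 1.
  rewrite -(thetaX j 0) add0n -exprM -expnD; apply/eqP; rewrite -(prim_order_dvd hm).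
  by apply: dvdn_exp2l; lia.
move/eqP; rewrite -(prim_order_dvd theta0) => /dvdn_leq; rewrite expn_gt0 p_gt0 => /(_ isT).
by rewrite leq_exp2l ?prime_gt1 //; lia.
Qed.

Lemma tower_algebraic j : exists2 P : {poly K}, P != 0 & root P^i (theta j).
Proof.
have n0 : (0 < p ^ (k0 + j))%N by rewrite expn_gt0 p_gt0.
exists ('X^(p ^ (k0 + j)) - 1); first by rewrite monic_neq0 // monicXnsubC.
by rewrite rmorphB /= map_polyXn rmorph1 /root !hornerE (prim_expr_order (tower_prim _)) ?subrr.
Qed.

Let raise (P : {poly K}) i j : P^i.[theta j] = (P \Po 'X^(p ^ i))^i.[theta (j + i)].
Proof. by rewrite map_comp_poly horner_comp map_polyXn hornerXn thetaX. Qed.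

Let tower (x : Kbar) := exists j (P : {poly K}), x = P^i.[theta j].

Let tower2 (x y : Kbar) : tower x -> tower y ->
  exists j (P Q : {poly K}), x = P^i.[theta j] /\ y = Q^i.[theta j].
Proof.
move=> [i [P ->]] [j [Q ->]]; exists (i + j)%N.
by exists (P \Po 'X^(p ^ j)), (Q \Po 'X^(p ^ i)); rewrite -raise addnC -raise.
Qed.

(** Each [K[theta j]] is already a field, since [theta j] is algebraic: an inverse comes
    from a Bezout relation with the minimal polynomial. *)
Lemma KGamma_tower (x : KG) : exists j (P : {poly K}), val x = P^i.[theta j].
Proof.
have /asboolP h := valP x; apply: (h tower) => [|a|s z s0 zs].
- split=> [|a b ha hb|a b ha hb].
  + by exists 0%N, 1; rewrite rmorph1 hornerE.
  + have [j [P [Q [-> ->]]]] := tower2 ha hb.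
    by exists j, (P - Q); rewrite rmorphB !hornerE.
  have [j [P [Q [-> ->]]]] := tower2 ha hb.
  have [Q0|Qn] := eqVneq Q^i.[theta j] 0.
    by exists j, 0; rewrite Q0 invr0 mulr0 rmorph0 hornerE.
  have [M M0 hM] := minpoly_ex (tower_algebraic j).
  have cop : coprimep Q M.
    apply: contraT; rewrite coprimep_def => szG.
    have /dvdpP[H ME] := dvdp_gcdr Q M; set G := gcdp Q M in szG ME.
    have : root M^i (theta j) by rewrite hM.
    have H0 : H != 0 by apply: contraNneq M0 => H0; rewrite ME H0 mul0r.
    have G0 : G != 0 by apply: contraNneq M0 => G0; rewrite ME G0 mulr0.
    rewrite ME rmorphM rootM => /orP[]; rewrite hM => dv.
      have := dvdp_leq H0 dv; rewrite ME size_mul // => le.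
      have G1 : (1 < size G)%N by rewrite ltn_neqAle eq_sym szG size_poly_gt0.
      by move: le G1; case: (size G) => [|[|g]] //; rewrite addnS /=; lia.
    move: Qn; have := dvdp_trans dv (dvdp_gcdl Q M).
    by rewrite -hM => /rootP ->; rewrite eqxx.
  have [[U V] /= hUV] := Bezout_coprimepP _ _ cop.
  have := hUV; rewrite -size_poly_eq1 => /size_poly1P[c c0 cE].
  exists j, (P * (c^-1 *: U)).
  have : (U * Q + V * M)^i.[theta j] = iota c by rewrite cE map_polyC hornerC.
  rewrite rmorphD !rmorphM hornerD !hornerM.
  have -> : M^i.[theta j] = 0 by apply/rootP; rewrite hM.
  rewrite mulr0 addr0 => E; rewrite /= map_polyZ hornerZ /=; congr (_ * _).
  apply: (mulIf Qn); rewrite mulVf // -mulrA E -rmorphM mulVf ?rmorph1 //.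
- by exists 0%N, a%:P; rewrite map_polyC hornerC.
have : z ^+ (p ^ (k0 + s)) = 1 by rewrite addnC expnD exprM zs expr1n.
move/(prim_rootP (tower_prim s)) => [i ->]; exists s, 'X^i.
by rewrite map_polyXn hornerXn.
Qed.

Section Automorphism.
Variable z : nat -> Kbar.
Hypothesis zS : forall j, z j.+1 ^+ p = z j.
Hypothesis zC : forall j, conj_roots (theta j) (z j).

Let zX i j : z (j + i) ^+ (p ^ i) = z j.
Proof.
elim: i j => [|i IH] j; first by rewrite addn0 expn0 expr1.
by rewrite addnS expnSr exprM -addSn IH zS.
Qed.

Let raisez (P : {poly K}) i j : P^i.[z j] = (P \Po 'X^(p ^ i))^i.[z (j + i)].
Proof. by rewrite map_comp_poly horner_comp map_polyXn hornerXn zX. Qed.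

Let transfer i j (P Q : {poly K}) : P^i.[theta i] = Q^i.[theta j] -> P^i.[z i] = Q^i.[z j].
Proof.
rewrite (raise P j i) (raise Q i j) (raisez P j i) (raisez Q i j) addnC => /eqP.
rewrite -subr_eq0 -hornerN -hornerD -rmorphB => /zC/rootP.
by rewrite rmorphB /= hornerD hornerN => /eqP; rewrite subr_eq0 => /eqP.
Qed.

Let z_prim1 j : z j ^+ (p ^ (k0 + j)) = 1.
Proof.
have := zC (j := j) (P := 'X^(p ^ (k0 + j)) - 1).
rewrite rmorphB /= map_polyXn rmorph1 /root !hornerE (prim_expr_order (tower_prim _)) ?subrr //.
by move=> /(_ (eqxx _)); rewrite subr_eq0 => /eqP.
Qed.

Let z_prim j : (p ^ (k0 + j)).-primitive_root (z j).
Proof.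
have n0 : (0 < p ^ (k0 + j))%N by rewrite expn_gt0 p_gt0.
have [m hm md] := prim_order_exists n0 (z_prim1 j).
suff : (p ^ (k0 + j) %| m)%N.
  by move=> dm; rewrite (_ : (p ^ _)%N = m) //; apply/eqP; rewrite eqn_dvd md dm.
have [i ij mE] := dvdn_pfactor _ _ p_prime md; rewrite mE in hm *.
have [->//|ilt] := eqVneq i (k0 + j)%N; exfalso.
have [M M0 hM] := minpoly_ex (tower_algebraic j).
(* [theta j] is not a root of X^(p^i) - 1, hence a root of the complementary factor [H],
   and so is its conjugate [z j]; but [H] and X^(p^i) - 1 have no common root. *)
have n1 : (0 < p ^ i)%N by rewrite expn_gt0 p_gt0.
have dv : ('X^(p ^ i) - 1 : {poly K}) %| 'X^(p ^ (k0 + j)) - 1.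
  have -> : (p ^ (k0 + j) = p ^ i * p ^ (k0 + j - i))%N by rewrite -expnD subnKC.
  by rewrite exprM [X in _ %| X]subrX1 dvdp_mulr.
have /dvdpP[H HE] := dv.
have : root H^i (theta j).
  have : root ('X^(p ^ (k0 + j)) - 1 : {poly K})^i (theta j).
    by rewrite rmorphB /= map_polyXn rmorph1 /root !hornerE (prim_expr_order (tower_prim _)) ?subrr.
  rewrite HE rmorphM rootM => /orP[//|].
  rewrite rmorphB /= map_polyXn rmorph1 /root !hornerE subr_eq0 -(prim_order_dvd (tower_prim j)).
  by rewrite dvdn_Pexp2l ?prime_gt1 // leqNgt ltn_neqAle ilt ij.
move/zC => Hz.
have sep : separable_poly ('X^(p ^ (k0 + j)) - 1 : {poly Kbar}).
  by rewrite separable_Xn_sub_1 // natr_neq0_ext.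
have HE' : ('X^(p ^ (k0 + j)) - 1 : {poly Kbar}) = H^i * ('X^(p ^ i) - 1).
  have := congr1 (map_poly iota) HE.
  by rewrite rmorphM !rmorphB /= !map_polyXn !rmorph1.
have := separable_coprime sep (u := H^i) (v := 'X^(p ^ i) - 1).
rewrite HE' dvdpp => /(_ isT) cop.
have := coprimep_root cop Hz.
by rewrite !hornerE (prim_expr_order hm) subrr eqxx.
Qed.

Let root_KG (u : Kbar) s (P : {poly K}) : u ^+ (p ^ (k0 + s)) = 1 ->
  P^i.[u] \in KGamma_pred p iota.
Proof.
move=> u1; apply/asboolP => S [S1 SB SD] SK SG; rewrite horner_poly.
have S0 : S 0 by rewrite -(subrr 1); apply: SB.
have SN a : S a -> S (- a) by rewrite -sub0r; apply: SB.
have SA a b : S a -> S b -> S (a + b) by move=> ha hb; rewrite -[b]opprK; apply/SB/SN.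
have SV a : S a -> S a^-1 by rewrite -[a^-1]mul1r; apply: SD.
have SM a b : S a -> S b -> S (a * b) by move=> ha hb; rewrite -[b]invrK; apply/SD/SV.
have Su : S u by apply: SG u1; rewrite addn_gt0 k0_gt0.
have SuX i : S (u ^+ i) by elim: i => [|i IH]; rewrite ?expr0 // exprS; apply: SM.
by elim/big_ind: _ => // i _; apply: SM.
Qed.

Let sig_ex (x : KG) : exists y : KG, forall j P, val x = P^i.[theta j] -> val y = P^i.[z j].
Proof.
have [j [P xE]] := KGamma_tower x.
exists (Sub (P^i.[z j]) (root_KG P (z_prim1 j))) => i Q; rewrite xE /= => /transfer; exact.
Qed.

Let sig (x : KG) : KG := sval (cid (sig_ex x)).
Let sigP x j P : val x = P^i.[theta j] -> val (sig x) = P^i.[z j].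
Proof. exact: (svalP (cid (sig_ex x))). Qed.

Let two (x y : KG) : exists j (P Q : {poly K}), val x = P^i.[theta j] /\ val y = Q^i.[theta j].
Proof. by apply: tower2; apply: KGamma_tower. Qed.

Let sigB : zmod_morphism sig.
Proof.
move=> x y; have [j [P [Q [hP hQ]]]] := two x y; apply: val_inj => /=.
have hPQ : val (x - y) = (P - Q)^i.[theta j].
  by rewrite [(P - Q)^i]rmorphB hornerD hornerN -hP -hQ.
by rewrite (sigP hPQ) (sigP hP) (sigP hQ) rmorphB hornerD hornerN.
Qed.

Let sigM : monoid_morphism sig.
Proof.
split=> [|x y].
  by apply: val_inj; rewrite (@sigP _ 0%N 1) ?rmorph1 ?hornerE.
have [j [P [Q [hP hQ]]]] := two x y; apply: val_inj => /=.
have hPQ : val (x * y) = (P * Q)^i.[theta j].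
  by rewrite [(P * Q)^i]rmorphM hornerM -hP -hQ.
by rewrite (sigP hPQ) (sigP hP) (sigP hQ) rmorphM hornerM.
Qed.

(** Compatibility makes [P(theta j) |-> P(z j)] independent of the level [j]; the map is
    onto because [z j] is again primitive, so that [theta j] is one of its powers. *)
Lemma tower_automorphism : exists2 sigma : {rmorphism KG -> KG}, is_galois sigma &
  forall (x : KG) j P, val x = P^i.[theta j] -> val (sigma x) = P^i.[z j].
Proof.
pose s : {rmorphism KG -> KG} := HB.pack sig
  (GRing.isZmodMorphism.Build KG KG sig sigB) (GRing.isMonoidMorphism.Build KG KG sig sigM).
exists s; last exact: sigP.
split=> [|a]; last first.
  by apply: val_inj; rewrite /= (@sigP _ 0%N a%:P) map_polyC ?hornerC //= mulr1.
have [g gK] : exists g, cancel g s.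
  suff h (y : KG) : exists x, s x = y.
    by exists (fun y => sval (cid (h y))) => y; apply: svalP (cid (h y)).
  have [j [P yE]] := KGamma_tower y.
  have t1 : theta j ^+ (p ^ (k0 + j)) = 1 by apply: prim_expr_order (tower_prim j).
  have [i tE] := prim_rootP (z_prim j) t1.
  exists (Sub ((P \Po 'X^i)^i.[theta j]) (root_KG (P \Po 'X^i) t1)).
  apply: val_inj; rewrite yE (@sigP _ j (P \Po 'X^i)) //.
  by rewrite map_comp_poly horner_comp map_polyXn hornerXn -tE.
exists g => // x; apply: (fmorph_inj s); exact: gK.
Qed.

End Automorphism.
End Tower.

Let proot_ex (x : Kbar) : exists y, y ^+ p = x.
Proof.
have : size ('X^p - x%:P) != 1%N by rewrite size_XnsubC // eqSS -lt0n.
by move/closed_rootP => [y]; rewrite /root !hornerE subr_eq0 => /eqP; exists y.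
Qed.

(** Write [y = P(theta 0)]. If [y] is fixed, then [P] takes the value [y] at every root of
    the minimal polynomial [M] of [theta 0], which is separable; the remainder of [P]
    modulo [M] is of smaller degree than [M], hence constant. *)
Lemma galois_fixed (y : KG) :
  (forall sigma : {rmorphism KG -> KG}, is_galois sigma -> sigma y = y) ->
  exists a : K, y = a%:A.
Proof.
move=> hy; pose r x := sval (cid (proot_ex x)).
have rP x : r x ^+ p = x by exact: svalP (cid (proot_ex x)).
have [x0 hx0] : exists x : Kbar, (p ^ 1).-primitive_root x by apply: prim_root_ex; rewrite expn1.
pose th0 j := iter j r x0.
have th0S j : th0 j.+1 ^+ p = th0 j by exact: rP.
have [j [P yE]] := KGamma_tower (ltn0Sn 0) th0S hx0 y.
pose th i := th0 (j + i)%N; pose k := (1 + j)%N.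
have thS i : th i.+1 ^+ p = th i by rewrite /th addnS th0S.
have thp : (p ^ k).-primitive_root (th 0%N).
  by rewrite /th addn0; apply: tower_prim (ltn0Sn 0) th0S hx0 j.
have yE0 : val y = P^i.[th 0%N] by rewrite /th addn0.
have k0 : (0 < k)%N by [].
have alg i := tower_algebraic k0 thS thp i.
have Pconst z0 : conj_roots (th 0%N) z0 -> P^i.[z0] = val y.
  move=> h0.
  have step i (z : Kbar) : exists z', conj_roots (th i) z ->
      z' ^+ p = z /\ conj_roots (th i.+1) z'.
    have [hz|hz] := pselect (conj_roots (th i) z); last by exists 0 => /hz.
    by rewrite -thS in hz; have [z' h1 h2] := conj_root_lift (alg i.+1) hz; exists z'.
  pose nx i z := sval (cid (step i z)).
  have nxP i z : conj_roots (th i) z -> nx i z ^+ p = z /\ conj_roots (th i.+1) (nx i z).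
    exact: svalP (cid (step i z)).
  pose z := fix z i := if i is i'.+1 then nx i' (z i') else z0.
  have zC i : conj_roots (th i) (z i) by elim: i => // i IH; have [] := nxP _ _ IH.
  have zS i : z i.+1 ^+ p = z i by have [] := nxP _ _ (zC i).
  have [sigma hs sE] := tower_automorphism k0 thS thp zS zC.
  by rewrite -(sE _ _ _ yE0) hy.
have [M M0 hM] := minpoly_ex (alg 0%N).
pose N := (p ^ k)%N; have N0 : (0 < N)%N by rewrite expn_gt0 p_gt0.
have MN : M %| 'X^N - 1.
  by rewrite -hM rmorphB /= map_polyXn rmorph1 /root !hornerE prim_expr_order ?subrr.
have Mroot z : root M^i z -> conj_roots (th 0%N) z.
  by move=> Mz Q; rewrite hM => /dvdpP[T ->]; rewrite rmorphM rootM Mz orbT.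
pose Q := P %% M.
have Qz z : root M^i z -> Q^i.[z] = val y.
  move=> Mz; rewrite -(Pconst _ (Mroot _ Mz)) [in RHS](divp_eq P M) rmorphD rmorphM.
  by rewrite hornerD hornerM /= (rootP Mz) mulr0 add0r.
have dv : M^i %| Q^i - (val y)%:P.
  have [rs Ers] := closed_field_poly_normal M^i.
  have lM : lead_coef M^i != 0 by rewrite lead_coef_eq0 map_poly_eq0.
  rewrite Ers dvdpZl //; apply: uniq_roots_dvdp.
    apply/allP => z zr; rewrite /root !hornerE Qz ?subrr //.
    by rewrite Ers rootZ // root_prod_XsubC.
  rewrite uniq_rootsE -separable_prod_XsubC -(eqp_separable (eqp_scale _ lM)) -Ers.
  apply: (dvdp_separable (p := 'X^N - 1)); last by rewrite separable_Xn_sub_1 // natr_neq0_ext.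
  by have := MN; rewrite -(dvdp_map iota) rmorphB /= map_polyXn rmorph1.
have QE : Q^i = (val y)%:P.
  apply/eqP; rewrite -subr_eq0; apply: contraT => n0.
  have M1 : (1 < size M^i)%N.
    by apply: (root_size_gt1 (a := th 0%N)); rewrite ?map_poly_eq0 // hM.
  have := dvdp_leq n0 dv; rewrite leqNgt => /negP[].
  rewrite (leq_ltn_trans (size_polyD _ _)) // gtn_max size_polyN !size_map_poly ltn_modp M0 /=.
  by rewrite (leq_ltn_trans (size_polyC_leq1 _)) // -(size_map_poly iota).
exists Q`_0; apply: val_inj; rewrite /= mulr1 -[LHS](coefC _ 0%N) -/(val y).
by rewrite -coef_map QE !coefC.
Qed.

End CyclotomicTower.

(** * Bases and tensor products with a field extension *)

Lemma ext_ind (K : fieldType) (L A : comAlgType K) (P : lmodType A) (S : mod_ext L P -> Prop) :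
  S 0 -> (forall x y, S x -> S y -> S (x + y)) -> (forall x l, S (mpure x l)) -> forall x, S x.
Proof. exact: tens_ind. Qed.

Section LinearMaps.
Variables (A : pzRingType) (P Q : lmodType A) (f : P -> Q).
Hypothesis fl : linear f.

Lemma lin_add x y : f (x + y) = f x + f y.
Proof. by rewrite -[x]scale1r fl !scale1r. Qed.

Lemma lin_zero : f 0 = 0.
Proof. by apply: (addIr (f 0)); rewrite -lin_add !add0r. Qed.

Lemma lin_scale a x : f (a *: x) = a *: f x.
Proof. by rewrite -[_ *: x]addr0 fl lin_zero addr0. Qed.

Lemma lin_comb (I : finType) (c : I -> A) (u : I -> P) :
  f (\sum_i c i *: u i) = \sum_i c i *: f (u i).
Proof. by elim/big_rec2: _ => [|i x y _ <-]; rewrite ?lin_zero // lin_add lin_scale. Qed.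

Lemma lin_sub x y : f (x - y) = f x - f y.
Proof. by apply: (addIr (f y)); rewrite -lin_add !subrK. Qed.

End LinearMaps.

Section TensorMap.
Variables (K : fieldType) (L A B : comAlgType K) (P : lmodType A) (Q : lmodType B).
Variables (f : P -> Q) (g : L -> L).

Definition Kadditive := [/\ forall x y, f (x + y) = f x + f y,
  forall (k : K) x, f (k%:A *: x) = k%:A *: f x,
  forall x y, g (x + y) = g x + g y & forall (k : K) x, g (k *: x) = k *: g x].

Definition emap : mod_ext L P -> mod_ext L Q := tmap _ _ f g.

Hypothesis fg : Kadditive.

Fact emap_bal : balanced (fun (k : K) (x : P) => k%:A *: x) (fun (k : K) (l : L) => k *: l)
  (fun x l => mpure (f x) (g l)).
Proof.
case: fg => fD fK gD gK; split=> [x x' y|x y y'|k x y]; rewrite /mpure.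
- by rewrite fD tpureDl.
- by rewrite gD tpureDr.
- by rewrite fK gK tpure_bal.
Qed.

Lemma emap_pure x l : emap (mpure x l) = mpure (f x) (g l).
Proof. exact: tlift_pure emap_bal. Qed.

Lemma emapD x y : emap (x + y) = emap x + emap y.
Proof. exact: tliftD emap_bal. Qed.

Lemma emap0 : emap 0 = 0.
Proof. exact: tlift0 emap_bal. Qed.

Lemma emap_sum (I : Type) (s : seq I) (S : pred I) (F : I -> mod_ext L P) :
  emap (\sum_(i <- s | S i) F i) = \sum_(i <- s | S i) emap (F i).
Proof. by elim/big_rec2: _ => [|i x y _ <-]; rewrite ?emap0 ?emapD. Qed.

End TensorMap.

Section SemilinearTensorMap.
Variables (K : fieldType) (L A B : comAlgType K) (P : lmodType A) (Q : lmodType B).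
Variables (f : P -> Q) (g : L -> L) (phi : A -> B).
Hypothesis fg : Kadditive f g.
Hypothesis phig : Kadditive (P := A^o) (Q := B^o) phi g.
Hypothesis gM : forall x y, g (x * y) = g x * g y.
Hypothesis fM : forall a x, f (a *: x) = phi a *: f x.

Lemma emapZ (F : alg_ext L A) (x : mod_ext L P) :
  emap f g (F *: x) = (emap (P := A^o) (Q := B^o) phi g F : alg_ext L B) *: emap f g x.
Proof.
elim/tens_ind: F => [|F F' hF hF'|a l].
- by rewrite scale0r !emap0 // scale0r.
- by rewrite scalerDl !emapD // hF hF' scalerDl.
elim/tens_ind: x => [|x x' hx hx'|u m].
- by rewrite scaler0 !emap0 // scaler0.
- by rewrite scalerDr !emapD // hx hx' scalerDr.
rewrite -[tpure _ _ a l]/(apure a l) -[tpure _ _ u m]/(mpure u m) apureZ.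
rewrite (emap_pure fg) -[apure a l]/(mpure (a : A^o) l) (emap_pure phig) (emap_pure fg).
by rewrite fM gM -apureZ.
Qed.

End SemilinearTensorMap.

Section Basis.
Variables (A : pzRingType) (P : lmodType A) (m : nat) (e : 'I_m -> P).
Hypothesis he : is_basis e.

Definition bcoord (x : P) : {ffun 'I_m -> A} := sval (cid (he x)).

Lemma bcoordE x : x = \sum_i bcoord x i *: e i.
Proof. by have [] := svalP (cid (he x)). Qed.

Lemma bcoord_uniq x c : x = \sum_i c i *: e i -> forall i, bcoord x i = c i.
Proof.
move=> xE i; have [_] := svalP (cid (he x)) => /(_ [ffun i => c i]) h.
rewrite /bcoord h ?ffunE // xE; apply: eq_bigr => j _; by rewrite ffunE.
Qed.

Lemma bcoordD x y i : bcoord (x + y) i = bcoord x i + bcoord y i.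
Proof.
apply: (bcoord_uniq (c := fun i => bcoord x i + bcoord y i)).
by rewrite {1}(bcoordE x) {1}(bcoordE y) -big_split; apply: eq_bigr => j _; rewrite scalerDl.
Qed.

Lemma bcoordZ a x i : bcoord (a *: x) i = a * bcoord x i.
Proof.
apply: (bcoord_uniq (c := fun i => a * bcoord x i)).
by rewrite {1}(bcoordE x) scaler_sumr; apply: eq_bigr => j _; rewrite scalerA.
Qed.

Lemma bcoord_base j i : bcoord (e j) i = (i == j)%:R.
Proof.
apply: (bcoord_uniq (c := fun i => (i == j)%:R)).
rewrite (bigD1 j) //= eqxx scale1r big1 ?addr0 // => k /negPf ->; exact: scale0r.
Qed.

Lemma bcoord0 i : bcoord 0 i = 0.
Proof. by rewrite -(scale0r (0 : P)) bcoordZ mul0r. Qed.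

Lemma bcoord_sum (I : Type) (s : seq I) (F : I -> P) i :
  bcoord (\sum_(k <- s) F k) i = \sum_(k <- s) bcoord (F k) i.
Proof. by elim/big_rec2: _ => [|k x y _ <-]; rewrite ?bcoord0 ?bcoordD. Qed.

Lemma bcoord_inj x y : bcoord x =1 bcoord y -> x = y.
Proof.
by move=> h; rewrite (bcoordE x) (bcoordE y); apply: eq_bigr => i _; rewrite h.
Qed.

Lemma bcoord_comb (c : 'I_m -> A) i : bcoord (\sum_j c j *: e j) i = c i.
Proof. exact: bcoord_uniq. Qed.

End Basis.

Lemma is_basisP (A : pzRingType) (P : lmodType A) m (e : 'I_m -> P) :
  (forall x, exists c, x = \sum_i c i *: e i) ->
  (forall c, \sum_i c i *: e i = 0 -> forall i, c i = 0) -> is_basis e.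
Proof.
move=> ex un x; have [c ->] := ex x; exists [ffun i => c i]; split.
  by apply: eq_bigr => i _; rewrite ffunE.
move=> d E; apply/ffunP => i; rewrite ffunE; apply/eqP; rewrite -subr_eq0; apply/eqP.
apply: (un (fun i => c i - d i)); under eq_bigr do rewrite scalerBl.
by rewrite sumrB E subrr.
Qed.

Section ExtBasis.
Variables (K : fieldType) (L A : comAlgType K) (P : lmodType A) (m : nat) (e : 'I_m -> P).
Hypothesis he : is_basis e.

Fact Kadd_bcoord i : Kadditive (Q := A^o) (fun x => bcoord he x i) (fun l : L => l).
Proof. by split=> // [x y|k x]; rewrite ?bcoordD ?bcoordZ. Qed.

Definition ecoord (x : mod_ext L P) (i : 'I_m) : alg_ext L A :=
  emap (Q := A^o) (fun x => bcoord he x i) (fun l : L => l) x.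

Lemma ecoord_pure x l i : ecoord (mpure x l) i = apure (bcoord he x i) l.
Proof. exact: (emap_pure (Kadd_bcoord i) x l). Qed.

Lemma ecoordD x y i : ecoord (x + y) i = ecoord x i + ecoord y i.
Proof. exact: (emapD (Kadd_bcoord i) x y). Qed.

Lemma ecoord0 i : ecoord 0 i = 0.
Proof. exact: (emap0 (Kadd_bcoord i)). Qed.

Lemma ecoord_sum (I : Type) (s : seq I) (F : I -> mod_ext L P) i :
  ecoord (\sum_(k <- s) F k) i = \sum_(k <- s) ecoord (F k) i.
Proof. by elim/big_rec2: _ => [|k x y _ <-]; rewrite ?ecoord0 ?ecoordD. Qed.

Fact Kadd_id : Kadditive (fun x : P => x) (fun l : L => l).
Proof. by []. Qed.

Lemma emap_id x : emap (fun x : P => x) (fun l : L => l) x = x.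
Proof.
elim/tens_ind: x => [|x y hx hy|u l]; first exact: (emap0 Kadd_id).
  by rewrite (emapD Kadd_id) hx hy.
exact: (emap_pure Kadd_id).
Qed.

End ExtBasis.

Section ExtBasisTheory.
Variables (K : fieldType) (L A : comAlgType K) (P : lmodType A) (m : nat) (e : 'I_m -> P).
Hypothesis he : is_basis e.

Lemma ecoordZ (F : alg_ext L A) (x : mod_ext L P) i : ecoord he (F *: x) i = F * ecoord he x i.
Proof.
have h := @emapZ K L A A P A^o (fun x => bcoord he x i) (fun l => l) (fun a => a)
  (Kadd_bcoord L he i) (Kadd_id L A^o) (fun x y => erefl) (fun a x => bcoordZ he a x i) F x.
by rewrite /ecoord h emap_id.
Qed.

Lemma ecoord_base j i : ecoord he (mpure (e j) 1) i = (i == j)%:R :> alg_ext L A.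
Proof.
rewrite ecoord_pure bcoord_base; case: (i == j) => //=.
exact: (tpure0l _ _).
Qed.

Lemma ecoordE (x : mod_ext L P) : x = \sum_i ecoord he x i *: mpure (e i) 1.
Proof.
elim/tens_ind: x => [|x y {1}-> {1}->|u l].
- by rewrite big1 // => i _; rewrite ecoord0 scale0r.
- by rewrite -big_split; apply: eq_bigr => i _; rewrite ecoordD scalerDl.
rewrite -/(mpure u l); under eq_bigr do rewrite ecoord_pure apureZ mulr1.
rewrite {1}(bcoordE he u); elim/big_rec2: _ => [|i x y _ <-]; first exact: tpure0l.
exact: tpureDl.
Qed.

Lemma ecoord_comb (c : 'I_m -> alg_ext L A) i :
  ecoord he (\sum_j c j *: mpure (e j) 1) i = c i.
Proof.
rewrite ecoord_sum (bigD1 i) //= ecoordZ ecoord_base eqxx mulr1 big1 ?addr0 //.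
by move=> j ji; rewrite ecoordZ ecoord_base eq_sym (negPf ji) mulr0.
Qed.

Lemma ecoord_inj (x y : mod_ext L P) : (forall i, ecoord he x i = ecoord he y i) -> x = y.
Proof. by move=> h; rewrite (ecoordE x) (ecoordE y); apply: eq_bigr => i _; rewrite h. Qed.

End ExtBasisTheory.

Section Descent.
Variables (p : nat) (R : realType) (K : fieldType) (v : complete_abs R K).
Variables (Kbar : closedFieldType) (iota : {rmorphism K -> Kbar}) (n : nat).
Variable C : laurent_class v n.
Local Notation KG := (KGamma p iota).
Local Notation A := (laurent_ring C).
Local Notation AG := (alg_ext KG A).

(** Separating off the coefficient of [1] in a tensor: the remaining second factors
    may be chosen with [1] outside their [K]-span, because a relation expressing [1]
    lets one of them be eliminated. *)
Lemma split_one (F : AG) : exists N (x0 : A) (x : nat -> A) (l : nat -> KG),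
  F = apure x0 1 + \sum_(i < N) apure (x i) (l i) /\
  forall (c : K) (d : nat -> K), c%:A = \sum_(i < N) d i *: l i -> c = 0.
Proof.
have [s ->] : exists s : seq (A * KG), F = \sum_(u <- s) apure u.1 u.2.
  by rewrite -(tpi_repr F) tpi_sum; eexists.
have p0 l : apure 0 l = 0 :> AG by exact: (tpure0l _ _).
elim: s => [|[a m] s [N [x0 [x [l [FE hl]]]]]].
  exists 0%N, 0, (fun=> 0), (fun=> 0); rewrite big_nil big_ord0 p0 addr0; split=> //.
  move=> c d; rewrite big_ord0 => /eqP; rewrite scaler_eq0 oner_eq0 orbF.
  by move/eqP.
rewrite big_cons FE /=.
pose x' i := if (i < N)%N then x i else a; pose l' i := if (i < N)%N then l i else m.
have sumE (V : zmodType) (h : nat -> A -> KG -> V) : \sum_(i < N.+1) h i (x' i) (l' i) =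
    \sum_(i < N) h i (x i) (l i) + h N a m.
  rewrite big_ord_recr /= /x' /l' ltnn; congr (_ + _).
  by apply: eq_bigr => i _; rewrite ltn_ord.
have [hex|hn] := pselect (forall (c : K) (d : nat -> K),
      c%:A = \sum_(i < N.+1) d i *: l' i -> c = 0).
  exists N.+1, x0, x', l'; split=> //.
  by rewrite (sumE _ (fun i y k => apure y k : AG)) addrCA [apure a m + _]addrC.
have [c [d [E c0]]] : exists (c : K) (d : nat -> K), c%:A = \sum_(i < N.+1) d i *: l' i /\ c != 0.
  apply: contrapT => hh; apply: hn => c d E; apply/eqP/negP => /negP c0.
  by apply: hh; exists c, d.
rewrite (sumE _ (fun i y k => d i *: k)) in E.
have dN : d N != 0.
  by apply: contra_neq c0 => dN; apply: (hl c d); rewrite E dN scale0r addr0.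
exists N, (x0 + (c / d N) *: a), (fun i => x i - (d i / d N) *: a), l; split=> //.
have aDl (y y' : A) k : apure (y + y') k = apure y k + apure y' k :> AG.
  exact: (tpureDl _ _ (y : A^o) y' k).
have aZ (k : K) (y : A) z : apure (k *: y) z = apure y (k *: z) :> AG.
  have -> : k *: y = k%:A *: (y : A^o) by rewrite -[RHS]scalerAl mul1r.
  exact: (tpure_bal _ _ k (y : A^o) z).
have -> : \sum_(i < N) apure (x i - (d i / d N) *: a) (l i) =
   \sum_(i < N) apure (x i) (l i) - apure a (\sum_(i < N) (d i / d N) *: l i) :> AG.
  apply: (addIr (apure a (\sum_(i < N) (d i / d N) *: l i))); rewrite subrK.
  have -> : apure a (\sum_(i < N) (d i / d N) *: l i) =
            \sum_(i < N) apure ((d i / d N) *: a) (l i) :> AG.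
    under [RHS]eq_bigr do rewrite aZ.
    elim/big_rec2: _ => [|i y y' _ <-]; first exact: (tpure0r _ _).
    exact: (tpureDr _ _ (a : A^o)).
  by rewrite -big_split; apply: eq_bigr => i _ /=; rewrite -aDl subrK.
have -> : m = (c / d N) *: 1 - \sum_(i < N) (d i / d N) *: l i.
  apply: (scalerI dN); rewrite scalerBr scalerA mulrC divfK // E scaler_sumr.
  under [X in _ = _ - X]eq_bigr do rewrite scalerA mulrC divfK //.
  by rewrite addrAC subrr add0r.
have aB (y : A) k k' : apure y (k - k') = apure y k - apure y k' :> AG.
  apply: (addIr (apure y k')); rewrite subrK.
  by rewrite -[LHS](tpureDr _ _ (y : A^o)) subrK.
rewrite aB -aZ aDl addrACA [apure x0 1 + apure (_ *: a) 1]addrC.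
by congr (_ + _); exact: addrC.
Qed.

Lemma apure_inj1 (f g : A) : apure f 1 = apure g 1 :> AG -> f = g.
Proof.
move=> E; apply: lring_inj => i.
have := congr1 (ext_coef i) E; rewrite !ext_coef_pure => /eqP.
by rewrite -subr_eq0 -scalerBl scaler_eq0 oner_eq0 orbF subr_eq0 => /eqP.
Qed.

(** By [split_one], such an element has no component outside the one along [1]. *)
Lemma descent (F : AG) :
  (forall i, exists c : K, ext_coef i F = c%:A) -> exists f : A, F = apure f 1.
Proof.
have [N [x0 [x [l [-> hl]]]]] := split_one F => hF; exists x0.
apply: ext_coef_inj => i; have [c cE] := hF i; rewrite cE.
move: cE; rewrite ext_coefD ext_coef_sum !ext_coef_pure.
under eq_bigr do rewrite ext_coef_pure.
move=> E; suff /eqP : c - x0 i = 0 by rewrite subr_eq0 => /eqP ->.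
apply: (hl _ (fun k => x k i)); rewrite scalerBl -E addrAC subrr add0r //.
Qed.

(** Decompose [G] by [split_one]: only its component along [1] contributes to the product
    [1], and so it is an inverse of [f]. *)
Lemma unit_descent (f : A) (G : AG) : apure f 1 * G = 1 -> exists g : A, f * g = 1.
Proof.
have [N [x0 [x [l [-> hl]]]]] := split_one G => hG; exists x0.
move: hG; rewrite mulrDr mulr_sumr apureM mul1r => hG; apply: lring_inj => i.
have := congr1 (ext_coef i) hG; rewrite ext_coefD ext_coef_sum.
under eq_bigr do rewrite apureM mul1r ext_coef_pure.
rewrite -[1 in RHS]/(apure 1 1) !ext_coef_pure => E.
suff /eqP : (1 : A) i - (f * x0) i = 0 by rewrite subr_eq0 => /eqP ->.
apply: (hl _ (fun k => (f * x k) i)); rewrite scalerBl -E addrAC subrr add0r //.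
Qed.

End Descent.

(** * Gauss norms and the substitutions by roots of unity *)

Section GaussNorms.
Variables (p : nat) (R : realType) (K : fieldType) (v : complete_abs R K).
Variables (Kbar : closedFieldType) (iota : {rmorphism K -> Kbar}).
Variables (w : nonarch_abs R Kbar) (n : nat).
Hypothesis w_ext : forall a, w (iota a) = v a.
Hypothesis p_gt0 : (0 < p)%N.
Local Notation KG := (KGamma p iota).
Local Notation mi := (multi_index n).

Fact wKG_ge0 (x : KG) : 0 <= w (val x). Proof. exact: nabs_ge0. Qed.
Fact wKG_eq0 (x : KG) : (w (val x) == 0) = (x == 0).
Proof. by rewrite nabs_eq0 -(inj_eq val_inj). Qed.
Fact wKG_M (x y : KG) : w (val (x * y)) = w (val x) * w (val y).
Proof. exact: nabsM. Qed.
Fact wKG_ultra (x y : KG) : w (val (x + y)) <= Num.max (w (val x)) (w (val y)).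
Proof. exact: nabs_ultra. Qed.

Definition wKG : nonarch_abs R KG := NonarchAbs wKG_ge0 wKG_eq0 wKG_M wKG_ultra.

Lemma wKG_scale (a : K) (x : KG) : wKG (a *: x) = v a * wKG x.
Proof. by rewrite /= nabsM w_ext. Qed.

Lemma wKG_alg (a : K) : wKG a%:A = v a.
Proof. by rewrite wKG_scale nabs1 mulr1. Qed.

Lemma wKG_X (x : KG) k : wKG (x ^+ k) = wKG x ^+ k.
Proof. by elim: k => [|k IH]; rewrite ?expr0 ?nabs1 // !exprS nabsM IH. Qed.

Lemma wKG_root (x : KG) N : (0 < N)%N -> x ^+ N = 1 -> wKG x = 1.
Proof.
move=> N0 xN; have : wKG x ^+ N = 1.
  by rewrite -wKG_X xN nabs1.
by move/eqP; rewrite pexpr_eq1 ?nabs_ge0 // => /eqP.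
Qed.

Lemma wKG_V (x : KG) : wKG x^-1 = (wKG x)^-1.
Proof.
have [->|x0] := eqVneq x 0; first by rewrite invr0 nabs0 invr0.
have wx : wKG x != 0 by rewrite nabs_eq0.
by apply: (mulfI wx); rewrite -nabsM !mulfV ?nabs1.
Qed.

Lemma wKG_gtup (z : Gamma_tuple p iota n) j : wKG (z j) = 1.
Proof.
have [s s0 hs] := gtupP z j; apply: wKG_root hs; by rewrite expn_gt0 p_gt0.
Qed.

Lemma wKG_monomial (z : Gamma_tuple p iota n) i : wKG (monomial z i) = 1.
Proof.
rewrite /monomial; elim/big_ind: _ => [|x y hx hy|j _]; first exact: nabs1.
  by rewrite nabsM hx hy mulr1.
have wX k : wKG (z j ^+ k) = 1 by rewrite wKG_X wKG_gtup expr1n.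
by case: (i j) => k; rewrite ?NegzE /exprz ?wKG_V wX // invr1.
Qed.

Section OneClass.
Variable C : laurent_class v n.
Local Notation A := (laurent_ring C).
Local Notation AG := (alg_ext KG A).

(** The coefficients of a product of tensors are infinite sums. In this limit form, an
    identity or a bound that holds for finite convolutions passes to the product. *)
Lemma ext_coefM_approx (F G : AG) i e : 0 < e -> exists T : {fset mi},
  forall T' : {fset mi}, (T `<=` T')%fset ->
  wKG (ext_coef i (F * G) - \sum_(j <- T') ext_coef j F * ext_coef (i - j) G) < e.
Proof.
move=> e0; elim/tens_ind: F => [|F F' [T hT] [T' hT']|f l].
- exists fset0 => T' _; rewrite [_ * G]mul0r ext_coef0 big1 ?subrr ?nabs0 // => j _.
  by rewrite [ext_coef j _]ext_coef0 mul0r.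
- exists (T `|` T')%fset => U hU.
  have := nabsD_lt (hT U (fsubset_trans (fsubsetUl _ _) hU))
    (hT' U (fsubset_trans (fsubsetUr _ _) hU)).
  rewrite addrACA -opprD -big_split -ext_coefD -mulrDl /=.
  by under eq_bigr do rewrite -mulrDl -ext_coefD.
elim/tens_ind: G => [|G G' [T hT] [T' hT']|g m].
- exists fset0 => T' _; rewrite [_ * 0]mulr0 ext_coef0 big1 ?subrr ?nabs0 // => j _.
  by rewrite [ext_coef (i - j) _]ext_coef0 mulr0.
- exists (T `|` T')%fset => U hU.
  have := nabsD_lt (hT U (fsubset_trans (fsubsetUl _ _) hU))
    (hT' U (fsubset_trans (fsubsetUr _ _) hU)).
  rewrite addrACA -opprD -big_split -ext_coefD -mulrDr /=.
  by under eq_bigr do rewrite -mulrDr -ext_coefD.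
have nl := null_mul_term (@lrad_gt0 _ _ _ _ C) i (lmem_conv (lcoefP f)) (lmem_conv (lcoefP g)).
have lm0 : 0 < wKG (l * m) + 1 by rewrite ltr_wpDl ?nabs_ge0.
have [T hT] := nsumP nl (divr_gt0 e0 lm0); exists T => U /hT hU.
rewrite -[tpure _ _ f l]/(apure f l) -[tpure _ _ g m]/(apure g m) apureM ext_coef_pure.
have -> : \sum_(j <- U) ext_coef j (apure f l) * ext_coef (i - j) (apure g m) =
          (\sum_(j <- U) f j * g (i - j)) *: (l * m).
  rewrite scaler_suml; apply: eq_bigr => j _.
  by rewrite !ext_coef_pure -scalerAl -scalerAr scalerA.
rewrite -scalerBl wKG_scale -nabsN opprB lcoefM.
move: hU; rewrite ltr_pdivlMr //; apply: le_lt_trans.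
by apply: ler_wpM2l; rewrite ?nabs_ge0 // lerDl.
Qed.

Lemma wKG_small_eq (x y : KG) : (forall e, 0 < e -> wKG (x - y) < e) -> x = y.
Proof. by move=> h; apply: (@nabs_small_eq _ _ wKG) => e /h/ltW. Qed.

Lemma gtup_neq0 (z : Gamma_tuple p iota n) j : z j != 0.
Proof. by rewrite -(nabs_eq0 wKG) wKG_gtup oner_neq0. Qed.

Lemma gsubstD (z : Gamma_tuple p iota n) (F G : AG) : gsubst z (F + G) = gsubst z F + gsubst z G.
Proof. by apply: ext_coef_inj => i; rewrite !(gsubstE, ext_coefD) // mulrDr. Qed.

Lemma gsubst0 (z : Gamma_tuple p iota n) : gsubst z (0 : AG) = 0.
Proof. by apply: (addIr (gsubst z 0)); rewrite -gsubstD !add0r. Qed.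

Lemma gsubst_const (z : Gamma_tuple p iota n) (k : KG) : gsubst z (apure (1 : A) k) = apure 1 k.
Proof.
apply: ext_coef_inj => i; rewrite gsubstE // ext_coef_pure lcoef1.
case: eqP => [->|_]; last by rewrite scale0r mulr0.
by rewrite /monomial big1 ?mul1r // => j _; rewrite ffunE expr0z.
Qed.

Lemma gsubstM (z : Gamma_tuple p iota n) (F G : AG) : gsubst z (F * G) = gsubst z F * gsubst z G.
Proof.
apply: ext_coef_inj => i; apply: wKG_small_eq => e e0.
have [T hT] := ext_coefM_approx F G i e0.
have [T' hT'] := ext_coefM_approx (gsubst z F) (gsubst z G) i e0.
have h1 := hT _ (fsubsetUl T T'); have h2 := hT' _ (fsubsetUr T T').
set S := \sum_(j <- _) _ in h1; set S' := \sum_(j <- _) _ in h2.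
have SE : S' = monomial z i * S.
  rewrite /S' /S mulr_sumr; apply: eq_bigr => j _; rewrite !gsubstE // mulrACA -monomialD.
    by rewrite addrC subrK.
  exact: gtup_neq0.
rewrite gsubstE //; rewrite SE in h2.
have {}h1 : wKG (monomial z i * ext_coef i (F * G) - monomial z i * S) < e.
  by rewrite -mulrBr nabsM wKG_monomial mul1r.
have := nabsB_lt h1 h2.
by rewrite opprB addrA subrK.
Qed.

Lemma gsubst_gtup1 (F : AG) : gsubst (gtup1 p iota n) F = F.
Proof.
apply: ext_coef_inj => i; rewrite gsubstE // /monomial big1 ?mul1r // => j _.
by rewrite /= exp1rz.
Qed.

Lemma monomial_gtupM (z z' : Gamma_tuple p iota n) i :
  monomial (gtupM z z') i = monomial z i * monomial z' i.
Proof. by rewrite /monomial -big_split; apply: eq_bigr => j _; rewrite /= expfzMl. Qed.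

Lemma gsubst_gtupM (z z' : Gamma_tuple p iota n) (F : AG) :
  gsubst (gtupM z z') F = gsubst z (gsubst z' F).
Proof. by apply: ext_coef_inj => i; rewrite !gsubstE // monomial_gtupM mulrA. Qed.

Lemma gsubst1 (z : Gamma_tuple p iota n) : gsubst z (1 : AG) = 1.
Proof. exact: gsubst_const. Qed.

Lemma gsubst_sum (I : Type) (s : seq I) (S : pred I) (F : I -> AG) z :
  gsubst z (\sum_(i <- s | S i) F i) = \sum_(i <- s | S i) gsubst z (F i).
Proof. by elim/big_rec2: _ => [|i x y _ <-]; rewrite ?gsubst0 ?gsubstD. Qed.

Fact gsubst_zmod (z : Gamma_tuple p iota n) : zmod_morphism (gsubst z : AG -> AG).
Proof.
by move=> F G; apply: ext_coef_inj => i; rewrite !(gsubstE, ext_coefB) // mulrBr.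
Qed.

Fact gsubst_monoid (z : Gamma_tuple p iota n) : monoid_morphism (gsubst z : AG -> AG).
Proof. by split; [apply: gsubst1|apply: gsubstM]. Qed.

Definition gsubst_rmorphism (z : Gamma_tuple p iota n) : {rmorphism AG -> AG} :=
  HB.pack (gsubst z : AG -> AG) (GRing.isZmodMorphism.Build AG AG _ (gsubst_zmod z))
    (GRing.isMonoidMorphism.Build AG AG _ (gsubst_monoid z)).

Section Bounds.
Variable J : polysegment R n.

(** The bound [|F|_J <= c], without supremum. *)
Definition bdd (c : R) (F : AG) := forall r, in_polysegment J r ->
  forall i, wKG (ext_coef i F) * monomial r i <= c.

Let mono0 r i : in_polysegment J r -> 0 < monomial r i.
Proof. by move=> hr; apply: monomial_gt0 => k; apply: in_polysegment_gt0 hr. Qed.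

Lemma bdd_le c c' F : c <= c' -> bdd c F -> bdd c' F.
Proof. by move=> h hF r hr i; apply: le_trans h; apply: hF. Qed.

Lemma bddD c F G : bdd c F -> bdd c G -> bdd c (F + G).
Proof.
move=> hF hG r hr i; rewrite ext_coefD -ler_pdivlMr ?mono0 //.
by apply: nabsD_le; rewrite ler_pdivlMr ?mono0 //; [apply: hF|apply: hG].
Qed.

Lemma bdd0 c : 0 <= c -> bdd c 0.
Proof. by move=> c0 r hr i; rewrite ext_coef0 nabs0 mul0r. Qed.

Lemma bdd_sum (I : Type) (s : seq I) (S : pred I) (F : I -> AG) c : 0 <= c ->
  (forall i, S i -> bdd c (F i)) -> bdd c (\sum_(i <- s | S i) F i).
Proof. by move=> c0 h; elim/big_rec: _ => [|i x Si]; [apply: bdd0|apply/bddD/h]. Qed.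

Lemma bddM c d F G : 0 <= c -> 0 <= d -> bdd c F -> bdd d G -> bdd (c * d) (F * G).
Proof.
move=> c0 d0 hF hG r hr i; have m0 := mono0 i hr.
rewrite -ler_pdivlMr //; apply/ler_addgt0Pr => e e0.
have [T hT] := ext_coefM_approx F G i e0; have {}hT := hT _ (fsubset_refl T).
have cd0 : 0 <= c * d / monomial r i by rewrite divr_ge0 ?mulr_ge0 // ltW.
rewrite -[ext_coef i _](subrK (\sum_(j <- T) ext_coef j F * ext_coef (i - j) G)).
apply: nabsD_le; first by rewrite (le_trans (ltW hT)) // lerDr.
apply: nabs_sum_le => [|j _]; first by rewrite addr_ge0 // ltW.
apply: (@le_trans _ _ (c * d / monomial r i)); last by rewrite lerDl ltW.
rewrite ler_pdivlMr // nabsM.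
have -> : monomial r i = monomial r j * monomial r (i - j).
  by rewrite -monomialD 1?addrC ?subrK // => k; rewrite gt_eqF // (in_polysegment_gt0 k hr).
rewrite mulrACA; apply: ler_pM; rewrite ?mulr_ge0 ?nabs_ge0 ?(ltW (mono0 _ hr)) //.
  exact: hF.
exact: hG.
Qed.

Lemma bdd_const k : bdd (wKG k) (apure (1 : A) k).
Proof.
move=> r hr i; rewrite ext_coef_pure lcoef1; case: eqP => [->|_].
  by rewrite scale1r /monomial big1 ?mulr1 // => j _; rewrite ffunE expr0z.
by rewrite scale0r nabs0 mul0r nabs_ge0.
Qed.

Lemma bdd1 : bdd 1 1.
Proof. by rewrite -{1}(nabs1 wKG); apply: bdd_const. Qed.

Lemma bdd_prod (I : Type) (s : seq I) (F : I -> AG) c : 0 <= c ->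
  (forall i, bdd c (F i)) -> bdd (c ^+ size s) (\prod_(i <- s) F i).
Proof.
move=> c0 h; elim: s => [|i s IH]; first by rewrite big_nil; apply: bdd1.
by rewrite big_cons exprS; apply: bddM; rewrite ?exprn_ge0.
Qed.

Lemma bdd_gsubst c z F : bdd c F -> bdd c (gsubst z F).
Proof. by move=> hF r hr i; rewrite gsubstE // nabsM wKG_monomial mul1r; apply: hF. Qed.

Lemma bdd_pure c (f : A) : bdd c (apure f 1) <->
  forall r, in_polysegment J r -> forall i, v (f i) * monomial r i <= c.
Proof.
by split=> h r hr i; have := h r hr i; rewrite ext_coef_pure wKG_alg.
Qed.

End Bounds.

Lemma bdd_sub (J J' : polysegment R n) c F :
  (forall r, in_polysegment J' r -> in_polysegment J r) -> bdd J c F -> bdd J' c F.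
Proof. by move=> h hF r /h; apply: hF. Qed.

End OneClass.
End GaussNorms.

(** * Polysegments, boundedness and units *)

Section RealEstimates.
Variable R : realType.
Implicit Types q e x c B eta : R.

Lemma expr_small q e : 0 <= q -> q < 1 -> 0 < e -> exists N, forall m, (N <= m)%N -> q ^+ m < e.
Proof.
move=> q0 q1 e0; have [qz|qn] := eqVneq q 0.
  by exists 1%N => m hm; rewrite qz expr0n gtn_eqF.
have {}q0 : 0 < q by rewrite lt_def qn.
pose x := q^-1 - 1; have x0 : 0 < x by rewrite subr_gt0 invf_gt1.
have xE : q^-1 = 1 + x by rewrite /x addrC subrK.
have bern m : 1 + x *+ m <= q^-1 ^+ m.
  rewrite xE; elim: m => [|m IH]; first by rewrite mulr0n addr0 expr0.
  rewrite exprS; apply: (@le_trans _ _ ((1 + x) * (1 + x *+ m))).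
    rewrite mulrDl mul1r mulrDr mulr1 mulrSr -!addrA !lerD2l lerDl.
    by rewrite mulr_ge0 ?mulrn_wge0 // ltW.
  by rewrite ler_pM2l // ltr_wpDr // ltW.
exists (Num.bound (e * x)^-1) => m hm.
have mpos : e^-1 < q^-1 ^+ m.
  apply: lt_le_trans (bern m); apply: ltr_wpDl => //.
  have : (e * x)^-1 < m%:R.
    by apply: lt_le_trans (archi_boundP _) _; rewrite ?ler_nat // invr_ge0 mulr_ge0 // ltW.
  by rewrite invfM ltr_pdivrMr // mulr_natl.
by move: mpos; rewrite exprVn ltf_pV2 // posrE ?exprn_gt0.
Qed.

(** The exponent [p ^ k - t] eventually exceeds any multiple of [k]. *)
Lemma growth_vs_decay (p : nat) B q eta c (t : nat) : (1 < p)%N -> 0 <= B -> 0 <= q ->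
  0 <= eta -> eta < 1 -> 0 < c -> exists2 k, (0 < k)%N &
    (t <= p ^ k)%N /\ B * q ^+ k * eta ^+ (p ^ k - t) < c.
Proof.
move=> p1 B0 q0 e0 e1 c0.
have [M hM] : exists M, q * eta ^+ M <= 2^-1.
  have [|M hM] := @expr_small eta (2 * (q + 1))^-1 e0 e1.
    by rewrite invr_gt0 mulr_gt0 // ltr_wpDl.
  exists M; have /ltW h := hM _ (leqnn M).
  apply: (le_trans (ler_wpM2l q0 h)); rewrite invfM mulrCA ler_piMr //.
  by rewrite ler_pdivrMr ?mul1r ?lerDl // ltr_wpDl.
have h2 : (2^-1 : R) < 1 by rewrite invf_lt1 // ltr1n.
have h20 : (0 : R) <= 2^-1 by rewrite invr_ge0.
have cB : 0 < c / (B + 1) by rewrite divr_gt0 // ltr_wpDl.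
have [N hN] := expr_small h20 h2 cB.
(* 2 ^ (2 j) >= j ^ 2 is at least 2 M j + t as soon as j exceeds 2 M + t *)
pose j := (N + 2 * M + t).+1; pose k := (2 * j)%N.
have kN : (N <= k)%N by rewrite /k /j; lia.
have le : (M * k + t <= p ^ k)%N.
  apply: (@leq_trans (2 ^ k)); last by rewrite leq_exp2r // /k /j; lia.
  have -> : (2 ^ k = 2 ^ j * 2 ^ j)%N by rewrite /k mul2n -addnn expnD.
  have hu : (j <= 2 ^ j)%N by rewrite ltnW // ltn_expl.
  apply: (@leq_trans (j * j)); last exact: leq_mul.
  by rewrite /k /j; nia.
exists k => //; split; first lia.
have -> : (p ^ k - t = M * k + (p ^ k - t - M * k))%N by lia.
rewrite exprD exprM -!mulrA [q ^+ k * _]mulrA -exprMn.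
have s1 : eta ^+ (p ^ k - t - M * k) <= 1 by apply: exprn_ile1 => //; apply: ltW.
have s2 : (q * eta ^+ M) ^+ k <= 2^-1 ^+ k.
  by apply: lerXn2r; rewrite ?nnegrE ?mulr_ge0 ?exprn_ge0 ?invr_ge0.
have s3 : (q * eta ^+ M) ^+ k * eta ^+ (p ^ k - t - M * k) <= 2^-1 ^+ k.
  by apply: (le_trans (ler_piMr _ s1)); rewrite ?exprn_ge0 ?mulr_ge0 ?exprn_ge0.
apply: (le_lt_trans (ler_wpM2l B0 s3)).
have B1 : 0 < B + 1 by rewrite ltr_wpDl.
have := hN k kN; rewrite ltr_pdivlMr // mulrC; apply: le_lt_trans.
by rewrite ler_wpM2r ?lerDl // exprn_ge0 // invr_ge0.
Qed.

End RealEstimates.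

Section Polysegments.
Variables (R : realType) (n : nat).
Local Notation mi := (multi_index n).
Implicit Types (J : polysegment R n).

Definition vertex J (s : 'I_n -> bool) (k : 'I_n) : R := if s k then pupper J k else plower J k.

(** The vertex at which the monomial of exponent [i] is largest on [J]. *)
Definition top_vertex J (i : mi) := vertex J (fun k => 0 <= i k).

Lemma vertex_in J s : in_polysegment J (vertex J s).
Proof. by move=> k; rewrite /vertex; case: (s k); rewrite lexx plower_le_upper. Qed.

Lemma monomial_le_top J (r : 'I_n -> R) i eta : 0 <= eta -> (forall k, 0 < r k) ->
  (forall k, r k <= eta * pupper J k /\ plower J k <= eta * r k) ->
  monomial r i <= eta ^+ msize i * monomial (top_vertex J i) i.
Proof.
move=> eta0 r0 hr; have J0 k := plower_gt0 J k.
have u0 k : 0 < pupper J k by apply: lt_le_trans (plower_le_upper J k).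
rewrite /monomial /msize -prodrXr -big_split /=.
apply: ler_prod => k _; rewrite exprz_ge0 ?(ltW (r0 k)) //=.
have [e1 e2] := hr k.
rewrite /top_vertex /vertex; case: (i k) => m /=.
  by rewrite -exprMn; apply: lerXn2r; rewrite ?nnegrE ?(ltW (r0 k)) ?mulr_ge0 ?(ltW (u0 k)).
rewrite -[r k ^ _]/((r k ^+ m.+1)^-1) -[plower J k ^ _]/((plower J k ^+ m.+1)^-1).
rewrite ler_pdivlMr ?exprn_gt0 // mulrC ler_pdivrMr ?exprn_gt0 // -exprMn.
by apply: lerXn2r; rewrite ?nnegrE ?mulr_ge0 ?(ltW (r0 k)) ?(ltW (J0 k)).
Qed.

Lemma monomial_le_vertex J r i : in_polysegment J r ->
  monomial r i <= monomial (top_vertex J i) i.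
Proof.
move=> hr; rewrite -[leRHS]mul1r -(expr1n R (msize i)); apply: monomial_le_top => // k.
  exact: in_polysegment_gt0 hr.
by rewrite !mul1r; apply/andP; rewrite andbC.
Qed.

(** Around [rho] every coordinate stays away from the ends of [J] by a factor [eta < 1],
    which each exponent then gains against the value at the top vertex. *)
Lemma shrink J rho : in_interior J rho -> exists (J' : polysegment R n) (eta : R),
  [/\ in_interior J' rho, forall r, in_polysegment J' r -> in_polysegment J r,
      0 <= eta < 1 & forall r i, in_polysegment J' r ->
        monomial r i <= eta ^+ msize i * monomial (top_vertex J i) i].
Proof.
move=> hJ; have J0 k := plower_gt0 J k.
have [lo [hi bounds]] : exists lo hi : 'I_n -> R, forall k,
    [/\ plower J k < lo k, lo k < rho k, rho k < hi k & hi k < pupper J k].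
  exists (fun k => (plower J k + rho k) / 2), (fun k => (pupper J k + rho k) / 2) => k.
  by have /andP[h1 h2] := hJ k; split; lra.
have lo0 k : 0 < lo k by have [h _ _ _] := bounds k; apply: lt_trans h.
have u0 k : 0 < pupper J k by apply: lt_le_trans (plower_le_upper J k).
have lohi k : lo k <= hi k by have [_ h1 h2 _] := bounds k; apply/ltW/(lt_trans h1).
pose eta := \big[Num.max/0]_k Num.max (hi k / pupper J k) (plower J k / lo k).
have eta0 : 0 <= eta by apply: bigmax_ge_id.
have eta1 : eta < 1.
  apply: bigmax_lt => // k _; have [h1 _ _ h2] := bounds k.
  by rewrite gt_max !ltr_pdivrMr // !mul1r h1 h2.
have eta_le k : hi k <= eta * pupper J k /\ plower J k <= eta * lo k.
  have := le_bigmax 0 (fun k => Num.max (hi k / pupper J k) (plower J k / lo k)) k.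
  by rewrite -/eta ge_max !ler_pdivrMr // => /andP.
exists (Polysegment lo0 lohi), eta; split=> //.
- by move=> k /=; have [_ -> -> _] := bounds k.
- move=> r hr k; have /andP[h1 h2] := hr k; have [h3 _ _ h4] := bounds k.
  by rewrite (le_trans (ltW h3) h1) (le_trans h2 (ltW h4)).
- by rewrite eta0.
move=> r i hr; apply: monomial_le_top => // [k|k]; first exact: in_polysegment_gt0 hr.
have /andP[h1 h2] := hr k; have [e1 e2] := eta_le k.
by rewrite (le_trans h2 e1) (le_trans e2) // ler_wpM2l.
Qed.

Lemma monomial_bounded J rho i : in_interior J rho -> exists (J' : polysegment R n) c,
  [/\ in_interior J' rho, forall r, in_polysegment J' r -> in_polysegment J r &
      forall r, in_polysegment J' r -> monomial r i <= c].
Proof.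
move=> /shrink[J' [eta [h1 h2 h3 h4]]]; exists J', (eta ^+ msize i * monomial (top_vertex J i) i).
by split=> // r; apply: h4.
Qed.

End Polysegments.

Section Boundedness.
Variables (R : realType) (K : fieldType) (v : complete_abs R K) (n : nat).
Local Notation mi := (multi_index n).
Implicit Types (J : polysegment R n) (f : mi -> K).

Definition vbdd J (c : R) f :=
  forall r, in_polysegment J r -> forall i, v (f i) * monomial r i <= c.

Lemma converges_at_bounded rho f : (forall k, 0 < rho k) -> converges_at v rho f ->
  exists2 M, 0 <= M & forall i, v (f i) * monomial rho i <= M.
Proof.
move=> rho0 /(_ 1 ltr01)[N hN]; have [F hF] := bounded_fset n N.
have nv0 i : 0 <= v (f i) * monomial rho i.
  by rewrite mulr_ge0 ?nabs_ge0 // ltW // monomial_gt0.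
have s0 : 0 <= \sum_(j <- F) v (f j) * monomial rho j by apply: sumr_ge0.
exists (1 + \sum_(j <- F) v (f j) * monomial rho j) => [|i]; first by rewrite addr_ge0.
have [iF|iF] := boolP (i \in F).
  by rewrite (big_fsetD1 i) //= addrCA lerDl addr_ge0 //; apply: sumr_ge0.
rewrite (le_trans (ltW (hN _ _))) ?lerDl // leqNgt; apply: contra iF; exact: hF.
Qed.

(** The supremum over a polysegment is attained at its vertices. *)
Lemma converges_on_bounded J f : converges_on v J f -> exists2 c, 0 <= c & vbdd J c f.
Proof.
move=> hf; pose V (s : {ffun 'I_n -> bool}) := vertex J s.
have hV s : exists M, 0 <= M /\ forall i, v (f i) * monomial (V s) i <= M.
  have [k|M M0 hM] := converges_at_bounded _ (hf _ (vertex_in J s)); last by exists M.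
  exact: in_polysegment_gt0 (vertex_in J s).
pose M s := sval (cid (hV s)).
have M0 s : 0 <= M s by have [] := svalP (cid (hV s)).
have hM s i : v (f i) * monomial (V s) i <= M s by have [_] := svalP (cid (hV s)).
exists (\sum_s M s) => [|r hr i]; first exact: sumr_ge0.
apply: (le_trans (ler_wpM2l (nabs_ge0 v _) (monomial_le_vertex i hr))).
pose s := [ffun k => 0 <= i k].
have -> : monomial (top_vertex J i) i = monomial (V s) i.
  by apply: eq_bigr => k _; rewrite /V /top_vertex /vertex ffunE.
by rewrite (bigD1 s) //= (le_trans (hM s i)) // lerDl sumr_ge0.
Qed.

(** The factor [eta ^ msize i] turns a bound into convergence to [0]. *)
Lemma bounded_converges J J' eta c f : 0 <= eta < 1 -> vbdd J c f ->
  (forall r i, in_polysegment J' r ->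
        monomial r i <= eta ^+ msize i * monomial (top_vertex J i) i) ->
  converges_on v J' f.
Proof.
move=> /andP[e0 e1] hf hJ r hr e he.
have c0 : 0 <= c.
  apply: le_trans (hf _ (vertex_in J xpredT) 0); rewrite mulr_ge0 ?nabs_ge0 // ltW //.
  by apply: monomial_gt0 => k; apply: in_polysegment_gt0 (vertex_in J xpredT).
have [|N hN] := expr_small e0 e1 (e := e / (c + 1)); first by rewrite divr_gt0 // ltr_wpDl.
exists N => i hi; have := hN _ hi; rewrite ltr_pdivlMr ?ltr_wpDl //; apply: le_lt_trans.
apply: (le_trans (ler_wpM2l (nabs_ge0 v _) (hJ r i hr))); rewrite mulrCA.
apply: ler_wpM2l; first by rewrite exprn_ge0.
by apply: (le_trans (hf _ (vertex_in J _) i)); rewrite lerDl.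
Qed.

End Boundedness.

Section Units.
Variables (R : realType) (K : fieldType) (v : complete_abs R K) (n : nat).
Variables (rho : 'I_n -> R) (rho0 : forall k, 0 < rho k).
Local Notation mi := (multi_index n).
Local Notation A := (Rrho v rho0).

Lemma lcoefB (C : laurent_class v n) (f g : laurent_ring C) i : (f - g) i = f i - g i.
Proof. by rewrite /= mulN1r. Qed.

Lemma lcoef_sum (C : laurent_class v n) (I : Type) (s : seq I) (F : I -> laurent_ring C) i :
  (\sum_(k <- s) F k) i = \sum_(k <- s) F k i.
Proof. by elim/big_rec2: _ => [|k x y _ <-]; rewrite ?lcoef0 ?lcoefD. Qed.

Lemma mul_bdd (J : polysegment R n) c d (f g : A) : 0 <= c -> 0 <= d ->
  vbdd v J c f -> vbdd v J d g -> vbdd v J (c * d) (f * g).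
Proof.
move=> c0 d0 hf hg r hr i.
have rn k : 0 < r k by apply: in_polysegment_gt0 hr.
have m0 j : 0 < monomial r j by apply: monomial_gt0.
rewrite lcoefM -ler_pdivlMr //; apply: nsum_le.
- exact: (@null_mul_term _ _ _ _ _ (@lrad_gt0 _ _ _ _ (Rrho_class v rho0)) _ _ i
    (lmem_conv (lcoefP f)) (lmem_conv (lcoefP g))).
- by rewrite divr_ge0 ?mulr_ge0 // ltW.
move=> j; rewrite ler_pdivlMr // nabsM.
have -> : monomial r i = monomial r j * monomial r (i - j).
  by rewrite -monomialD 1?addrC ?subrK // => k; rewrite gt_eqF.
by rewrite mulrACA; apply: ler_pM; rewrite ?mulr_ge0 ?nabs_ge0 ?(ltW (m0 _)) ?hf ?hg.
Qed.

Lemma bdd_one (J : polysegment R n) : vbdd v J 1 (1 : A).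
Proof.
move=> r hr i; rewrite lcoef1; case: eqP => [->|_].
  by rewrite nabs1 mul1r /monomial big1 // => j _; rewrite ffunE expr0z.
by rewrite nabs0 mul0r.
Qed.

Lemma exp_bdd (J : polysegment R n) c (f : A) m : 0 <= c ->
  vbdd v J c f -> vbdd v J (c ^+ m) (f ^+ m).
Proof.
move=> c0 hf; elim: m => [|m IH]; first exact: bdd_one.
by rewrite !exprS; apply: mul_bdd; rewrite ?exprn_ge0.
Qed.

Lemma near_bounded (J : polysegment R n) c (f : mi -> K) :
  in_interior J rho -> vbdd v J c f -> converges_near v rho f.
Proof.
move=> /shrink[J' [eta [h1 h2 h3 h4]]] hf; exists J' => //.
exact: bounded_converges h3 hf h4.
Qed.

Lemma vbddB (J : polysegment R n) c (f g : A) : vbdd v J c f -> vbdd v J c g -> vbdd v J c (f - g).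
Proof.
move=> hf hg r hr i; have m0 : 0 < monomial r i.
  by apply: monomial_gt0 => k; apply: in_polysegment_gt0 hr.
rewrite lcoefB -ler_pdivlMr //; apply: nabsB_le; rewrite ler_pdivlMr //.
  exact: hf.
exact: hg.
Qed.

(** The inverse is the sum of the powers of [u], taken coefficient by coefficient; its
    tails inherit the bounds [q ^ M], so it converges near [rho] and the product with
    [1 - u] differs from [1] by less than every [q ^ M]. *)
Lemma geometric_unit (J : polysegment R n) q (u : A) : in_interior J rho ->
  0 <= q < 1 -> vbdd v J q u -> exists g, (1 - u) * g = 1.
Proof.
move=> hJ /andP[q0 q1] hu.
have hum m := exp_bdd m q0 hu.
have Jrho := interior_in hJ.
have mon0 r i : in_polysegment J r -> 0 < monomial r i.
  by move=> hr; apply: monomial_gt0 => k; apply: in_polysegment_gt0 hr.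
have qM m m' : (m <= m')%N -> q ^+ m' <= q ^+ m.
  by move=> h; apply: ler_wiXn2l => //; apply: ltW.
have nullu i : null_family v (fun m => (u ^+ m : A) i).
  move=> e e0; have e'0 : 0 < e * monomial rho i by rewrite mulr_gt0 // mon0.
  have [N hN] := expr_small q0 q1 e'0.
  exists [fset m in iota 0 N]%fset => m; rewrite in_fset_ /= mem_iota add0n -leqNgt => hm.
  by rewrite -(ltr_pM2r (mon0 rho i Jrho)); apply: le_lt_trans (hN m hm); apply: hum.
pose g0 i := nsum v (fun m => (u ^+ m : A) i).
have tail M r i : in_polysegment J r ->
    v (g0 i - (\sum_(m < M) u ^+ m : A) i) * monomial r i <= q ^+ M.
  move=> hr; have m0 := mon0 r i hr.
  have -> : (\sum_(m < M) u ^+ m : A) i = \sum_(m <- [fset m in iota 0 M]%fset) (u ^+ m : A) i.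
    rewrite lcoef_sum -(big_mkord xpredT (fun m => (u ^+ m : A) i)) /index_iota subn0.
    apply: perm_big; apply: uniq_perm; rewrite ?iota_uniq ?fset_uniq // => m.
    by rewrite in_fset_ /=.
  rewrite -ler_pdivlMr //; apply: nsum_tail => // [|m].
    by rewrite divr_ge0 ?exprn_ge0 // ltW.
  rewrite in_fset_ /= mem_iota add0n -leqNgt => hm; rewrite ler_pdivlMr //.
  exact: le_trans (hum m r hr i) (qM _ _ hm).
have g0b : vbdd v J 1 g0.
  by move=> r hr i; have := tail 0%N r i hr; rewrite big_ord0 lcoef0 subr0 expr0.
pose g : A := @LaurentRing _ _ _ _ (Rrho_class v rho0) g0 (near_bounded hJ g0b).
exists g; apply: lring_inj => i; apply: (@nabs_small_eq _ _ v) => e e0.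
have e'0 : 0 < e * monomial rho i by rewrite mulr_gt0 // mon0.
have [M hM] := expr_small q0 q1 e'0; have {}hM := hM M (leqnn M).
rewrite -lcoefB -(ler_pM2r (mon0 rho i Jrho)) (le_trans _ (ltW hM)) //.
pose S : A := \sum_(m < M) u ^+ m.
have SE : (1 - u) * S = 1 - u ^+ M.
  by rewrite -opprB mulNr -subrX1 opprB.
have -> : (1 - u) * g - 1 = (1 - u) * (g - S) - u ^+ M.
  by rewrite mulrBr SE opprB -[RHS]addrA [u ^+ M - 1 - _]addrAC subrr add0r.
suff key : vbdd v J (q ^+ M) ((1 - u) * (g - S) - u ^+ M) by exact: key.
apply: vbddB; last exact: hum.
rewrite -[q ^+ M]mul1r; apply: mul_bdd => //; first exact: exprn_ge0.
  by apply: vbddB; [apply: bdd_one|move=> r hr j; apply: le_trans (ltW q1); apply: hu].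
by move=> r hr j; rewrite lcoefB; apply: tail.
Qed.

Fact monomial_near (s : mi) (c : K) : converges_near v rho (fun i => if i == s then c else 0).
Proof.
have [J hJ] := interior_ex rho0; exists J => // r hr e e0.
exists (msize s).+1 => i hi; case: eqP => [si|_]; first by rewrite si ltnn in hi.
by rewrite nabs0 mul0r.
Qed.

Definition lmon (s : mi) (c : K) : A :=
  @LaurentRing _ _ _ _ (Rrho_class v rho0) _ (monomial_near s c).

Lemma lmonM s c (f : A) i : (lmon s c * f) i = c * f (i - s).
Proof.
rewrite lcoefM (@nsum_single _ _ _ _ _ s) /= ?eqxx // => j /negPf ->.
by rewrite mul0r.
Qed.

(** Divided by its dominant term, the series is [1 - u] with [u] small. *)
Lemma dominant_unit (J : polysegment R n) q (h : A) s : in_interior J rho ->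
  0 <= q < 1 -> h s != 0 ->
  (forall r i, in_polysegment J r -> i != s ->
     v (h i) * monomial r i <= q * (v (h s) * monomial r s)) ->
  exists g, h * g = 1.
Proof.
move=> hJ hq hs dom; pose t := lmon (- s) (h s)^-1.
have [|g hg] := @geometric_unit J q (1 - t * h) hJ hq; last first.
  by exists (t * g); rewrite mulrA [h * t]mulrC -[RHS]hg opprB addrCA subrr addr0.
move=> r hr i; have /andP[q0 _] := hq.
rewrite lcoefB lmonM opprK lcoef1; case: eqP => [->|/eqP i0].
  by rewrite add0r mulVf // subrr nabs0 mul0r.
have r0 k : 0 < r k by apply: in_polysegment_gt0 hr.
have vs : 0 < v (h s) by rewrite lt_def nabs_ge0 nabs_eq0 hs.
have vn : v (h s) != 0 by rewrite gt_eqF.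
have m0 : 0 < v (h s) * monomial r s by rewrite mulr_gt0 // monomial_gt0.
rewrite sub0r nabsN nabsM -(ler_pM2r m0).
have -> : v (h s)^-1 = (v (h s))^-1.
  by apply: (mulfI vn); rewrite -nabsM !mulfV ?nabs1.
have nis : i + s != s by rewrite -subr_eq0 addrK.
apply: le_trans (dom r (i + s) hr nis).
rewrite monomialD; last by move=> k; rewrite gt_eqF.
by rewrite le_eqVlt; apply/orP; left; apply/eqP; field.
Qed.

End Units.

(** * Galois descent and characters of the roots of unity *)

Section GaloisDescent.
Variables (p : nat) (R : realType) (K : fieldType) (v : complete_abs R K).
Variables (Kbar : closedFieldType) (iota : {rmorphism K -> Kbar}) (n : nat).
Local Notation KG := (KGamma p iota).
Variable C : laurent_class v n.
Local Notation A := (laurent_ring C).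
Local Notation AG := (alg_ext KG A).

Fact apure1_zmod : zmod_morphism (fun f : A => apure f 1 : AG).
Proof.
move=> f g; apply: ext_coef_inj => i.
by rewrite ext_coefB !ext_coef_pure -scalerBl lcoefB.
Qed.

Fact apure1_monoid : monoid_morphism (fun f : A => apure f 1 : AG).
Proof. by split=> // f g; rewrite apureM mulr1. Qed.

Definition apure1 : {rmorphism A -> AG} := HB.pack (fun f : A => apure f 1 : AG)
  (GRing.isZmodMorphism.Build A AG _ apure1_zmod)
  (GRing.isMonoidMorphism.Build A AG _ apure1_monoid).

Variables (sigma : {rmorphism KG -> KG}) (hs : is_galois sigma).

Lemma galoisZ (k : K) (l : KG) : sigma (k *: l) = k *: sigma l.
Proof. by rewrite -[k *: l]mulr_algl rmorphM hs.2 mulr_algl. Qed.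

Fact Kadd_gal (P : lmodType A) : Kadditive (fun x : P => x) sigma.
Proof. by split=> // [x y|k x]; rewrite ?rmorphD ?galoisZ. Qed.

Lemma gal_map_pure (P : lmodType A) (x : P) l : gal_map sigma (mpure x l) = mpure x (sigma l).
Proof. exact: (emap_pure (Kadd_gal P) x l). Qed.

Lemma gal_mapD (P : lmodType A) (x y : mod_ext KG P) :
  gal_map sigma (x + y) = gal_map sigma x + gal_map sigma y.
Proof. exact: (emapD (Kadd_gal P) x y). Qed.

Lemma gal_map_sum (P : lmodType A) (I : Type) (s : seq I) (F : I -> mod_ext KG P) :
  gal_map sigma (\sum_(i <- s) F i) = \sum_(i <- s) gal_map sigma (F i).
Proof. exact: (emap_sum (Kadd_gal P) s xpredT F). Qed.

Lemma gal_mapZ (P : lmodType A) (F : AG) (x : mod_ext KG P) :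
  gal_map sigma (F *: x) = (gal_map sigma F : AG) *: gal_map sigma x.
Proof.
exact: (@emapZ K KG A A P P (fun x => x) sigma (fun a => a) (Kadd_gal P) (Kadd_gal A^o)
  (rmorphM sigma) (fun a x => erefl) F x).
Qed.

Lemma ext_coef_gal i (F : AG) : ext_coef i (gal_map sigma F : AG) = sigma (ext_coef i F).
Proof.
elim/tens_ind: F => [|F G hF hG|f l].
- by rewrite [gal_map _ _](emap0 (Kadd_gal A^o)) ext_coef0 rmorph0.
- by rewrite gal_mapD !ext_coefD rmorphD; congr (_ + _).
rewrite -[tpure _ _ f l]/(mpure (f : A^o) l) gal_map_pure -!/(apure _ _).
by rewrite !ext_coef_pure galoisZ.
Qed.

End GaloisDescent.

Section ModuleDescent.
Variables (p : nat) (R : realType) (K : fieldType) (v : complete_abs R K).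
Variables (Kbar : closedFieldType) (iota : {rmorphism K -> Kbar}) (n : nat).
Hypotheses (p_prime : prime p) (K0 : [pchar K] =i pred0).
Local Notation KG := (KGamma p iota).
Variable C : laurent_class v n.
Local Notation A := (laurent_ring C).
Local Notation AG := (alg_ext KG A).
Variables (P : lmodType A) (m : nat) (e : 'I_m -> P) (he : is_basis e).

Lemma mpure_inj (x y : P) : mpure x 1 = mpure y 1 :> mod_ext KG P -> x = y.
Proof.
move=> E; apply: (bcoord_inj (he := he)) => i; apply: (@apure_inj1 p _ _ _ _ iota).
by rewrite -!(ecoord_pure he) E.
Qed.

Lemma mpure_comb (c : 'I_m -> A) :
  mpure (\sum_i c i *: e i) 1 = \sum_i (apure (c i) 1 : AG) *: mpure (e i) 1.
Proof.
under [RHS]eq_bigr do rewrite apureZ mulr1.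
by elim/big_rec2: _ => [|i x y _ <-]; [apply: tpure0l|apply: tpureDl].
Qed.

Lemma ecoord_gal (sigma : {rmorphism KG -> KG}) (X : mod_ext KG P) i : is_galois sigma ->
  ecoord he (gal_map sigma X) i = gal_map sigma (ecoord he X i).
Proof.
move=> hs; rewrite {1}(ecoordE he X) gal_map_sum //.
rewrite -[RHS](ecoord_comb he (fun i => gal_map sigma (ecoord he X i) : AG)).
congr (ecoord he _ _); apply: eq_bigr => j _; rewrite gal_mapZ //.
by rewrite gal_map_pure // rmorph1.
Qed.

(** The coordinates of a fixed element have their coefficients in [K], by [galois_fixed]. *)
Lemma module_descent (X : mod_ext KG P) :
  (forall sigma : {rmorphism KG -> KG}, is_galois sigma -> gal_map sigma X = X) ->
  exists x : P, X = mpure x 1.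
Proof.
move=> hX.
have co sigma : is_galois sigma -> forall i, gal_map sigma (ecoord he X i) = ecoord he X i.
  by move=> hs i; rewrite -ecoord_gal // hX.
have ex i : exists f : A, ecoord he X i = apure f 1.
  apply: descent => j; apply: (galois_fixed p_prime K0) => sigma hs.
  by rewrite -ext_coef_gal // co.
exists (\sum_i sval (cid (ex i)) *: e i).
rewrite mpure_comb {1}(ecoordE he X); apply: eq_bigr => i _; congr (_ *: _).
exact: (svalP (cid (ex i))).
Qed.

End ModuleDescent.

Section RootTuples.
Variables (p : nat) (K : fieldType) (Kbar : closedFieldType) (iota : {rmorphism K -> Kbar}).
Hypotheses (p_prime : prime p) (K0 : [pchar K] =i pred0).
Local Notation KG := (KGamma p iota).

Lemma KG_prim_root k : (0 < k)%N -> exists z : KG, (p ^ k).-primitive_root z.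
Proof.
move=> k0; have N0 : (0 < p ^ k)%N by rewrite expn_gt0 prime_gt0.
have [z hz] := prim_root_ex iota K0 N0.
have zK : z \in KGamma_pred p iota.
  apply/asboolP => S _ _ /(_ k z k0); apply; exact: prim_expr_order.
exists (Sub z zK); move: hz; rewrite /primitive_root_of_unity => /andP[-> /forallP h] /=.
apply/forallP => i; rewrite -(eqP (h i)); apply/eqP; rewrite !unity_rootE; apply/idP/idP.
  by move/eqP/(congr1 val); rewrite rmorphXn rmorph1 => /eqP.
by move/eqP => E; apply/eqP/val_inj; rewrite rmorphXn rmorph1.
Qed.

Lemma KG_natr_neq0 N : (0 < N)%N -> N%:R != 0 :> KG.
Proof.
move=> N0; apply: contraNneq (natr_neq0_ext iota K0 N0) => /(congr1 val).
by rewrite rmorph_nat rmorph0 => ->.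
Qed.

Lemma gtup_eq n (z z' : Gamma_tuple p iota n) : (forall j, z j = z' j) -> z = z'.
Proof.
case: z z' => z hz [z' hz'] /= /funext E; rewrite E in hz *.
by congr GammaTuple; apply: Prop_irrelevance.
Qed.

Variables (n k : nat) (zeta : KG).
Hypotheses (k_gt0 : (0 < k)%N) (zeta_prim : (p ^ k).-primitive_root zeta).
Local Notation N := (p ^ k)%N.
Local Notation cls := {ffun 'I_n -> 'I_N}.

Let N_gt0 : (0 < N)%N. Proof. exact: prim_order_gt0 zeta_prim. Qed.

Fact root_tuple_proof (a : cls) (j : 'I_n) : exists2 s, (0 < s)%N & (zeta ^+ a j) ^+ (p ^ s) = 1.
Proof. by exists k => //; rewrite exprAC (prim_expr_order zeta_prim) expr1n. Qed.

Definition root_tuple (a : cls) : Gamma_tuple p iota n := GammaTuple (root_tuple_proof a).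

Lemma root_tuple_level a : Gamma_level k (root_tuple a).
Proof. by move=> j /=; rewrite exprAC (prim_expr_order zeta_prim) expr1n. Qed.

(** The translations and the Galois automorphisms permute the tuples of level [k]. *)
Lemma root_tuple_reindex (V : zmodType) (F : Gamma_tuple p iota n -> V)
    (h : 'I_n -> KG -> KG) (g : Gamma_tuple p iota n -> Gamma_tuple p iota n) :
  (forall j, injective (h j)) -> (forall j x, x ^+ N = 1 -> h j x ^+ N = 1) ->
  (forall z j, g z j = h j (z j)) ->
  \sum_(a : cls) F (g (root_tuple a)) = \sum_(a : cls) F (root_tuple a).
Proof.
move=> hi hN gE.
have ex j (b : 'I_N) : exists b' : 'I_N, h j (zeta ^+ b) = zeta ^+ b'.
  have [|b' ->] := prim_rootP zeta_prim (x := h j (zeta ^+ b)); last by exists b'.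
  by apply: hN; rewrite exprAC (prim_expr_order zeta_prim) expr1n.
pose tau j b := sval (cid (ex j b)).
have tauP j (b : 'I_N) : h j (zeta ^+ b) = zeta ^+ tau j b by exact: svalP (cid (ex j b)).
have tau_inj j : injective (tau j).
  move=> b b' E; have /hi : h j (zeta ^+ b) = h j (zeta ^+ b') by rewrite !tauP E.
  move/eqP; rewrite (eq_prim_root_expr zeta_prim) !modn_small // => /eqP; exact: val_inj.
pose t (a : cls) : cls := [ffun j => tau j (a j)].
have t_inj : injective t.
  move=> a b /ffunP E; apply/ffunP => j; apply: (tau_inj j).
  by have := E j; rewrite !ffunE.
rewrite [RHS](reindex_inj t_inj); apply: eq_bigr => a _; congr F; apply: gtup_eq => j.
by rewrite gE /= ffunE tauP.
Qed.

Lemma sum_characters (y : 'I_n -> KG) : (forall j, y j ^+ N = 1) ->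
  \sum_(a : cls) \prod_j y j ^+ a j = if [forall j, y j == 1] then (N ^ n)%:R else 0.
Proof.
move=> yN; rewrite -(bigA_distr_bigA (fun j (b : 'I_N) => y j ^+ b)).
have one j : \sum_(b < N) y j ^+ b = if y j == 1 then N%:R else 0.
  case: eqP => [->|/eqP y1].
    by under eq_bigr do rewrite expr1n; rewrite sumr_const card_ord.
  have y1' : y j - 1 != 0 by rewrite subr_eq0.
  by apply: (mulfI y1'); rewrite -subrX1 yN subrr mulr0.
case: forallP => [h|/forallP].
  transitivity (\prod_(j < n) (N%:R : KG)); last by rewrite prodr_const card_ord (natrX _ N n).
  by apply: eq_bigr => j _; rewrite one h.
rewrite negb_forall => /existsP[j yj]; apply/eqP/prodf_eq0; exists j => //.
by rewrite one (negPf yj).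
Qed.

Lemma root_tuple_orthogonal (i : multi_index n) :
  \sum_(a : cls) monomial (root_tuple a) i =
    if [forall j, (N%:Z %| i j)%Z] then (N ^ n)%:R else 0.
Proof.
have z0 : zeta != 0.
  apply: contra_eq_neq (prim_expr_order zeta_prim) => ->.
  by rewrite expr0n gtn_eqF // eq_sym oner_neq0.
have yE (j : 'I_n) (b : 'I_N) : (zeta ^+ b) ^ i j = (zeta ^ i j) ^+ b.
  by rewrite !exprnP !exprz_exp mulrC.
have yN (j : 'I_n) : (zeta ^ i j) ^+ N = 1.
  by rewrite exprnP exprz_exp mulrC -exprz_exp -exprnP (prim_expr_order zeta_prim) exp1rz.
under eq_bigr => a _.
  by rewrite /monomial; under eq_bigr do rewrite /= yE; over.
rewrite (sum_characters yN); congr (if _ then _ else _).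
apply: eq_forallb => j; case: (i j) => t.
  by rewrite -exprnP -(prim_order_dvd zeta_prim).
rewrite NegzE dvdzE abszN -[N%:Z]/(Posz N) /= -exprnN invr_eq1.
by rewrite -(prim_order_dvd zeta_prim).
Qed.

Lemma sum_class_characters (b : cls) :
  \sum_(a : cls) monomial (root_tuple b) (- [ffun j => (a j : nat)%:Z]) =
    if [forall j, root_tuple b j == 1] then (N ^ n)%:R else 0.
Proof.
have yN (j : 'I_n) : ((zeta ^+ b j)^-1) ^+ N = 1.
  by rewrite exprVn -exprM mulnC exprM (prim_expr_order zeta_prim) expr1n invr1.
under eq_bigr => a _.
  rewrite /monomial; under eq_bigr => j _.
    rewrite !ffunE /= -exprnN -exprVn; over.
  over.
rewrite (sum_characters yN); congr (if _ then _ else _).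
by apply: eq_forallb => j /=; rewrite invr_eq1.
Qed.

End RootTuples.

(** * Projectors onto eigenspaces and adapted bases *)

Section Projectors.
Variables (p : nat) (R : realType) (K : fieldType) (v : complete_abs R K).
Variables (Kbar : closedFieldType) (iota : {rmorphism K -> Kbar}).
Variables (w : nonarch_abs R Kbar) (n : nat).
Variables (rho : 'I_n -> R) (rho0 : forall k, 0 < rho k).
Hypotheses (p_prime : prime p) (K0 : [pchar K] =i pred0) (v_p : v p%:R = p%:R^-1).
Hypothesis w_ext : forall a, w (iota a) = v a.
Local Notation KG := (KGamma p iota).
Local Notation A := (Rrho v rho0).
Local Notation AG := (alg_ext KG A).
Local Notation gtuple := (Gamma_tuple p iota n).
Local Notation obj := (Crho_obj p v iota w rho0).
Local Notation ext := (mod_ext KG).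
Local Notation cst k := (apure (1 : A) k : AG).

Let p_gt0 : (0 < p)%N. Proof. exact: prime_gt0. Qed.

Lemma cstM k l : cst (k * l) = cst k * cst l.
Proof. by rewrite apureM mulr1. Qed.

Lemma cstD k l : cst (k + l) = cst k + cst l.
Proof. exact: (tpureDr _ _ (1 : A^o)). Qed.

Lemma cst0 : cst 0 = 0.
Proof. exact: (tpure0r _ _ (1 : A^o)). Qed.

Lemma cst_sum (I : finType) (F : I -> KG) : cst (\sum_i F i) = \sum_i cst (F i).
Proof. by elim/big_rec2: _ => [|i x y _ <-]; rewrite ?cst0 ?cstD. Qed.

Lemma cst_gal (sigma : {rmorphism KG -> KG}) k : is_galois sigma ->
  gal_map sigma (cst k) = cst (sigma k) :> AG.
Proof. by move=> hs; apply: (gal_map_pure hs (1 : A^o) k). Qed.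

Lemma ext_coef_cst l (F : AG) i : ext_coef i (cst l * F) = l * ext_coef i F.
Proof.
elim/tens_ind: F => [|F F' hF hF'|f m].
- by rewrite [_ * 0]mulr0 ext_coef0 mulr0.
- by rewrite [_ * (_ + _)]mulrDr !ext_coefD hF hF' mulrDr.
by rewrite -[tpure _ _ f m]/(apure f m) apureM mul1r !ext_coef_pure scalerAr.
Qed.

Section OneObject.
Variable P : obj.
Implicit Types (X Y : ext P) (z : gtuple).

Lemma CactZ z F X : Cact z (F *: X) = gsubst z F *: Cact z X.
Proof. by case: (Csemilinear P) => _ _ _; apply. Qed.

Lemma CactM z z' X : Cact (gtupM z z') X = Cact z (Cact z' X).
Proof. by case: (Csemilinear P) => _ h _ _; apply: h. Qed.

Lemma Cact1 X : Cact (gtup1 p iota n) X = X.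
Proof. by case: (Csemilinear P) => h _ _ _; apply: h. Qed.

Lemma Cact_sum (I : Type) (s : seq I) (F : I -> ext P) z :
  Cact z (\sum_(i <- s) F i) = \sum_(i <- s) Cact z (F i).
Proof. by elim/big_rec2: _ => [|i x y _ <-]; rewrite ?Cact0 ?CactD. Qed.

Lemma Cact_cst z k X : Cact z (cst k *: X) = cst k *: Cact z X.
Proof. by rewrite CactZ gsubst_const. Qed.

Section Level.
Variables (k : nat) (zeta : KG).
Hypotheses (k_gt0 : (0 < k)%N) (zeta_prim : (p ^ k).-primitive_root zeta).
Local Notation N := (p ^ k)%N.
Local Notation cls := {ffun 'I_n -> 'I_N}.
Local Notation rt := (@root_tuple p K Kbar iota n k zeta k_gt0 zeta_prim).

(** The component of [X] on which the level [k] roots of unity act through the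
    character of the multi-index [i]. *)
Definition proj (i : multi_index n) X : ext P :=
  cst (N ^ n)%:R^-1 *: \sum_(a : cls) cst (monomial (rt a) (- i)) *: Cact (rt a) X.

Let N_gt0 : (0 < N)%N. Proof. exact: prim_order_gt0 zeta_prim. Qed.

Let Nn0 : (N ^ n)%:R != 0 :> KG.
Proof. by apply: (KG_natr_neq0 p iota K0); rewrite expn_gt0 N_gt0. Qed.

Lemma proj_sum X : \sum_(i : cls) proj [ffun j => (i j : nat)%:Z] X = X.
Proof.
rewrite -scaler_sumr exchange_big /=.
under eq_bigr do rewrite -scaler_suml -cst_sum sum_class_characters.
pose a0 : cls := [ffun j => Ordinal N_gt0].
have rt0 : rt a0 = gtup1 p iota n by apply: gtup_eq => j /=; rewrite ffunE expr0.
rewrite (bigD1 a0) //= [X in _ *: (_ + X)]big1 ?addr0; last first.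
  move=> a aa0; case: forallP => [h|_]; last by rewrite cst0 scale0r.
  case/eqP: aa0; apply/ffunP => j; apply: val_inj; rewrite ffunE /=.
  have := h j; rewrite /= -(prim_order_dvd zeta_prim) => /dvdnP[[|q] aE] //.
  by have := ltn_ord (a j); rewrite aE mulSn -ltn_subRL subnn.
rewrite ifT; last by apply/forallP => j; rewrite /= ffunE expr0.
by rewrite scalerA -cstM mulVf // scale1r rt0 Cact1.
Qed.

Lemma monomialN z i : monomial z (- i) = (monomial z i)^-1.
Proof.
by rewrite /monomial -prodfV; apply: eq_bigr => j _; rewrite ffunE invr_expz.
Qed.

Lemma monomial_neq0 z i : monomial z i != 0.
Proof. by rewrite -(nabs_eq0 (wKG p iota w)) wKG_monomial // oner_neq0. Qed.

Lemma proj_eigen i X z : Gamma_level k z ->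
  Cact z (proj i X) = cst (monomial z i) *: proj i X.
Proof.
move=> hz; rewrite /proj Cact_cst Cact_sum.
have -> : \sum_(a : cls) cst (monomial (rt a) (- i)) *: Cact (rt a) X =
    \sum_(a : cls) cst (monomial (gtupM z (rt a)) (- i)) *: Cact (gtupM z (rt a)) X.
  apply/esym; apply: (root_tuple_reindex k_gt0 zeta_prim
    (fun z => cst (monomial z (- i)) *: Cact z X) (h := fun j x => z j * x) (g := gtupM z)) => //.
    by move=> j; apply: mulfI; apply: (gtup_neq0 w p_gt0).
  by move=> j x xN; rewrite exprMn hz xN mulr1.
rewrite [RHS]scalerA [cst (monomial z i) * _]mulrC -scalerA; congr (_ *: _); rewrite scaler_sumr.
apply: eq_bigr => a _; rewrite Cact_cst CactM scalerA -cstM; congr (cst _ *: _).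
by rewrite monomial_gtupM [monomial z (- i)]monomialN mulrA mulfV ?mul1r // monomial_neq0.
Qed.

Lemma proj_gal sigma i X : is_galois sigma ->
  gal_map sigma X = X -> gal_map sigma (proj i X) = proj i X.
Proof.
move=> hs hX; rewrite /proj gal_mapZ // cst_gal // gal_map_sum //.
have -> : sigma (N ^ n)%:R^-1 = (N ^ n)%:R^-1 by rewrite fmorphV rmorph_nat.
congr (_ *: _).
rewrite -[RHS](root_tuple_reindex k_gt0 zeta_prim
  (fun z => cst (monomial z (- i)) *: Cact z X) (h := fun j x => sigma x) (g := gtup_gal sigma)) //.
- apply: eq_bigr => a _; rewrite gal_mapZ // cst_gal // Cgalois // hX; congr (cst _ *: _).
  by rewrite /monomial rmorph_prod; apply: eq_bigr => j _; rewrite fmorphXz.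
- by move=> j; apply: fmorph_inj.
- by move=> j x xN; rewrite -rmorphXn xN rmorph1.
Qed.

(** The projector commutes with the Galois group: each [sigma] permutes the roots of
    unity in the defining sum, by the compatibility of the action with [sigma]. *)
Lemma proj_descent i (x : P) : exists y : P, mpure y 1 = proj i (mpure x 1).
Proof.
have [m [e he]] := Cfree P.
have [sigma hs|y ->] := module_descent p_prime K0 he (X := proj i (mpure x 1)); last by exists y.
by apply: proj_gal => //; rewrite gal_map_pure // rmorph1.
Qed.

End Level.
End OneObject.

Lemma Kadd_linear (B : comAlgType K) (P Q : lmodType B) (f : P -> Q) :
  linear f -> Kadditive f (fun l : KG => l).
Proof. by move=> fl; split=> // [x y|k x]; rewrite ?(lin_add fl) ?(lin_scale fl). Qed.

Lemma ext_mapZ (B : comAlgType K) (P Q : lmodType B) (f : P -> Q) (F : alg_ext KG B) (X : ext P) :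
  linear f -> ext_map f (F *: X) = F *: ext_map f X.
Proof.
move=> fl.
rewrite -[RHS]/(F *: emap f (fun l : KG => l) X) -[X in _ = X *: _]emap_id.
exact: (@emapZ K KG B B P Q f (fun l => l) (fun a => a) (Kadd_linear fl) (Kadd_id KG B^o)
  (fun x y => erefl) (lin_scale fl) F X).
Qed.

Lemma ext_map_sum (B : comAlgType K) (P Q : lmodType B) (f : P -> Q) (I : Type) (s : seq I)
  (F : I -> ext P) : linear f ->
  ext_map f (\sum_(i <- s) F i) = \sum_(i <- s) ext_map f (F i).
Proof. by move=> fl; apply: (emap_sum (Kadd_linear fl) s xpredT F). Qed.

(** This is why kernels and images are stable under the projectors. *)
Lemma proj_hom (P Q : obj) (f : Crho_hom P Q) k zeta (k0 : (0 < k)%N)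
    (zp : (p ^ k).-primitive_root zeta) i X :
  ext_map f (proj k0 zp i X) = proj k0 zp i (ext_map f X).
Proof.
have fl := Clinear f.
rewrite /proj ext_mapZ // ext_map_sum //; congr (_ *: _); apply: eq_bigr => a _.
by rewrite ext_mapZ // Cequiv.
Qed.

Fact gtupV_proof (z : gtuple) j : exists2 s, (0 < s)%N & (z j)^-1 ^+ (p ^ s) = 1.
Proof. by have [s s0 hs] := gtupP z j; exists s => //; rewrite exprVn hs invr1. Qed.

Definition gtupV (z : gtuple) : gtuple := GammaTuple (gtupV_proof z).

Lemma gtupMV z : gtupM z (gtupV z) = gtup1 p iota n.
Proof. by apply: gtup_eq => j /=; rewrite mulfV // (gtup_neq0 w p_gt0). Qed.

Section Matrices.
Variables (P : obj) (m : nat) (e : 'I_m -> P) (he : is_basis e).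

Definition act_mx (z : gtuple) : 'M[AG]_m :=
  \matrix_(i, j) ecoord he (Cact z (mpure (e j) 1)) i.

Lemma ecoord_act z X i :
  ecoord he (Cact z X) i = \sum_j act_mx z i j * gsubst z (ecoord he X j).
Proof.
rewrite {1}(ecoordE he X) Cact_sum ecoord_sum; apply: eq_bigr => j _.
by rewrite CactZ ecoordZ mulrC mxE.
Qed.

Lemma act_mxM z z' : act_mx (gtupM z z') = act_mx z *m map_mx (gsubst z) (act_mx z').
Proof.
apply/matrixP => i j; rewrite !mxE CactM ecoord_act; apply: eq_bigr => l _.
by rewrite !mxE.
Qed.

Lemma act_mx1 : act_mx (gtup1 p iota n) = 1%:M.
Proof. by apply/matrixP => i j; rewrite !mxE Cact1 ecoord_base. Qed.

Definition coord_mx (x : 'I_m -> P) : 'M[A]_m := \matrix_(i, j) bcoord he (x j) i.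

Local Notation detP x := (\det (coord_mx x)).

(** In the relation [E(z) z^*(X) = X D] between the matrices of the eigenvectors, [E(z)]
    is invertible: the determinant of [X] generates an ideal stable under [z^*]. *)
Lemma eigen_det (x : 'I_m -> P) (I : 'I_m -> multi_index n) z :
  (forall j, Cact z (mpure (x j) 1) = cst (monomial z (I j)) *: mpure (x j) 1) ->
  exists G, gsubst z (apure (detP x) 1) = G * apure (detP x) 1 :> AG.
Proof.
move=> hx; pose gs := gsubst_rmorphism w_ext p_gt0 (Rrho_class v rho0).
pose X : 'M[AG]_m := map_mx (apure1 p iota (Rrho_class v rho0)) (coord_mx x).
have XiE i j : X i j = ecoord he (mpure (x j) 1) i.
  by rewrite !mxE; apply/esym/(ecoord_pure he).
have XE : act_mx z *m map_mx (gsubst z) X =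
    X *m diag_mx (\row_j cst (monomial z (I j))).
  apply/matrixP => i j; rewrite mul_mx_diag [LHS]mxE [RHS]mxE XiE mxE mulrC.
  rewrite -ecoordZ -hx ecoord_act; apply: eq_bigr => l _.
  by rewrite [map_mx _ _ _ _]mxE XiE.
have EV : \det (act_mx z) * gsubst z (\det (act_mx (gtupV z))) = 1.
  by rewrite -[gsubst z _](det_map_mx (gs z)) -det_mulmx -act_mxM gtupMV act_mx1 det1.
have detX : \det X = apure (detP x) 1 by rewrite det_map_mx.
set u := gsubst z (\det (act_mx (gtupV z))) in EV.
have gsX : \det (map_mx (gsubst z) X) = gsubst z (apure (detP x) 1).
  by rewrite (det_map_mx (gs z)) detX.
have := congr1 (fun M => u * \det M) XE; rewrite !det_mulmx gsX detX.
rewrite mulrA [u * _]mulrC EV mul1r mulrCA mulrC => E.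
by exists (u * \det (diag_mx (\row_j cst (monomial z (I j))))).
Qed.

Lemma det_sum_columns (T : finType) (B : 'I_m -> T -> 'I_m -> A) :
  \det (\matrix_(i, j) \sum_t B j t i) =
    \sum_(I : {ffun 'I_m -> T}) \det (\matrix_(i, j) B j (I j) i).
Proof.
rewrite -det_tr; under [RHS]eq_bigr do rewrite -det_tr.
rewrite /determinant exchange_big /=; apply: eq_bigr => s _.
rewrite -mulr_sumr; congr (_ * _).
transitivity (\prod_j \sum_t B j t (s j)).
  by apply: eq_bigr => j _; rewrite !mxE.
rewrite bigA_distr_bigA; apply: eq_bigr => I _.
by apply: eq_bigr => j _; rewrite !mxE.
Qed.

Lemma bddN (J : polysegment R n) c (F : AG) : bdd w J c F -> bdd w J c (- F).
Proof. by move=> hF r hr i; rewrite -sub0r ext_coefB ext_coef0 sub0r nabsN; apply: hF. Qed.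

Lemma det_bdd (J : polysegment R n) c (M : 'M[AG]_m) : 0 <= c ->
  (forall i j, bdd w J c (M i j)) -> bdd w J (c ^+ m) (\det M).
Proof.
move=> c0 hM; apply: bdd_sum; first exact: exprn_ge0.
move=> s _; rewrite mulr_sign; have pr : bdd w J (c ^+ m) (\prod_i M i (s i)).
  have := bdd_prod w_ext (index_enum 'I_m) c0 (fun i => hM i (s i)).
  by rewrite -sum1_size sum1_card card_ord.
by case: ifP => // _; apply: bddN.
Qed.

Lemma common_polysegment (J0 : polysegment R n) (s : seq A) : in_interior J0 rho ->
  exists (J : polysegment R n) B, [/\ in_interior J rho,
    forall r, in_polysegment J r -> in_polysegment J0 r, 0 <= B &
    forall f, f \in s -> vbdd v J B f].
Proof.
move=> h0; elim: s => [|f s [J [B [hJ sub B0 hB]]]]; first by exists J0, 0; split.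
have [J1 h1 c1] := lcoefP f; have [J2 [h2 s2 s2']] := interior_meet hJ h1.
have [|c c0 hc] := @converges_on_bounded _ _ v _ J2 f; first by move=> r /s2'; apply: c1.
exists J2, (B + c); split=> // [r /s2/sub //||g]; first exact: addr_ge0.
rewrite inE => /predU1P[->|gs] r hr i; first by rewrite (le_trans (hc r hr i)) // lerDr.
by rewrite (le_trans (hB g gs r (s2 r hr) i)) // lerDl.
Qed.

Lemma wKG_pow k : wKG p iota w ((p ^ k) ^ n)%:R^-1 = p%:R ^+ n ^+ k.
Proof.
have -> : ((p ^ k) ^ n)%:R = p%:R ^+ k ^+ n :> KG by rewrite !natrX.
rewrite wKG_V !wKG_X; have -> : p%:R = (p%:R : K)%:A :> KG by rewrite scaler_nat.
by rewrite (wKG_alg _ w_ext) v_p -!exprM mulnC exprVn invrK.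
Qed.

Section Growth.
Variables (J : polysegment R n) (q : R).
Hypotheses (hJ : in_interior J rho) (q0 : 0 <= q).
Hypothesis hE : forall k z i j, (0 < k)%N -> Gamma_level k z -> bdd w J (q ^+ k) (act_mx z i j).

(** The denominator [p ^ (k * n)] of the projector only costs another factor exponential
    in [k]. *)
Lemma proj_bdd (J' : polysegment R n) B k zeta (k0 : (0 < k)%N)
    (zp : (p ^ k).-primitive_root zeta) i (x y : P) :
  (forall r, in_polysegment J' r -> in_polysegment J r) -> 0 <= B ->
  (forall l, bdd w J' B (apure (bcoord he x l) 1 : AG)) ->
  mpure y 1 = proj k0 zp i (mpure x 1) ->
  forall l, bdd w J' (B * (p%:R ^+ n * q) ^+ k) (apure (bcoord he y l) 1 : AG).
Proof.
move=> sub B0 hx yE l; rewrite -(ecoord_pure he) yE ecoordZ ecoord_sum.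
have qk0 : 0 <= q ^+ k by apply: exprn_ge0.
have -> : B * (p%:R ^+ n * q) ^+ k = p%:R ^+ n ^+ k * (1 * (q ^+ k * B)).
  by rewrite exprMn mul1r mulrA mulrC.
have qB0 : 0 <= q ^+ k * B by apply: mulr_ge0.
apply: (bddM w_ext); rewrite ?mul1r ?exprn_ge0 //.
  by rewrite -wKG_pow; apply: bdd_const.
apply: bdd_sum => // a _.
rewrite ecoordZ -[q ^+ k * B]mul1r; apply: (bddM w_ext) => //.
  by rewrite -[1](wKG_monomial w p_gt0 (root_tuple k0 zp a) (- i)); apply: bdd_const.
rewrite ecoord_act; apply: bdd_sum => // j _.
apply: (bddM w_ext) => //.
  by apply: (bdd_sub sub); apply: hE => //; apply: root_tuple_level.
by apply: bdd_gsubst => //; rewrite ecoord_pure.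
Qed.

Lemma msize_off (i s : multi_index n) (N : nat) :
  (forall j, (N%:Z %| (i - s)%R j)%Z) -> i != s -> (N - msize s <= msize i)%N.
Proof.
move=> dv nis; have [j ij] : exists j, i j != s j.
  apply/existsP; rewrite -negb_forall; apply: contra nis => /forallP h.
  by apply/eqP/ffunP => j; apply/eqP.
have := dv j; rewrite !ffunE => /dvdzP[t tE].
have t0 : t != 0.
  by apply: contra ij => /eqP t0; move: tE; rewrite t0 mul0r => /eqP; rewrite subr_eq0.
have hi : (`|i j|%N <= msize i)%N by rewrite /msize (bigD1 j) //= leq_addr.
have hs : (`|s j|%N <= msize s)%N by rewrite /msize (bigD1 j) //= leq_addr.
have : (N <= `|(t * N%:Z)%R|)%N by rewrite abszM absz_nat leq_pmull // absz_gt0.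
have tri (a b : int) (c d M : nat) : (`|a| <= c)%N -> (`|b| <= d)%N ->
    (M <= `|(a - b)%R|)%N -> (M - d <= c)%N by lia.
by rewrite -tE; apply: tri.
Qed.

(** Expand the determinant of [x] along the decompositions of the vectors into their
    eigencomponents. The coefficient of [t ^ s] in the sum does not depend on [k], so some
    term [d] has at least as large a coefficient there, for every [k]. The part [h] of [d]
    with exponents congruent to [s] modulo [p ^ k] is an average of transforms [z^*(d)],
    hence a multiple of [d] by [eigen_det]. Its other exponents are at distance at least
    [p ^ k] from [s]; near [rho] this gains [eta ^ (p ^ k)], which beats the exponential
    growth in [k] of the bounds on [d]. For large [k] the term at [s] thus dominates in
    [h], which makes [h], and then [d], a unit. *)
Lemma eigen_basis (x : 'I_m -> P) : detP x != 0 ->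
  exists k zeta (k0 : (0 < k)%N) (zp : (p ^ k).-primitive_root zeta)
    (I : 'I_m -> multi_index n) (y : 'I_m -> P),
  (forall j, mpure (y j) 1 = proj k0 zp (I j) (mpure (x j) 1)) /\
  exists g, detP y * g = 1.
Proof.
move=> Dn; set D := detP x in Dn.
have [s Ds] : exists s, D s != 0.
  apply: contrapT => h; case/eqP: Dn; apply: lring_inj => i; rewrite lcoef0.
  by apply/eqP; apply: contraT => Di; case: h; exists i.
have c_gt0 : 0 < v (D s) by rewrite lt_def nabs_ge0 nabs_eq0 Ds.
have [J1 [B [h1 s1 B0 hB]]] := common_polysegment
  [seq bcoord he (x u.1) u.2 | u <- enum [set: 'I_m * 'I_m]] hJ.
have {}hB j l : bdd w J1 B (apure (bcoord he (x j) l) 1 : AG).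
  apply/bdd_pure => //; apply: hB; apply/mapP; exists (j, l) => //.
  by rewrite mem_enum inE.
have [J2 [eta [h2 s2 /andP[e0 e1] dec]]] := shrink h1.
have [J3 [c' [h3 s3 hc']]] := monomial_bounded (- s) h2.
have c'0 : 0 < c'.
  apply: lt_le_trans (hc' rho (interior_in h3)); exact: monomial_gt0.
pose Q := (p%:R ^+ n * q) ^+ m.
have Q0 : 0 <= Q by rewrite exprn_ge0 // mulr_ge0 // exprn_ge0.
have [|k k0 [tk small]] := growth_vs_decay (msize s) (prime_gt1 p_prime)
  (exprn_ge0 m B0) Q0 e0 e1 (c := v (D s) / (2 * c')).
  by rewrite divr_gt0 // mulr_gt0.
have [zeta zp] := KG_prim_root iota p_prime K0 k0.
pose N := (p ^ k)%N; pose cls := {ffun 'I_n -> 'I_N}.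
pose ix (t : cls) : multi_index n := [ffun j => (t j : nat)%:Z].
pose pi (t : cls) (j : 'I_m) : P := sval (cid (proj_descent k0 zp (ix t) (x j))).
have piE t j : mpure (pi t j) 1 = proj k0 zp (ix t) (mpure (x j) 1).
  exact: svalP (cid (proj_descent k0 zp (ix t) (x j))).
have pi_sum j : \sum_t pi t j = x j.
  apply: (mpure_inj (p := p) (iota := iota) he); rewrite -[RHS](proj_sum k0 zp).
  rewrite -(eq_bigr _ (fun t _ => piE t j)).
  by elim/big_rec2: _ => [|t y z _ <-]; [apply: tpure0l|apply: tpureDl].
have DE : D = \sum_(I : {ffun 'I_m -> cls}) detP (fun j => pi (I j) j).
  have := det_sum_columns (fun j t i => bcoord he (pi t j) i).
  rewrite /D /coord_mx => <-; congr (\det _); apply/matrixP => i j; rewrite !mxE.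
  by rewrite -bcoord_sum pi_sum.
have [I hI] : exists I : {ffun 'I_m -> cls}, v (D s) <= v (detP (fun j => pi (I j) j) s).
  apply: contrapT => h; suff : v (D s) < v (D s) by rewrite ltxx.
  rewrite {1}DE lcoef_sum; elim/big_ind: _ => [|a b ha hb|I _]; first by rewrite nabs0.
    exact: nabsD_lt.
  by rewrite ltNge; apply/negP => hI; apply: h; exists I.
exists k, zeta, k0, zp, (fun j => ix (I j)), (fun j => pi (I j) j); split=> //.
set y := fun j => pi (I j) j in hI *; set d := detP y in hI *.
have dbd : bdd w J1 (B ^+ m * Q ^+ k) (apure d 1 : AG).
  have -> : B ^+ m * Q ^+ k = (B * (p%:R ^+ n * q) ^+ k) ^+ m.
    by rewrite exprMn /Q -!exprM mulnC.
  have -> : apure d 1 = \det (map_mx (apure1 p iota (Rrho_class v rho0)) (coord_mx y)) :> AG.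
    by rewrite det_map_mx.
  apply: det_bdd => [|i j]; first by rewrite mulr_ge0 ?exprn_ge0 // mulr_ge0 // exprn_ge0.
  rewrite mxE mxE; exact: (proj_bdd s1 B0 (hB j) (piE (I j) j)).
have eig z : Gamma_level k z ->
    exists G, gsubst z (apure d 1) = G * apure d 1 :> AG.
  by move=> hz; apply: (eigen_det (I := fun j => ix (I j))) => j; rewrite piE proj_eigen.
pose mk (i : multi_index n) := [forall j, (N%:Z %| (i - s)%R j)%Z].
pose h : A := lmask mk d.
have [G hG] : exists G, apure h 1 = G * apure d 1 :> AG.
  pose G a := sval (cid (eig (root_tuple k0 zp a) (root_tuple_level k0 zp a))).
  have GE a : gsubst (root_tuple k0 zp a) (apure d 1) = G a * apure d 1 :> AG.
    exact: svalP (cid (eig _ (root_tuple_level k0 zp a))).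
  exists (cst (N ^ n)%:R^-1 * \sum_a cst (monomial (root_tuple k0 zp a) (- s)) * G a).
  rewrite -mulrA mulr_suml; apply: ext_coef_inj => i; rewrite ext_coef_cst ext_coef_sum.
  under eq_bigr => a _.
    rewrite -mulrA -GE ext_coef_cst gsubstE // ext_coef_pure mulrA.
    rewrite -(monomialD _ _ (gtup_neq0 w p_gt0 (root_tuple k0 zp a))) addrC.
    over.
  rewrite -mulr_suml root_tuple_orthogonal ext_coef_pure /h /= -/(mk i).
  case: (mk i); last by rewrite mul0r mulr0 scale0r.
  rewrite mulrA mulVf ?mul1r //; apply: (KG_natr_neq0 p iota K0).
  by rewrite expn_gt0 expn_gt0 p_gt0.
have hs : h s = d s.
  by rewrite /h /= ifT //; apply/forallP => j; rewrite subrr ffunE dvdz0.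
have ds0 : 0 < v (d s) by apply: lt_le_trans hI.
have [|||g hg] := @dominant_unit _ _ v n rho rho0 J3 2^-1 h s h3.
- by rewrite invr_ge0 ler0n /= invf_lt1 // ltr1n.
- by rewrite hs -(nabs_eq0 v) gt_eqF.
- move=> r i hr nis; have r0 l : 0 < r l by apply: in_polysegment_gt0 hr.
  have ms : 0 < monomial r s by apply: monomial_gt0.
  rewrite [h i]/= -/(mk i); case: ifP => [/forallP mki|_]; last first.
    by rewrite nabs0 mul0r !mulr_ge0 ?nabs_ge0 ?invr_ge0 // ltW.
  have le1 : v (d i) * monomial r i <= B ^+ m * Q ^+ k * eta ^+ (p ^ k - msize s).
    apply: (le_trans (ler_wpM2l (nabs_ge0 v _) (dec r i (s3 r hr)))).
    rewrite mulrCA mulrC; apply: ler_pM; rewrite ?exprn_ge0 ?mulr_ge0 ?nabs_ge0 //.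
    - by apply/ltW/monomial_gt0 => l; apply: in_polysegment_gt0 (vertex_in J1 _).
    - by move/(bdd_pure p w_ext): dbd; apply; apply: vertex_in.
    by apply: ler_wiXn2l => //; [apply: ltW|apply: msize_off].
  apply: (le_trans le1); apply: (le_trans (ltW small)).
  have : monomial r s * monomial r (- s) = 1.
    rewrite -monomialD; last by move=> l; rewrite gt_eqF.
    by rewrite subrr /monomial big1 // => l _; rewrite ffunE expr0z.
  have := hc' r hr; set b := monomial r (- s) => bc ab.
  have ab1 : 1 <= monomial r s * c' by rewrite -ab ler_wpM2l // ltW.
  rewrite invfM mulrCA; apply: ler_wpM2l; first by rewrite invr_ge0.
  apply: (@le_trans _ _ (v (D s) * monomial r s)).
    by apply: ler_wpM2l; rewrite ?nabs_ge0 // -[c'^-1]mul1r ler_pdivrMr.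
  by rewrite hs; apply: ler_wpM2r => //; apply: ltW.
apply: (@unit_descent p _ _ _ _ iota _ _ _ (G * apure g 1)).
rewrite mulrCA mulrA -hG -[apure g 1]/(apure1 p iota _ g) -[apure h 1]/(apure1 p iota _ h).
by rewrite -rmorphM hg rmorph1.
Qed.

Lemma unit_det_basis (y : 'I_m -> P) g : detP y * g = 1 -> is_basis y.
Proof.
move=> dg; have coordE (c : 'I_m -> A) i :
    bcoord he (\sum_j c j *: y j) i = (coord_mx y *m (\col_j c j)) i 0.
  by rewrite mxE bcoord_sum; apply: eq_bigr => j _; rewrite bcoordZ !mxE mulrC.
apply: is_basisP => [x|c E i].
  pose b : 'cV[A]_m := \col_i bcoord he x i.
  exists (fun j => (g *: (\adj (coord_mx y) *m b)) j 0).
  apply: (bcoord_inj (he := he)) => i; rewrite coordE.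
  have -> : (\col_j (g *: (\adj (coord_mx y) *m b)) j 0) = g *: (\adj (coord_mx y) *m b).
    by apply/colP => j; rewrite mxE.
  rewrite -scalemxAr mulmxA mul_mx_adj -scalemx1 -scalemxAl mul1mx scalerA mulrC dg scale1r.
  by rewrite mxE.
have E0 : coord_mx y *m (\col_j c j) = 0.
  by apply/colP => l; rewrite -coordE E bcoord0 mxE.
have := congr1 (fun M => g *: (\adj (coord_mx y) *m M)) E0.
rewrite mulmx0 scaler0 mulmxA mul_adj_mx -scalemx1 -scalemxAl mul1mx scalerA mulrC dg scale1r.
by move/colP/(_ i); rewrite !mxE.
Qed.

Lemma det_replace (y : 'I_m -> P) (c : 'I_m -> A) j :
  detP (fun i => if i == j then \sum_l c l *: y l else y i) = c j * detP y.
Proof.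
set y' := fun i => _; rewrite (expand_det_col _ j).
have cof i : cofactor (coord_mx y') i j = cofactor (coord_mx y) i j.
  rewrite /cofactor; congr (_ * \det _); apply/matrixP => a b; rewrite !mxE.
  by rewrite /y' eq_sym (negPf (neq_lift j b)).
under eq_bigr => i _.
  rewrite cof mxE {1}/y' eqxx bcoord_sum mulr_suml.
  under eq_bigr do rewrite bcoordZ -mulrA.
  over.
rewrite exchange_big /=.
transitivity (\sum_l c l * ((\adj (coord_mx y) *m coord_mx y) j l)).
  apply: eq_bigr => l _; rewrite -mulr_sumr mxE; congr (_ * _).
  by apply: eq_bigr => i _; rewrite !mxE mulrC.
rewrite mul_adj_mx (bigD1 j) //= mxE eqxx mulr1n big1 ?addr0 // => l lj.
by rewrite mxE eq_sym (negPf lj) mulr0n mulr0.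
Qed.

Definition proj_stable (S : P -> Prop) := forall k zeta (k0 : (0 < k)%N)
  (zp : (p ^ k).-primitive_root zeta) i x y,
  S x -> mpure y 1 = proj k0 zp i (mpure x 1) -> S y.

(** Among the families with nonzero determinant, take one with the most members in [S], and
    make it a basis [y] by passing to eigencomponents, which keeps the members in [S]. If
    an element of [S] had a nonzero coordinate along some other vector of [y], then it
    could replace that vector and give one more member in [S]. *)
Lemma adapted_basis (S : P -> Prop) : proj_stable S ->
  exists (x : 'I_m -> P) (hx : is_basis x) (T : {set 'I_m}),
    (forall j, j \in T -> S (x j)) /\
    (forall s, S s -> forall j, j \notin T -> bcoord hx s j = 0).
Proof.
move=> hS.
pose ok (T : {set 'I_m}) := `[< exists x, (forall j, j \in T -> S (x j)) /\ detP x != 0 >].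
have ok0 : ok finset.set0.
  apply/asboolP; exists e; split=> [j|]; first by rewrite inE.
  have -> : coord_mx e = 1%:M by apply/matrixP => i j; rewrite !mxE bcoord_base.
  by rewrite det1 oner_neq0.
case: (@arg_maxnP _ finset.set0 ok (fun T => #|T|) ok0) => T /asboolP[x [xS dx]] maxT.
have [k [zeta [k0 [zp [I [y [yE [g dg]]]]]]]] := eigen_basis dx.
have hy := unit_det_basis dg; exists y, hy, T; split=> [j jT|s sS j jT].
  by apply: hS (yE j); apply: xS.
apply/eqP; apply: contraT => cj.
pose y' i := if i == j then s else y i.
have dy' : detP y' = bcoord hy s j * detP y.
  rewrite -det_replace; congr (\det _); apply/matrixP => a b; rewrite !mxE /y'.
  by rewrite -bcoordE.
suff okT : ok (j |: T) by have := maxT _ okT; rewrite cardsU1 jT /= add1n ltnn.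
apply/asboolP; exists y'; split=> [i|].
  rewrite !inE /y'; case: eqP => [//|_] /= iT; apply: hS (yE i); exact: xS.
rewrite dy'; apply: contra cj => /eqP E.
by rewrite -[bcoord _ _ _]mulr1 -dg mulrA E mul0r.
Qed.

End Growth.
End Matrices.
End Projectors.

(** * The column module of a cocycle *)

Section SameCoefficients.
Variables (p : nat) (R : realType) (K : fieldType) (v : complete_abs R K).
Variables (Kbar : closedFieldType) (iota : {rmorphism K -> Kbar}).
Variables (w : nonarch_abs R Kbar) (n : nat).
Hypothesis w_ext : forall a, w (iota a) = v a.
Hypothesis p_gt0 : (0 < p)%N.
Local Notation KG := (KGamma p iota).
Variables C C' : laurent_class v n.
Local Notation AG := (alg_ext KG (laurent_ring C)).
Local Notation AG' := (alg_ext KG (laurent_ring C')).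

(** Equality as formal Laurent series of elements of two different series rings. *)
Definition same (F : AG) (F' : AG') := forall i, ext_coef i F = ext_coef i F'.

Lemma same0 : same 0 0.
Proof. by move=> i; rewrite !ext_coef0. Qed.

Lemma same1 : same 1 1.
Proof. by move=> i; rewrite -[1 in LHS]/(apure 1 1) -[1 in RHS]/(apure 1 1) !ext_coef_pure. Qed.

Lemma sameD F G F' G' : same F F' -> same G G' -> same (F + G) (F' + G').
Proof. by move=> h h' i; rewrite !ext_coefD h h'. Qed.

Lemma sameM F G F' G' : same F F' -> same G G' -> same (F * G) (F' * G').
Proof.
move=> h h' i; apply: (@wKG_small_eq _ _ _ _ _ w) => e e0.
have [T hT] := ext_coefM_approx w_ext F G i e0.
have [T' hT'] := ext_coefM_approx w_ext F' G' i e0.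
have := nabsB_lt (hT _ (fsubsetUl T T')) (hT' _ (fsubsetUr T T')).
under [X in _ - X - (_ - _)]eq_bigr do rewrite h h'.
by rewrite opprB addrA subrK.
Qed.

Lemma same_sum (I : Type) (s : seq I) (F : I -> AG) (F' : I -> AG') :
  (forall i, same (F i) (F' i)) -> same (\sum_(i <- s) F i) (\sum_(i <- s) F' i).
Proof.
by move=> h; elim/big_rec2: _ => [|i x y _]; [apply: same0|apply: sameD].
Qed.

Lemma same_gsubst z F F' : same F F' -> same (gsubst z F) (gsubst z F').
Proof. by move=> h i; rewrite !gsubstE // h. Qed.

End SameCoefficients.

Section ColumnModule.
Variables (p : nat) (R : realType) (K : fieldType) (v : complete_abs R K).
Variables (Kbar : closedFieldType) (iota : {rmorphism K -> Kbar}).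
Variables (w : nonarch_abs R Kbar) (n : nat).
Hypothesis w_ext : forall a, w (iota a) = v a.
Hypothesis p_gt0 : (0 < p)%N.
Local Notation KG := (KGamma p iota).
Variables (C : laurent_class v n) (m : nat).
Local Notation A := (laurent_ring C).
Local Notation AG := (alg_ext KG A).
Local Notation gtuple := (Gamma_tuple p iota n).
Local Notation P := ('cV[A]_m).

Definition col_base (j : 'I_m) : P := delta_mx j 0.

Lemma col_base_is_basis : is_basis col_base.
Proof.
have sumE (c : 'I_m -> A) : \sum_j c j *: col_base j = \col_j c j.
  apply/colP => i; rewrite summxE mxE (bigD1 i) //= !mxE !eqxx mulr1 big1 ?addr0 // => j ji.
  by rewrite !mxE eq_sym (negPf ji) mulr0.
apply: is_basisP => [x|c /eqP]; last by rewrite sumE => /eqP/colP h i; have := h i; rewrite !mxE.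
by exists (fun j => x j 0); rewrite sumE; apply/colP => i; rewrite mxE.
Qed.

Lemma col_coord (x : P) i : bcoord col_base_is_basis x i = x i 0.
Proof.
apply: (@bcoord_uniq _ _ _ _ col_base_is_basis x (fun i => x i 0)); apply/colP => j.
rewrite summxE (bigD1 j) //= !mxE !eqxx mulr1 big1 ?addr0 // => l lj.
by rewrite !mxE eq_sym (negPf lj) mulr0.
Qed.

Local Notation cb := col_base_is_basis.

Variable E : gtuple -> 'M[AG]_m.
Hypothesis E1 : E (gtup1 p iota n) = 1%:M.
Hypothesis EM : forall z z', E (gtupM z z') = E z *m map_mx (gsubst z) (E z').

Definition col_act (z : gtuple) (X : mod_ext KG P) : mod_ext KG P :=
  \sum_i (\sum_j E z i j * gsubst z (ecoord cb X j)) *: mpure (col_base i) 1.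

Lemma col_actE z X i :
  ecoord cb (col_act z X) i = \sum_j E z i j * gsubst z (ecoord cb X j).
Proof. exact: ecoord_comb. Qed.

Lemma col_act_base z j :
  col_act z (mpure (col_base j) 1) = \sum_i E z i j *: mpure (col_base i) 1.
Proof.
apply: eq_bigr => i _; congr (_ *: _); rewrite (bigD1 j) //= ecoord_base eqxx gsubst1 // mulr1.
by rewrite big1 ?addr0 // => l lj; rewrite ecoord_base (negPf lj) gsubst0 // mulr0.
Qed.

Lemma col_act_semilinear : semilinear_action col_act.
Proof.
split=> [X|z z' X|z X Y|z F X]; apply: (ecoord_inj (he := cb)) => i.
- rewrite col_actE E1 (bigD1 i) //= mxE eqxx mul1r big1 ?addr0 => [|j ji]; last first.
    by rewrite mxE eq_sym (negPf ji) mul0r.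
  exact: gsubst_gtup1.
- rewrite !col_actE EM.
  under [RHS]eq_bigr => j _ do rewrite col_actE gsubst_sum // mulr_sumr.
  rewrite exchange_big; apply: eq_bigr => j _ /=; rewrite mxE mulr_suml.
  apply: eq_bigr => l _; rewrite mxE -mulrA (gsubstM w_ext p_gt0) //; congr (_ * (_ * _)).
  exact: gsubst_gtupM.
- by rewrite ecoordD !col_actE -big_split; apply: eq_bigr => j _; rewrite ecoordD gsubstD // mulrDr.
rewrite ecoordZ !col_actE mulr_sumr; apply: eq_bigr => j _.
by rewrite ecoordZ (gsubstM w_ext p_gt0) // mulrCA.
Qed.

Hypothesis EG : forall sigma : {rmorphism KG -> KG}, is_galois sigma -> forall z i j,
  gal_map sigma (E z i j) = E (gtup_gal sigma z) i j :> AG.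

Lemma gal_gsubst (sigma : {rmorphism KG -> KG}) z (F : AG) : is_galois sigma ->
  gal_map sigma (gsubst z F) = gsubst (gtup_gal sigma z) (gal_map sigma F : AG) :> AG.
Proof.
move=> hs; apply: ext_coef_inj => i; rewrite ext_coef_gal // !gsubstE // ext_coef_gal //.
rewrite rmorphM; congr (_ * _); rewrite /monomial rmorph_prod.
by apply: eq_bigr => j _; rewrite fmorphXz.
Qed.

Lemma gal_mapM (sigma : {rmorphism KG -> KG}) (F G : AG) : is_galois sigma ->
  gal_map sigma (F * G) = (gal_map sigma F : AG) * (gal_map sigma G : AG) :> AG.
Proof. by move=> hs; apply: (gal_mapZ hs F (G : mod_ext KG A^o)). Qed.

Lemma col_act_gal (sigma : {rmorphism KG -> KG}) z X : is_galois sigma ->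
  gal_map sigma (col_act z X) = col_act (gtup_gal sigma z) (gal_map sigma X).
Proof.
move=> hs; apply: (ecoord_inj (he := cb)) => i; rewrite ecoord_gal // !col_actE.
rewrite [LHS](gal_map_sum hs); apply: eq_bigr => j _.
by rewrite gal_mapM // EG // gal_gsubst // -ecoord_gal.
Qed.

End ColumnModule.

(** * Objects from cocycles *)

Section Cocycles.
Variables (p : nat) (R : realType) (K : fieldType) (v : complete_abs R K).
Variables (Kbar : closedFieldType) (iota : {rmorphism K -> Kbar}).
Variables (w : nonarch_abs R Kbar) (n : nat).
Variables (rho : 'I_n -> R) (rho0 : forall k, 0 < rho k).
Hypothesis p_prime : prime p.
Hypothesis w_ext : forall a, w (iota a) = v a.
Local Notation KG := (KGamma p iota).
Local Notation A := (Rrho v rho0).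
Local Notation AG := (alg_ext KG A).
Local Notation gtuple := (Gamma_tuple p iota n).
Local Notation obj := (Crho_obj p v iota w rho0).
Local Notation ext := (mod_ext KG).
Local Notation KJG J := (alg_ext KG (KJ v J)).

Let p_gt0 : (0 < p)%N. Proof. exact: prime_gt0. Qed.

(** [F] comes from [K_{J,n}] with scalars extended. *)
Definition defined_on (J : polysegment R n) (F : AG) := exists F' : KJG J, same F F'.

Lemma defined_on0 J : defined_on J 0.
Proof. by exists 0; apply: same0. Qed.

Lemma defined_onM J F G : defined_on J F -> defined_on J G -> defined_on J (F * G).
Proof. by move=> [F' hF] [G' hG]; exists (F' * G'); apply: (sameM w_ext). Qed.

Lemma defined_on_sum J (I : Type) (s : seq I) (F : I -> AG) :
  (forall i, defined_on J (F i)) -> defined_on J (\sum_(i <- s) F i).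
Proof.
move=> h; exists (\sum_(i <- s) sval (cid (h i))).
by apply: same_sum => i; apply: svalP (cid (h i)).
Qed.

Lemma defined_on_gsubst J z F : defined_on J F -> defined_on J (gsubst z F).
Proof. by move=> [F' hF]; exists (gsubst z F'); apply: same_gsubst. Qed.

Lemma defined_on_pure J (f : A) : converges_on v J f -> defined_on J (apure f 1).
Proof.
move=> hf; exists (apure (@LaurentRing _ _ _ _ (KJ_class v J) f hf) 1) => i.
by rewrite !ext_coef_pure.
Qed.

Lemma defined_on_sub (J J' : polysegment R n) F :
  (forall r, in_polysegment J' r -> in_polysegment J r) -> defined_on J F -> defined_on J' F.
Proof.
move=> sub [F' hF].
pose res (f : KJ v J) : KJ v J' :=
  @LaurentRing _ _ _ _ (KJ_class v J') f (fun r hr => lcoefP f r (sub r hr)).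
have resK : Kadditive (L := KG) (P := (KJ v J)^o) (Q := (KJ v J')^o) res (fun l => l).
  split=> // [f g|k f]; first by apply: lring_inj.
  have scaleE (I : polysegment R n) (h : KJ v I) :
      (k%:A : KJ v I) *: (h : (KJ v I)^o) = k *: h :> KJ v I.
    by rewrite -[LHS]scalerAl mul1r.
  by apply: lring_inj => i; rewrite !scaleE.
exists (emap (P := (KJ v J)^o) (Q := (KJ v J')^o) res (fun l => l) F') => i; rewrite hF.
elim/tens_ind: F' {hF} => [|F1 F2 h1 h2|f l].
- by rewrite (emap0 resK) !ext_coef0.
- by rewrite (emapD resK) !ext_coefD h1 h2.
rewrite (emap_pure resK (f : (KJ v J)^o) l) -[tpure _ _ f l]/(apure f l) -/(apure _ _).
by rewrite !ext_coef_pure.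
Qed.

Definition growth_on J q m (E : gtuple -> 'M[AG]_m) := [/\ in_interior J rho, 0 <= q,
  forall z i j, defined_on J (E z i j) &
  forall k z i j, (0 < k)%N -> Gamma_level k z -> bdd w J (q ^+ k) (E z i j)].

(** The matrices of the action of an object in a basis: each axiom on objects becomes one
    of these conditions. *)
Definition cocycle m (E : gtuple -> 'M[AG]_m) := [/\ E (gtup1 p iota n) = 1%:M,
  forall z z', E (gtupM z z') = E z *m map_mx (gsubst z) (E z'),
  forall sigma : {rmorphism KG -> KG}, is_galois sigma -> forall z i j,
    gal_map sigma (E z i j) = E (gtup_gal sigma z) i j :> AG &
  exists J q, growth_on J q E].

Section Germ.
Variables (J : polysegment R n) (hJ : in_interior J rho).

Lemma germD (f g : KJ v J) : germ rho0 hJ (f + g) = germ rho0 hJ f + germ rho0 hJ g.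
Proof. exact: lring_inj. Qed.

Lemma germM (f g : KJ v J) : germ rho0 hJ (f * g) = germ rho0 hJ f * germ rho0 hJ g.
Proof. exact: lring_inj. Qed.

Lemma germ_alg (k : K) : germ rho0 hJ (k%:A : KJ v J) = k%:A.
Proof. exact: lring_inj. Qed.

Lemma germ1 : germ rho0 hJ (1 : KJ v J) = 1 :> A.
Proof. by apply: (@lring_inj _ _ _ _ (Rrho_class v rho0)). Qed.

Lemma germ0 : germ rho0 hJ (0 : KJ v J) = 0 :> A.
Proof. by apply: (addIr (germ rho0 hJ (0 : KJ v J) : A)); rewrite -germD !add0r. Qed.

End Germ.

Section Realization.
Variables (m : nat) (E : gtuple -> 'M[AG]_m).
Hypothesis hE : cocycle E.

(** The cocycle acts on columns over [Rrho], and its model on columns over [K_{J,n}]. *)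
Lemma cocycle_realization :
  exists (P : obj) (e : 'I_m -> P) (he : is_basis e), forall z, act_mx he z = E z.
Proof.
have [E1 EM EG [J [q [hJ q0 hdef hbd]]]] := hE.
have [E' sE] : exists E' : gtuple -> 'M[KJG J]_m, forall z i j, same (E z i j) (E' z i j).
  exists (fun z => \matrix_(i, j) sval (cid (hdef z i j))) => z i j.
  by rewrite mxE; apply: (svalP (cid (hdef z i j))).
have E1' : E' (gtup1 p iota n) = 1%:M.
  apply/matrixP => i j; apply: ext_coef_inj => l; rewrite -sE E1 !mxE.
  by case: (i == j); [apply: same1|apply: same0].
have EM' z z' : E' (gtupM z z') = E' z *m map_mx (gsubst z) (E' z').
  apply/matrixP => i j; apply: ext_coef_inj => l; rewrite -sE EM !mxE.
  apply: same_sum => t; rewrite [map_mx _ _ _ _]mxE [map_mx _ (E' z') _ _]mxE.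
  by apply: (sameM w_ext); [apply: sE|apply: (same_gsubst p_gt0); apply: sE].
pose jm (x : ('cV[KJ v J]_m)) : ('cV[A]_m) := map_mx (germ rho0 hJ) x.
have gD := germD hJ; have gM := germM hJ; have gA := germ_alg hJ.
have g1 := germ1 hJ; have g0 := germ0 hJ.
have jD x y : jm (x + y) = jm x + jm y by apply/matrixP => i j; rewrite !mxE gD.
have jZ a x : jm (a *: x) = germ rho0 hJ a *: jm x.
  by apply/matrixP => i j; rewrite !mxE gM.
pose cbA := @col_base_is_basis R K v n (Rrho_class v rho0) m.
pose cbJ := @col_base_is_basis R K v n (KJ_class v J) m.
have jK : Kadditive (L := KG) jm (fun l => l) by split=> // k x; rewrite jZ gA.
have jbase i : jm (col_base _ i) = col_base _ i.
  by apply/matrixP => a b; rewrite !mxE; case: (_ && _).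
have extj : extended_from hJ jm.
  split=> //.
  pose aV (a : KJ v J) (r : A) := germ rho0 hJ a * r.
  pose aW (a : KJ v J) (x : ('cV[KJ v J]_m)) := a *: x.
  have bal : balanced aV aW (fun (r : A) (x : ('cV[KJ v J]_m)) => r *: jm x).
    split=> [r r' x|r x x'|a r x]; rewrite ?scalerDl ?jD ?scalerDr //.
    by rewrite jZ scalerA mulrC.
  have gb := balanced_tpure aV aW.
  pose psi (y : ('cV[A]_m)) : tens aV aW := \sum_i tpure aV aW (y i 0) (col_base (KJ_class v J) i).
  have psiD y y' : psi (y + y') = psi y + psi y'.
    by rewrite /psi -big_split; apply: eq_bigr => i _; rewrite mxE tpureDl.
  have psi0 : psi 0 = 0 by apply: (addIr (psi 0)); rewrite -psiD !add0r.
  exists psi; last first.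
    move=> y; rewrite /psi.
    have -> : tlift (fun r x => r *: jm x)
        (\sum_i tpure aV aW (y i 0) (col_base (KJ_class v J) i)) =
        \sum_i y i 0 *: col_base (Rrho_class v rho0) i.
      elim/big_rec2: _ => [|i x x' _ <-]; first exact: tlift0 bal.
      by rewrite (tliftD _ _ bal) (tlift_pure _ _ bal) jbase.
    by rewrite [RHS](bcoordE cbA); apply: eq_bigr => i _; rewrite col_coord.
  move=> t; elim/tens_ind: t => [|t t' ht ht'|r x].
  - by rewrite (tlift0 bal) psi0.
  - by rewrite (tliftD _ _ bal) psiD ht ht'.
  rewrite (tlift_pure _ _ bal) /psi {2}(bcoordE cbJ x).
  have tD (F : 'I_m -> ('cV[KJ v J]_m)) : tpure aV aW r (\sum_i F i) = \sum_i tpure aV aW r (F i).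
    by elim/big_rec2: _ => [|i y y' _ <-]; rewrite ?tpure0r ?tpureDr.
  rewrite tD; apply: eq_bigr => i _; rewrite col_coord -[RHS]tpure_bal /aV !mxE.
  by congr tpure; rewrite mulrC.
pose actA := @col_act p R K v Kbar iota n (Rrho_class v rho0) m E.
pose actJ := @col_act p R K v Kbar iota n (KJ_class v J) m E'.
have ext0 : ext_map jm (0 : ext ('cV[KJ v J]_m)) = 0 := emap0 jK.
have extD X Y : ext_map jm (X + Y) = ext_map jm X + ext_map jm Y := emapD jK X Y.
have extP x (l : KG) : ext_map jm (mpure x l) = mpure (jm x) l := emap_pure jK x l.
have sX (X : ext ('cV[KJ v J]_m)) i : same (ecoord cbA (ext_map jm X) i) (ecoord cbJ X i).
  elim/ext_ind: X => [|X Y hX hY|x l].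
  - by rewrite ext0 !ecoord0; apply: same0.
  - by rewrite extD !ecoordD; apply: sameD.
  rewrite extP !ecoord_pure => t; rewrite !ext_coef_pure.
  by rewrite !col_coord mxE.
have freeA : finite_free ('cV[A]_m).
  by exists m, (@col_base R K v n (Rrho_class v rho0) m); apply: cbA.
have freeJ : finite_free ('cV[KJ v J]_m).
  by exists m, (@col_base R K v n (KJ_class v J) m); apply: cbJ.
have semA : semilinear_action actA by apply: (col_act_semilinear w_ext p_gt0).
have semJ : semilinear_action actJ by apply: (col_act_semilinear w_ext p_gt0).
have comp z x : actA z (ext_map jm x) = ext_map jm (actJ z x).
  apply: (ecoord_inj (he := cbA)) => i; apply: ext_coef_inj => t.
  rewrite sX !col_actE; apply: same_sum => a.
  by apply: (sameM w_ext); [apply: sE|apply: (same_gsubst p_gt0); apply: sX].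
have growth : growth_bound w actJ.
  exists m, (@col_base R K v n (KJ_class v J) m); split; first exact: cbJ.
  have p1 : 1 < (p%:R : R) by rewrite ltr1n prime_gt1.
  have [l l0 ql] : exists2 l, (0 < l)%N & q <= p%:R ^+ l.
    have pV0 : 0 <= (p%:R : R)^-1 by rewrite invr_ge0.
    have pV1 : (p%:R : R)^-1 < 1 by rewrite invf_lt1 // (lt_trans ltr01).
    have q1 : 0 < (q + 1)^-1 by rewrite invr_gt0 ltr_wpDl.
    have [N hN] := expr_small pV0 pV1 q1; exists N.+1 => //.
    have := hN N.+1 (leqnSn N); rewrite exprVn ltf_pV2 ?posrE ?exprn_gt0 ?ltr_wpDl //.
      by move/ltW; apply: le_trans; rewrite lerDl.
    by rewrite (lt_trans ltr01).
  exists l%:R; first by rewrite ltr0n.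
  move=> k z k0 hz; exists (E' z).
    by move=> j; apply: (col_act_base p_gt0).
  rewrite -natrM powR_mulrn ?ler0n // exprM.
  apply: bigmax_le => [|i _]; first by rewrite lee_fin !exprn_ge0.
  apply: bigmax_le => [|j _]; first by rewrite lee_fin !exprn_ge0.
  apply: ge_ereal_sup => _ [r hr <-]; apply: ge_ereal_sup => _ [t _ <-].
  rewrite lee_fin -sE (le_trans (hbd k z i j k0 hz r hr t)) //.
  by apply: lerXn2r; rewrite ?nnegrE ?exprn_ge0.
have gal (sigma : {rmorphism KG -> KG}) : is_galois sigma ->
    forall z x, gal_map sigma (actA z x) = actA (gtup_gal sigma z) (gal_map sigma x).
  by move=> hs z x; apply: (col_act_gal p_gt0 EG).
pose P : obj := @CrhoObj p R K v Kbar iota w n rho rho0 _ actA freeA semA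
  (ex_intro _ J (ex_intro _ hJ (ex_intro _ _ (ex_intro _ actJ (ex_intro _ jm
     (And5 freeJ extj semJ comp growth)))))) gal.
exists P, (@col_base R K v n (Rrho_class v rho0) m), cbA => z; apply/matrixP => i j; rewrite mxE.
by rewrite [Cact _ _](col_act_base p_gt0 E z j) ecoord_comb.
Qed.

End Realization.
End Cocycles.

(** * Cocycles from objects *)

Section Presentation.
Variables (p : nat) (R : realType) (K : fieldType) (v : complete_abs R K).
Variables (Kbar : closedFieldType) (iota : {rmorphism K -> Kbar}).
Variables (w : nonarch_abs R Kbar) (n : nat).
Variables (rho : 'I_n -> R) (rho0 : forall k, 0 < rho k).
Local Notation KG := (KGamma p iota).
Local Notation A := (Rrho v rho0).
Local Notation AG := (alg_ext KG A).
Local Notation gtuple := (Gamma_tuple p iota n).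
Local Notation obj := (Crho_obj p v iota w rho0).
Local Notation ext := (mod_ext KG).
Local Notation KJG J := (alg_ext KG (KJ v J)).

(** Injectivity of the map from the tensor product gives independence, through the maps
    induced on it by the coordinate functions of [e]. *)
Lemma extended_basis (J : polysegment R n) (hJ : in_interior J rho) (P' : lmodType (KJ v J))
    (P : lmodType A) (j : P' -> P) m (e : 'I_m -> P') :
  extended_from hJ j -> is_basis e -> is_basis (fun i => j (e i)).
Proof.
move=> [jD jZ [g gK Kg]] he.
pose aV (a : KJ v J) (r : A) := germ rho0 hJ a * r.
pose aW (a : KJ v J) (x : P') := a *: x.
have bal : balanced aV aW (fun (r : A) (x : P') => r *: j x).
  split=> [r r' x|r x x'|a r x]; rewrite ?scalerDl ?jD ?scalerDr //.
  by rewrite jZ scalerA mulrC.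
have j0 : j 0 = 0 by apply: (addIr (j 0)); rewrite -jD !add0r.
apply: is_basisP => [x|c E i].
  rewrite -(Kg x); elim/tens_ind: (g x) => [|t t' [c hc] [c' hc']|r y].
  - by exists (fun=> 0); rewrite (tlift0 bal) big1 // => i _; rewrite scale0r.
  - exists (fun i => c i + c' i); rewrite (tliftD _ _ bal) hc hc' -big_split.
    by apply: eq_bigr => i _; rewrite scalerDl.
  exists (fun i => r * germ rho0 hJ (bcoord he y i)).
  rewrite (tlift_pure _ _ bal) {1}(bcoordE he y).
  have -> : j (\sum_i bcoord he y i *: e i) = \sum_i j (bcoord he y i *: e i).
    by elim/big_rec2: _ => [|l u u' _ <-]; rewrite ?j0 ?jD.
  by rewrite scaler_sumr; apply: eq_bigr => l _; rewrite jZ scalerA.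
pose t := \sum_l tpure aV aW (c l) (e l).
have tE : tlift (fun (r : A) (x : P') => r *: j x) t = 0.
  rewrite -E /t; elim/big_rec2: _ => [|l u u' _ <-]; first exact: (tlift0 bal).
  by rewrite (tliftD _ _ bal) (tlift_pure _ _ bal).
have t0 : t = 0 by rewrite -(gK t) tE -(tlift0 bal) gK.
have bal' : balanced aV aW (fun (r : A) (x : P') => r * germ rho0 hJ (bcoord he x i)).
  split=> [r r' x|r x x'|a r x]; rewrite ?mulrDl // ?bcoordD ?germD ?mulrDr //.
  by rewrite bcoordZ germM mulrA [r * _]mulrC.
have := tlift0 bal'; rewrite -t0 => <-.
rewrite (_ : tlift _ t = \sum_l c l * germ rho0 hJ (bcoord he (e l) i)); last first.
  rewrite /t; elim/big_rec2: _ => [|l u u' _ <-]; first exact: (tlift0 bal').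
  by rewrite (tliftD _ _ bal') (tlift_pure _ _ bal').
rewrite (bigD1 i) //= bcoord_base eqxx germ1 mulr1 big1 ?addr0 // => l li.
by rewrite bcoord_base eq_sym (negPf li) germ0 mulr0.
Qed.

(** In the basis coming from a model over [K_{J,n}], the action has the matrices of the
    action on the model. *)
Lemma presentation (P : obj) : exists m (e : 'I_m -> P) (he : is_basis e) J q,
  growth_on w J q (act_mx he).
Proof.
have [J [hJ [P' [act' [j [_ ext_j sem' comp [m [e' [he' [l l0 hl]]]]]]]]]] := Cextended P.
have he := extended_basis ext_j he'.
have [jD jZ _] := ext_j.
have jK : Kadditive (L := KG) j (fun l => l).
  by split=> // k x; rewrite jZ germ_alg.
pose gx (F : KJG J) : AG := emap (P := (KJ v J)^o) (Q := A^o) (germ rho0 hJ) (fun l => l) F.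
have gK : Kadditive (L := KG) (P := (KJ v J)^o) (Q := A^o) (germ rho0 hJ) (fun l => l).
  split=> // [f g|k f]; first exact: germD.
  by rewrite -[k%:A *: f]/(k%:A * f) germM germ_alg.
have gxE F : same (gx F) F.
  move=> i; rewrite /gx; elim/ext_ind: F => [|F G hF hG|f s].
  - by rewrite (emap0 gK) !ext_coef0.
  - by rewrite (emapD gK) !ext_coefD hF hG.
  by rewrite (emap_pure gK) -!/(apure _ _) !ext_coef_pure.
have extZ F (X : ext P') : ext_map j (F *: X) = gx F *: ext_map j X.
  exact: (@emapZ K KG (KJ v J) A P' P j (fun l => l) (germ rho0 hJ) jK gK
    (fun x y => erefl) jZ F X).
have entries (z : gtuple) (E : 'M[KJG J]_m) :
    (forall b, act' z (mpure (e' b) 1) = \sum_a E a b *: mpure (e' a) 1) ->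
    forall a b, same (act_mx he z a b) (E a b).
  move=> hE a b; rewrite mxE.
  have -> : mpure (j (e' b)) (1 : KG) = ext_map j (mpure (e' b) 1).
    by apply/esym; apply: (emap_pure jK (e' b) 1).
  rewrite comp hE.
  have -> : ext_map j (\sum_a E a b *: mpure (e' a) 1) =
      \sum_a gx (E a b) *: mpure (j (e' a)) 1.
    rewrite [LHS](emap_sum jK _ xpredT); apply: eq_bigr => a' _.
    by rewrite -[LHS]/(ext_map j _) extZ; congr (_ *: _); apply: (emap_pure jK (e' a') 1).
  by rewrite ecoord_comb; apply: gxE.
exists m, (fun i => j (e' i)), he, J, (p%:R `^ l); split=> //.
- move=> z a b; have [k hk] := Gamma_uniform z.
  have [|E hE _] := hl k.+1 z isT.
    by move=> i; rewrite expnSr exprM hk expr1n.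
  by exists (E a b); apply: entries hE a b.
move=> k z a b k0 hz r hr i; have [E hE hn] := hl k z k0 hz.
rewrite (entries z E hE a b i) -powR_mulrn ?powR_ge0 // -powRrM.
rewrite -lee_fin; apply: le_trans hn.
apply: (le_trans _ (le_bigmax _ _ a)); apply: (le_trans _ (le_bigmax _ _ b)).
apply: le_trans (ereal_sup_ubound _); last by exists r.
by apply: ereal_sup_ubound; exists i.
Qed.

End Presentation.

(** * Operations on cocycles *)

Section CocycleOperations.
Variables (p : nat) (R : realType) (K : fieldType) (v : complete_abs R K).
Variables (Kbar : closedFieldType) (iota : {rmorphism K -> Kbar}).
Variables (w : nonarch_abs R Kbar) (n : nat).
Variables (rho : 'I_n -> R) (rho0 : forall k, 0 < rho k).
Hypothesis p_prime : prime p.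
Hypothesis w_ext : forall a, w (iota a) = v a.
Local Notation KG := (KGamma p iota).
Local Notation A := (Rrho v rho0).
Local Notation AG := (alg_ext KG A).
Local Notation gtuple := (Gamma_tuple p iota n).
Local Notation obj := (Crho_obj p v iota w rho0).
Local Notation ext := (mod_ext KG).

Let p_gt0 : (0 < p)%N. Proof. exact: prime_gt0. Qed.

Lemma act_mx_cocycle (P : obj) m (e : 'I_m -> P) (he : is_basis e) J q :
  growth_on w J q (act_mx he) -> cocycle w (act_mx he).
Proof.
move=> gr; split=> [|z z'|sigma hs z i j|].
- exact: act_mx1.
- exact: act_mxM.
- rewrite !mxE -ecoord_gal // Cgalois // gal_map_pure // rmorph1.
  by [].
by exists J, q.
Qed.

Lemma ecoord_change (P : lmodType A) m (e e' : 'I_m -> P) (he : is_basis e) (he' : is_basis e')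
    (X : ext P) a :
  ecoord he' X a = \sum_i ecoord he X i * apure (bcoord he' (e i) a) 1.
Proof.
rewrite {1}(ecoordE he X) ecoord_sum; apply: eq_bigr => i _.
by rewrite ecoordZ ecoord_pure.
Qed.

(** A basis over [Rrho] and its inverse are defined and bounded on a smaller
    polysegment, so that a change of basis preserves exponential growth. *)
Lemma growth_base_change (P : obj) m (e e' : 'I_m -> P) (he : is_basis e) (he' : is_basis e') J q :
  growth_on w J q (act_mx he) -> exists J' q', growth_on w J' q' (act_mx he').
Proof.
move=> [hJ q0 hdef hbd].
pose s := [seq bcoord he' (e u.1) u.2 | u <- enum [set: 'I_m * 'I_m]] ++
          [seq bcoord he (e' u.1) u.2 | u <- enum [set: 'I_m * 'I_m]].
have [J1 [B [h1 s1 B0 hB]]] := common_polysegment s hJ.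
have [J2 [eta [h2 s2 e01 dec]]] := shrink h1.
have sub r : in_polysegment J2 r -> in_polysegment J r by move/s2/s1.
have in1 a b : bcoord he' (e a) b \in s.
  by rewrite mem_cat; apply/orP; left; apply/mapP; exists (a, b); rewrite // mem_enum inE.
have in2 a b : bcoord he (e' a) b \in s.
  by rewrite mem_cat; apply/orP; right; apply/mapP; exists (a, b); rewrite // mem_enum inE.
have sdef f : f \in s -> defined_on J2 (apure f 1 : AG).
  by move=> fs; apply: defined_on_pure; apply: bounded_converges e01 (hB f fs) dec.
have sbd f : f \in s -> bdd w J2 (B + 1) (apure f 1 : AG).
  move=> fs; apply/(bdd_pure p w_ext) => r hr i.
  by apply: le_trans (hB f fs r (s2 r hr) i) _; rewrite lerDl.
have actE z a b : act_mx he' z a b = \sum_i (\sum_j act_mx he z i j *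
    gsubst z (apure (bcoord he (e' b) j) 1)) * apure (bcoord he' (e i) a) 1.
  rewrite mxE (ecoord_change he); apply: eq_bigr => i _; rewrite ecoord_act.
  by congr (_ * _); apply: eq_bigr => j _; rewrite ecoord_pure.
have B1 : 0 <= B + 1 by rewrite addr_ge0.
exists J2, ((B + 1) * (B + 1) * q); split=> //.
- by rewrite !mulr_ge0.
- move=> z a b; rewrite actE; apply: defined_on_sum => i.
  apply: (defined_onM w_ext); last exact: sdef.
  apply: defined_on_sum => j; apply: (defined_onM w_ext).
    exact: defined_on_sub sub (hdef z i j).
  by apply: (defined_on_gsubst p_prime); apply: sdef.
move=> k z a b k0 hz; rewrite actE.
apply: (bdd_le (c := q ^+ k * (B + 1) * (B + 1))).
  rewrite exprMn -mulrA mulrC; apply: ler_wpM2r; first exact: exprn_ge0.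
  rewrite -[leLHS]expr1; apply: ler_weXn2l => //.
  by rewrite -[leLHS]mulr1; apply: ler_pM; rewrite ?lerDr.
have qk : 0 <= q ^+ k by apply: exprn_ge0.
apply: bdd_sum => [|i _]; first by rewrite !mulr_ge0.
apply: (bddM w_ext); rewrite ?mulr_ge0 //; last by apply: sbd.
apply: bdd_sum => [|j _]; first by rewrite mulr_ge0.
apply: (bddM w_ext) => //; first by apply: (bdd_sub sub); apply: hbd.
by apply: (bdd_gsubst p_gt0); apply: sbd.
Qed.

(** Block-triangularity, in either direction, is what makes a diagonal block a cocycle: it
    is the action on a subobject in the first case and on a quotient in the second. *)
Lemma cocycle_block m m' (E : gtuple -> 'M[AG]_m) (f : 'I_m' -> 'I_m) :
  injective f -> cocycle w E ->
  (forall z l b, l \notin codom f -> E z l (f b) = 0) \/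
  (forall z a l, l \notin codom f -> E z (f a) l = 0) ->
  cocycle w (fun z => mxsub f f (E z)).
Proof.
move=> fi [E1 EM EG [J [q [hJ q0 hdef hbd]]]] hf; split=> [|z z'|sigma hs z i j|].
- by rewrite E1; apply/matrixP => i j; rewrite !mxE (inj_eq fi).
- apply/matrixP => a b; rewrite EM !mxE.
  rewrite (bigID (mem (f @: [set: 'I_m'])%SET)) /= [X in _ + X]big1 ?addr0; last first.
    move=> l hl; have ln : l \notin codom f.
      by apply: contra hl => /codomP[c ->]; rewrite imset_f ?inE.
    rewrite mxE; case: hf => hf; rewrite hf ?mul0r //.
    by rewrite gsubst0 // mulr0.
  rewrite big_imset /=; last by move=> x y _ _; apply: fi.
  by apply: eq_big => [c|c _]; rewrite ?inE // !mxE.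
- by rewrite !mxE EG.
by exists J, q; split=> // [z a b|k z a b k0 hz]; rewrite mxE //; apply: hbd.
Qed.

Lemma cocycle_sum m1 m2 (E1 : gtuple -> 'M[AG]_m1) (E2 : gtuple -> 'M[AG]_m2) :
  cocycle w E1 -> cocycle w E2 -> cocycle w (fun z => block_mx (E1 z) 0 0 (E2 z)).
Proof.
move=> [E11 EM1 EG1 [J1 [q1 [h1 q10 hd1 hb1]]]] [E12 EM2 EG2 [J2 [q2 [h2 q20 hd2 hb2]]]].
have [J [hJ s1 s2]] := interior_meet h1 h2.
have gal0 (sigma : {rmorphism KG -> KG}) : is_galois sigma -> gal_map sigma 0 = 0 :> AG.
  by move=> hs; apply: ext_coef_inj => i; rewrite ext_coef_gal // !ext_coef0 rmorph0.
split=> [|z z'|sigma hs z i j|].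
- by rewrite E11 E12 -scalar_mx_block.
- rewrite EM1 EM2 map_block_mx mulmx_block; congr block_mx.
  + by rewrite mul0mx addr0.
  + rewrite mul0mx addr0; apply/esym/matrixP => i j; rewrite !mxE big1 // => l _.
    by rewrite !mxE gsubst0 // mulr0.
  + rewrite mul0mx add0r; apply/esym/matrixP => i j; rewrite !mxE big1 // => l _.
    by rewrite !mxE gsubst0 // mulr0.
  by rewrite mul0mx add0r.
- by rewrite !mxE; case: (split i) => i'; rewrite !mxE; case: (split j) => j';
    rewrite ?mxE ?EG1 ?EG2 ?gal0.
exists J, (q1 + q2); split=> // [|z i j|k z i j k0 hz]; first exact: addr_ge0.
  rewrite !mxE; case: (split i) => i'; rewrite !mxE; case: (split j) => j'; rewrite ?mxE.
  - exact: defined_on_sub s1 (hd1 z i' j').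
  - exact: defined_on0.
  - exact: defined_on0.
  exact: defined_on_sub s2 (hd2 z i' j').
have le1 : q1 ^+ k <= (q1 + q2) ^+ k.
  by apply: lerXn2r; rewrite ?nnegrE ?addr_ge0 ?lerDl.
have le2 : q2 ^+ k <= (q1 + q2) ^+ k.
  by apply: lerXn2r; rewrite ?nnegrE ?addr_ge0 ?lerDr.
have b0 : bdd w J ((q1 + q2) ^+ k) (0 : AG) by apply: bdd0; rewrite exprn_ge0 ?addr_ge0.
rewrite !mxE; case: (split i) => i'; rewrite !mxE; case: (split j) => j'; rewrite ?mxE //.
- by apply: bdd_le le1 _; apply: (bdd_sub s1); apply: hb1.
by apply: bdd_le le2 _; apply: (bdd_sub s2); apply: hb2.
Qed.

Lemma cocycle_empty : cocycle w (fun _ : gtuple => 0 : 'M[AG]_0).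
Proof.
have [J hJ] := interior_ex rho0.
split=> [|z z'|sigma hs z i|]; [by apply/matrixP => -[]|by apply/matrixP => -[]|by case: i|].
by exists J, 0; split=> // [z i|k z i]; case: i.
Qed.

End CocycleOperations.

(** * Kernels and cokernels *)

Section IndicatorSums.
Variable A : pzRingType.

Lemma sum_eq_r (I : finType) (x : I) (G : I -> A) : \sum_i G i * (i == x)%:R = G x.
Proof.
rewrite (bigD1 x) //= eqxx mulr1 big1 ?addr0 // => i /negPf ->; exact: mulr0.
Qed.

Lemma sum_eq_l (I : finType) (x : I) (G : I -> A) : \sum_i (i == x)%:R * G i = G x.
Proof.
rewrite (bigD1 x) //= eqxx mul1r big1 ?addr0 // => i /negPf ->; exact: mul0r.
Qed.

Lemma sum_image (I J : finType) (f : J -> I) (fi : injective f) (x : I) (G : I -> A) :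
  \sum_j (x == f j)%:R * G (f j) = if x \in codom f then G x else 0.
Proof.
case: codomP => [[j ->]|h].
  by rewrite -(sum_eq_l j (fun j => G (f j))); apply: eq_bigr => k _; rewrite (inj_eq fi) eq_sym.
by rewrite big1 // => j _; case: eqP => [xj|_]; [case: h; exists j|rewrite mul0r].
Qed.

Lemma sum_image_inj (I J : finType) (f : J -> I) (fi : injective f) (k : J) (G : J -> A) :
  \sum_j (f k == f j)%:R * G j = G k.
Proof.
by rewrite -(sum_eq_l k G); apply: eq_bigr => j _; rewrite (inj_eq fi) eq_sym.
Qed.

End IndicatorSums.

Section Category.
Variables (p : nat) (R : realType) (K : fieldType) (v : complete_abs R K).
Variables (Kbar : closedFieldType) (iota : {rmorphism K -> Kbar}).
Variables (w : nonarch_abs R Kbar) (n : nat).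
Variables (rho : 'I_n -> R) (rho0 : forall k, 0 < rho k).
Hypotheses (p_prime : prime p) (K0 : [pchar K] =i pred0) (v_p : v p%:R = p%:R^-1).
Hypothesis w_ext : forall a, w (iota a) = v a.
Local Notation KG := (KGamma p iota).
Local Notation A := (Rrho v rho0).
Local Notation AG := (alg_ext KG A).
Local Notation gtuple := (Gamma_tuple p iota n).
Local Notation obj := (Crho_obj p v iota w rho0).
Local Notation ext := (mod_ext KG).

Let p_gt0 : (0 < p)%N. Proof. exact: prime_gt0. Qed.

Lemma cocycle_basis (P : obj) : exists m (e : 'I_m -> P) (he : is_basis e), cocycle w (act_mx he).
Proof.
have [m [e [he [J [q hg]]]]] := presentation P.
by exists m, e, he; apply: act_mx_cocycle hg.
Qed.

Lemma stable_submodule_basis (P : obj) (S : P -> Prop) : proj_stable S ->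
  exists m (x : 'I_m -> P) (hx : is_basis x) (T : {set 'I_m}),
  [/\ cocycle w (act_mx hx), forall j, j \in T -> S (x j) &
      forall s, S s -> forall j, j \notin T -> bcoord hx s j = 0].
Proof.
move=> hS; have [m [e [he [J [q hg]]]]] := presentation P.
have [hJ q0 _ hbd] := hg.
have [x [hx [T [h1 h2]]]] := adapted_basis p_prime K0 v_p w_ext hJ q0 hbd hS.
have [J' [q' hg']] := growth_base_change p_prime w_ext hx hg.
by exists m, x, hx, T; split=> //; apply: act_mx_cocycle hg'.
Qed.

(** The morphisms constructed below send basis vectors to basis vectors or to [0], so that
    their matrices are fixed by all substitutions. *)
Lemma hom_of_indicator (P Q : obj) m m' (e : 'I_m -> P) (e' : 'I_m' -> Q) (he : is_basis e)
    (he' : is_basis e') (N : 'I_m' -> 'I_m -> bool) :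
  (forall z i j, \sum_l act_mx he' z i l * (N l j)%:R = \sum_l (N i l)%:R * act_mx he z l j) ->
  exists f : Crho_hom P Q, forall x i, bcoord he' (f x) i = \sum_j (N i j)%:R * bcoord he x j.
Proof.
move=> hN; pose f (x : P) : Q := \sum_i (\sum_j (N i j)%:R * bcoord he x j) *: e' i.
have fE x i : bcoord he' (f x) i = \sum_j (N i j)%:R * bcoord he x j by apply: bcoord_comb.
have fl : linear f.
  move=> a x y; apply: (bcoord_inj (he := he')) => i; rewrite bcoordD bcoordZ !fE.
  rewrite mulr_sumr -big_split; apply: eq_bigr => j _.
  by rewrite bcoordD bcoordZ mulrDr mulrCA.
have extE (X : ext P) i : ecoord he' (ext_map f X) i = \sum_j (N i j)%:R * ecoord he X j.
  elim/ext_ind: X => [|X Y hX hY|x l].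
  - by rewrite ext_map0 // ecoord0 big1 // => j _; rewrite ecoord0 mulr0.
  - rewrite ext_mapD // ecoordD hX hY -big_split; apply: eq_bigr => j _.
    by rewrite ecoordD mulrDr.
  rewrite ext_map_pure // ecoord_pure fE; apply: ext_coef_inj => t.
  rewrite ext_coef_sum ext_coef_pure lcoef_sum scaler_suml; apply: eq_bigr => j _.
  rewrite ecoord_pure -ext_coef_pure; congr ext_coef.
  by case: (N i j); rewrite ?mul1r // !mul0r; apply: (tpure0l _ _).
have feq z (X : ext P) : Cact z (ext_map f X) = ext_map f (Cact z X).
  apply: (ecoord_inj (he := he')) => i; rewrite ecoord_act extE.
  under eq_bigr => l _ do rewrite extE gsubst_sum // mulr_sumr.
  rewrite exchange_big /=.
  under [RHS]eq_bigr => l _ do rewrite ecoord_act mulr_sumr.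
  rewrite [RHS]exchange_big /=; apply: eq_bigr => j _.
  transitivity ((\sum_l act_mx he' z i l * (N l j)%:R) * gsubst z (ecoord he X j)).
    rewrite mulr_suml; apply: eq_bigr => l _; rewrite -mulrA; congr (_ * _).
    by case: (N l j); rewrite ?mul1r // !mul0r gsubst0.
  by rewrite hN mulr_suml; apply: eq_bigr => l _; rewrite mulrA.
by exists (CrhoHom fl feq).
Qed.

Section OneMorphism.
Variables (P Q : obj) (f : Crho_hom P Q).

Lemma kernel_stable : proj_stable (fun x => f x = 0).
Proof.
move=> k zeta k0 zp i x y fx yE.
have [m [e [he _]]] := cocycle_basis Q.
apply: (mpure_inj (p := p) (iota := iota) he).
rewrite -[LHS](ext_map_pure _ _ (Clinear f)) yE proj_hom (ext_map_pure _ _ (Clinear f)) fx.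
have -> : mpure (0 : Q) (1 : KG) = 0 by apply: tpure0l.
rewrite /proj big1 ?scaler0 // => a _.
by rewrite Cact0 scaler0.
Qed.

Lemma image_stable : proj_stable (fun y => exists x, y = f x).
Proof.
move=> k zeta k0 zp i _ y [x ->] yE.
have [x' xE] := proj_descent p_prime K0 k0 zp i x.
have [m [e [he _]]] := cocycle_basis Q.
exists x'; apply: (mpure_inj (p := p) (iota := iota) he).
rewrite yE -(ext_map_pure x' _ (Clinear f)) xE proj_hom.
by rewrite (ext_map_pure _ _ (Clinear f)).
Qed.

(** A basis adapted to the image is partly made of images; lift these and send the other
    basis vectors to [0]. *)
Lemma pseudo_inverse : exists2 g : Q -> P, linear g & forall x, f (g (f x)) = f x.
Proof.
have [m [y [hy [T [_ hT hS]]]]] := stable_submodule_basis image_stable.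
have ex j : exists u, j \in T -> y j = f u.
  have [jT|jT] := boolP (j \in T); last by exists 0.
  by have [u uE] := hT j jT; exists u.
pose u j := sval (cid (ex j)).
have uE j : j \in T -> y j = f (u j) by exact: (svalP (cid (ex j))).
exists (fun q => \sum_j bcoord hy q j *: u j) => [a q q'|x].
  rewrite scaler_sumr -big_split; apply: eq_bigr => j _.
  by rewrite bcoordD bcoordZ scalerDl scalerA.
rewrite (lin_comb (Clinear f)) [RHS](bcoordE hy (f x)); apply: eq_bigr => j _.
have [jT|jT] := boolP (j \in T); first by rewrite (uE j jT).
by rewrite hS ?scale0r //; exists x.
Qed.

Lemma codom_enum_val m (T : {set 'I_m}) l :
  (l \in codom (fun a : 'I_#|T| => enum_val a)) = (l \in T).
Proof.
apply/codomP/idP => [[a ->]|lT]; first exact: enum_valP.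
by exists (enum_rank_in lT l); rewrite enum_rankK_in.
Qed.

(** The kernel is spanned by a part of an adapted basis. To see that the
    action preserves its span after extension of scalars, use the projection [h] onto the
    kernel given by the pseudo-inverse: it fixes whatever the extension of [f] kills. *)
Lemma kernel_data : exists (N : obj) (i : Crho_hom N P) (ret : P -> N),
  [/\ linear ret, forall x, f (i x) = 0, forall y, f y = 0 -> i (ret y) = y &
      forall x, ret (i x) = x].
Proof.
have [g gl fgf] := pseudo_inverse.
have [m [x [hx [T [hE hT hS]]]]] := stable_submodule_basis kernel_stable.
have fl := Clinear f.
pose h y := y - g (f y).
have hl : linear h.
  by move=> a y y'; rewrite /h fl gl scalerBr opprD addrACA.
have hker y : f (h y) = 0 by rewrite /h (lin_sub fl) fgf subrr.
have ext_h (X : ext P) l : l \notin T -> ecoord hx (ext_map h X) l = 0.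
  move=> lT; elim/ext_ind: X => [|X Y hX hY|y k].
  - by rewrite ext_map0 // ecoord0.
  - by rewrite ext_mapD // ecoordD hX hY addr0.
  rewrite ext_map_pure // ecoord_pure (hS _ (hker y)) //.
  exact: (tpure0l _ _).
have ext_hE (X : ext P) : ext_map h X = X - ext_map g (ext_map f X).
  elim/ext_ind: X => [|X Y hX hY|y k].
  - by rewrite !ext_map0 // subr0.
  - by rewrite !ext_mapD // hX hY opprD addrACA.
  rewrite !ext_map_pure // /h; apply: (addIr (mpure (g (f y)) k)); rewrite subrK.
  by rewrite -[LHS](tpureDl _ _) subrK.
have van z l b : l \notin T -> b \in T -> act_mx hx z l b = 0.
  move=> lT bT; rewrite mxE.
  have fX : ext_map f (Cact z (mpure (x b) 1)) = 0.
    rewrite -Cequiv ext_map_pure // hT //.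
    have -> : mpure (0 : Q) (1 : KG) = 0 by apply: tpure0l.
    exact: Cact0.
  by have := ext_hE (Cact z (mpure (x b) 1)); rewrite fX ext_map0 // subr0 => <-; apply: ext_h.
pose ev (a : 'I_#|T|) : 'I_m := enum_val a.
have evi : injective ev by exact: enum_val_inj.
have cE := cocycle_block p_prime evi hE.
have {}cE : cocycle w (fun z => mxsub ev ev (act_mx hx z)).
  apply: cE; left => z l b; rewrite codom_enum_val => lT; apply: van => //.
  exact: enum_valP.
have [N [b [hb hbE]]] := cocycle_realization p_prime w_ext cE.
have [z i j|i iE] := @hom_of_indicator N P _ _ b x hb hx (fun l a => l == ev a).
  rewrite sum_eq_r hbE.
  under eq_bigr do rewrite mxE.
  rewrite (sum_image evi i (fun l => act_mx hx z l (ev j))) codom_enum_val.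
  by case: ifP => // /negbT iT; apply: van => //; apply: enum_valP.
pose ret (y : P) : N := \sum_a bcoord hx y (ev a) *: b a.
have retE y a : bcoord hb (ret y) a = bcoord hx y (ev a) by apply: bcoord_comb.
exists N, i, ret; split.
- move=> a y y'; apply: (bcoord_inj (he := hb)) => c.
  by rewrite bcoordD bcoordZ !retE bcoordD bcoordZ.
- move=> y; have -> : i y = \sum_a bcoord hb y a *: x (ev a).
    apply: (bcoord_inj (he := hx)) => l; rewrite iE bcoord_sum; apply: eq_bigr => a _.
    by rewrite bcoordZ bcoord_base mulrC.
  rewrite (lin_comb fl) big1 // => a _; rewrite hT ?scaler0 //; exact: enum_valP.
- move=> y fy; apply: (bcoord_inj (he := hx)) => l; rewrite iE.
  under eq_bigr do rewrite retE.
  rewrite (sum_image evi l (fun l => bcoord hx y l)) codom_enum_val.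
  by case: ifP => // /negbT lT; rewrite hS.
move=> y; apply: (bcoord_inj (he := hb)) => a.
by rewrite retE iE sum_image_inj.
Qed.

(** The quotient by the image has a basis given by the part of an adapted basis outside
    the image. *)
Lemma cokernel_data : exists (N : obj) (r : Crho_hom Q N) (s : N -> Q),
  [/\ linear s, forall x, r (f x) = 0, forall c, r (s c) = c &
      forall y, r y = 0 -> exists x, y = f x].
Proof.
have [m [x [hx [T [hE hT hS]]]]] := stable_submodule_basis image_stable.
have fl := Clinear f.
have ext_f (X : ext P) l : l \notin T -> ecoord hx (ext_map f X) l = 0.
  move=> lT; elim/ext_ind: X => [|X Y hX hY|y k].
  - by rewrite ext_map0 // ecoord0.
  - by rewrite ext_mapD // ecoordD hX hY addr0.
  rewrite ext_map_pure // ecoord_pure hS //; last by exists y.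
  exact: (tpure0l _ _).
have van z l b : l \notin T -> b \in T -> act_mx hx z l b = 0.
  move=> lT bT; rewrite mxE; have [u ->] := hT b bT.
  by rewrite -(ext_map_pure _ _ fl) Cequiv; apply: ext_f.
pose ev (a : 'I_#|~: T|) : 'I_m := enum_val a.
have evi : injective ev by exact: enum_val_inj.
have evT a : ev a \notin T by have := enum_valP a; rewrite inE.
have cE : cocycle w (fun z => mxsub ev ev (act_mx hx z)).
  apply: (cocycle_block p_prime evi hE); right => z a l; rewrite codom_enum_val inE negbK => lT.
  exact: van.
have [N [b [hb hbE]]] := cocycle_realization p_prime w_ext cE.
have [z i j|r rE0] := @hom_of_indicator Q N _ _ x b hx hb (fun a l => l == ev a).
  rewrite sum_eq_l hbE.
  under eq_bigr do rewrite mxE mulrC.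
  rewrite (sum_image evi j (fun l => act_mx hx z (ev i) l)) codom_enum_val inE.
  by case: ifP => // /negbT; rewrite negbK => jT; rewrite van.
have rE y a : bcoord hb (r y) a = bcoord hx y (ev a) by rewrite rE0 sum_eq_l.
pose s (c : N) : Q := \sum_a bcoord hb c a *: x (ev a).
exists N, r, s; split.
- move=> a c c'; rewrite /s scaler_sumr -big_split; apply: eq_bigr => i _.
  by rewrite bcoordD bcoordZ scalerDl scalerA.
- move=> u; apply: (bcoord_inj (he := hb)) => a; rewrite rE bcoord0 hS //.
  by exists u.
- move=> c; apply: (bcoord_inj (he := hb)) => a; rewrite rE /s bcoord_sum.
  under eq_bigr do rewrite bcoordZ bcoord_base mulrC.
  by rewrite sum_image_inj.
move=> y ry; rewrite (bcoordE hx y).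
have ex j : exists u, bcoord hx y j *: x j = f u.
  have [jT|jT] := boolP (j \in T).
    have [u ->] := hT j jT; exists (bcoord hx y j *: u); by rewrite (lin_scale fl).
  exists 0; rewrite (lin_zero fl).
  have jc : j \in codom ev by rewrite codom_enum_val inE.
  by have [a ->] := codomP jc; rewrite -rE ry bcoord0 scale0r.
exists (\sum_j sval (cid (ex j))).
elim/big_rec2: _ => [|j a b' _ ->]; first by rewrite (lin_zero fl).
by rewrite (lin_add fl) -(svalP (cid (ex j))).
Qed.

End OneMorphism.
End Category.

(** * The category is abelian *)

Section Abelian.
Variables (p : nat) (R : realType) (K : fieldType) (v : complete_abs R K).
Variables (Kbar : closedFieldType) (iota : {rmorphism K -> Kbar}).
Variables (w : nonarch_abs R Kbar) (n : nat).
Variables (rho : 'I_n -> R) (rho0 : forall k, 0 < rho k).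
Hypotheses (p_prime : prime p) (K0 : [pchar K] =i pred0) (v_p : v p%:R = p%:R^-1).
Hypothesis w_ext : forall a, w (iota a) = v a.
Local Notation KG := (KGamma p iota).
Local Notation A := (Rrho v rho0).
Local Notation AG := (alg_ext KG A).
Local Notation gtuple := (Gamma_tuple p iota n).
Local Notation obj := (Crho_obj p v iota w rho0).
Local Notation ext := (mod_ext KG).
Local Notation cat := (Crho p v iota w rho0).

Lemma hom_ext_at (P Q : obj) (f g : Crho_hom P Q) : f = g -> forall x, f x = g x.
Proof. by move=> ->. Qed.

(** The lift of [g] is [ret \o g]; it is equivariant because [i] stays injective after
    extension of scalars, thanks to its retraction. *)
Lemma kernel_criterion (P Q N : obj) (f : Crho_hom P Q) (i : Crho_hom N P) (ret : P -> N) :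
  linear ret -> (forall x, f (i x) = 0) -> (forall y, f y = 0 -> i (ret y) = y) ->
  (forall x, ret (i x) = x) -> is_kernel (C := cat) f i.
Proof.
move=> rl fi ir ri; split; first by apply: Crho_hom_inj => x; apply: fi.
move=> X g fg; have fg0 x : f (g x) = 0 by have := hom_ext_at fg x.
have ii : injective (ext_map i : ext N -> ext P).
  have rK : cancel (ext_map i : ext N -> ext P) (ext_map ret).
    move=> Y; rewrite -ext_map_comp //; last exact: Clinear.
    by rewrite -[RHS]ext_map_id; congr ext_map; apply/funext => x; apply: ri.
  exact: can_inj rK.
pose h x := ret (g x).
have hl : linear h by apply: linear_comp rl (Clinear g).
have ih x : i (h x) = g x by apply: ir; apply: fg0.
have ihE (Y : ext X) : ext_map i (ext_map h Y) = ext_map g Y.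
  rewrite -ext_map_comp //; last exact: Clinear.
  by congr ext_map; apply/funext => x; apply: ih.
have he z (Y : ext X) : Cact z (ext_map h Y) = ext_map h (Cact z Y).
  by apply: ii; rewrite -(Cequiv i) !ihE (Cequiv (g : Crho_hom X P)).
exists (CrhoHom hl he); split; first by apply: Crho_hom_inj => x; apply: ih.
move=> h' ih'; apply: Crho_hom_inj => x /=; rewrite /h -(hom_ext_at ih' x) /=.
by rewrite ri.
Qed.

(** Dually, the factorization of [g] is [g \o s]. *)
Lemma cokernel_criterion (P Q N : obj) (f : Crho_hom P Q) (r : Crho_hom Q N) (s : N -> Q) :
  linear s -> (forall x, r (f x) = 0) -> (forall c, r (s c) = c) ->
  (forall y, r y = 0 -> exists x, y = f x) -> is_cokernel (C := cat) f r.
Proof.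
move=> sl rf rs ex; split; first by apply: Crho_hom_inj => x; apply: rf.
move=> X g gf; have gf0 x : g (f x) = 0 by have := hom_ext_at gf x.
have rsE (Y : ext N) : ext_map r (ext_map s Y) = Y.
  rewrite -ext_map_comp //; last exact: Clinear.
  by rewrite -[RHS]ext_map_id; congr ext_map; apply/funext => x; apply: rs.
pose h c := g (s c).
have hl : linear h by apply: linear_comp (Clinear g) sl.
have hr y : h (r y) = g y.
  have [|x xE] := ex (y - s (r y)); first by rewrite (lin_sub (Clinear r)) rs subrr.
  by rewrite -[in RHS](subrK (s (r y)) y) xE (lin_add (Clinear g)) gf0 add0r.
have hrE (Y : ext Q) : ext_map h (ext_map r Y) = ext_map g Y.
  rewrite -ext_map_comp //; last exact: Clinear.
  by congr ext_map; apply/funext => x; apply: hr.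
have he z (Y : ext N) : Cact z (ext_map h Y) = ext_map h (Cact z Y).
  by rewrite -(rsE Y) hrE !Cequiv hrE.
exists (CrhoHom hl he); split; first by apply: Crho_hom_inj => x; apply: hr.
move=> h' h'r; apply: Crho_hom_inj => c /=; rewrite /h -(hom_ext_at h'r (s c)) /=.
by rewrite rs.
Qed.

Lemma Crho_zero : exists z : cat, is_zero_object z.
Proof.
have [Z [b [hb _]]] := cocycle_realization p_prime w_ext (cocycle_empty p v iota w rho0).
have Z0 (x y : Z) : x = y by apply: (bcoord_inj (he := hb)) => -[].
exists Z => P; split=> f g; apply: Crho_hom_inj => x; last exact: Z0.
by rewrite (Z0 x 0) !lin_zero //; apply: Clinear.
Qed.

Lemma Crho_biproduct (P Q : obj) : exists (s : cat)
  (i1 : Defs.hom (P : cat) s) (i2 : Defs.hom (Q : cat) s)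
  (p1 : Defs.hom s (P : cat)) (p2 : Defs.hom s (Q : cat)), is_biproduct i1 i2 p1 p2.
Proof.
have [m1 [e1 [h1 c1]]] := cocycle_basis P; have [m2 [e2 [h2 c2]]] := cocycle_basis Q.
have [S [b [hb hE]]] := cocycle_realization p_prime w_ext (cocycle_sum p_prime c1 c2).
have lr (a : 'I_m1) (c : 'I_m2) : (lshift m2 a == rshift m1 c) = false.
  exact: eq_lrshift.
have rl (a : 'I_m1) (c : 'I_m2) : (rshift m1 c == lshift m2 a) = false.
  exact: eq_rlshift.
have [z i j|i1 i1E] := hom_of_indicator p_prime
  (he := h1) (he' := hb) (N := fun l a => l == lshift m2 a).
  rewrite sum_eq_r hE; case: (split_ordP i) => a ->.
    by rewrite block_mxEul sum_image_inj //; apply: lshift_inj.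
  by rewrite block_mxEdl mxE big1 // => c _; rewrite rl mul0r.
have [z i j|i2 i2E] := hom_of_indicator p_prime
  (he := h2) (he' := hb) (N := fun l a => l == rshift m1 a).
  rewrite sum_eq_r hE; case: (split_ordP i) => a ->.
    by rewrite block_mxEur mxE big1 // => c _; rewrite lr mul0r.
  by rewrite block_mxEdr sum_image_inj //; apply: rshift_inj.
have [z i j|p1 p1E] := hom_of_indicator p_prime
  (he := hb) (he' := h1) (N := fun a l => l == lshift m2 a).
  rewrite sum_eq_l hE; case: (split_ordP j) => a ->.
    rewrite block_mxEul; under eq_bigr do rewrite mulrC.
    by rewrite sum_image_inj //; apply: lshift_inj.
  by rewrite block_mxEur mxE big1 // => c _; rewrite rl mulr0.
have [z i j|p2 p2E] := hom_of_indicator p_prime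
  (he := hb) (he' := h2) (N := fun a l => l == rshift m1 a).
  rewrite sum_eq_l hE; case: (split_ordP j) => a ->.
    by rewrite block_mxEdl mxE big1 // => c _; rewrite lr mulr0.
  rewrite block_mxEdr; under eq_bigr do rewrite mulrC.
  by rewrite sum_image_inj //; apply: rshift_inj.
have p1l x a : bcoord h1 (p1 x) a = bcoord hb x (lshift m2 a) by rewrite p1E sum_eq_l.
have p2l x a : bcoord h2 (p2 x) a = bcoord hb x (rshift m1 a) by rewrite p2E sum_eq_l.
have i1l x a : bcoord hb (i1 x) (lshift m2 a) = bcoord h1 x a.
  by rewrite i1E sum_image_inj //; apply: lshift_inj.
have i1r x a : bcoord hb (i1 x) (rshift m1 a) = 0.
  by rewrite i1E big1 // => c _; rewrite rl mul0r.
have i2r x a : bcoord hb (i2 x) (rshift m1 a) = bcoord h2 x a.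
  by rewrite i2E sum_image_inj //; apply: rshift_inj.
have i2l x a : bcoord hb (i2 x) (lshift m2 a) = 0.
  by rewrite i2E big1 // => c _; rewrite lr mul0r.
exists S, i1, i2, p1, p2; split; apply: Crho_hom_inj => x /=.
- by apply: (bcoord_inj (he := h1)) => a; rewrite p1l i1l.
- by apply: (bcoord_inj (he := h2)) => a; rewrite p2l i2r.
- by apply: (bcoord_inj (he := h1)) => a; rewrite p1l i2l bcoord0.
- by apply: (bcoord_inj (he := h2)) => a; rewrite p2l i1r bcoord0.
apply: (bcoord_inj (he := hb)) => a; rewrite bcoordD.
by case: (split_ordP a) => c ->; rewrite ?i1l ?i2l ?i1r ?i2r ?p1l ?p2l ?addr0 ?add0r.
Qed.

Lemma Crho_abelian : is_abelian cat.
Proof.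
split; first exact: Crho_zero.
split; first exact: Crho_biproduct.
have ker (P Q : obj) (f : Crho_hom P Q) := kernel_data p_prime K0 v_p w_ext f.
have coker (P Q : obj) (f : Crho_hom P Q) := cokernel_data p_prime K0 v_p w_ext f.
have pinv (P Q : obj) (f : Crho_hom P Q) := pseudo_inverse p_prime K0 v_p w_ext f.
split=> [P Q f|].
  have [N [i [ret [h1 h2 h3 h4]]]] := ker P Q f.
  by exists N, i; apply: kernel_criterion h1 h2 h3 h4.
split=> [P Q f|].
  have [N [r [s [h1 h2 h3 h4]]]] := coker P Q f.
  by exists N, r; apply: cokernel_criterion h1 h2 h3 h4.
(* A mono is the kernel of its cokernel, with the pseudo-inverse as retraction; an epi is
   the cokernel of its kernel, with the pseudo-inverse as section. *)
split=> [P Q f fm|P Q f fe].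
  have [N [i [ret [_ fi ir _]]]] := ker P Q f.
  have [C [r [s [_ rf _ ex]]]] := coker P Q f.
  have [g gl fgf] := pinv P Q f.
  have i0 : i = 0 :> Crho_hom N P.
    apply: (fm N i 0); apply: Crho_hom_inj => x /=.
    by rewrite fi (lin_zero (Clinear f)).
  have finj x : f x = 0 -> x = 0 by move=> /ir <-; rewrite i0.
  exists C, r; apply: (kernel_criterion gl) => [x|y ry|x]; first exact: rf.
    by have [x ->] := ex y ry; rewrite fgf.
  apply/eqP; rewrite -subr_eq0; apply/eqP/finj.
  by rewrite (lin_sub (Clinear f)) fgf subrr.
have [N [i [ret [_ fi ir _]]]] := ker P Q f.
have [C [r [s [_ rf rs ex]]]] := coker P Q f.
have [g gl fgf] := pinv P Q f.
have r0 : r = 0 :> Crho_hom Q C.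
  by apply: (fe C r 0); apply: Crho_hom_inj => x /=; rewrite rf.
have fsurj y : exists x, y = f x by apply: ex; rewrite r0.
exists N, i; apply: (cokernel_criterion gl) => [x|c|y fy]; first exact: fi.
  by have [x ->] := fsurj c; rewrite fgf.
by exists (ret y); rewrite ir.
Qed.

End Abelian.

Theorem proposition2p11 (R : realType) (p : nat) (p_prime : prime p)
    (K : fieldType) (v : complete_abs R K)
    (K_char0 : [pchar K] =i pred0) (v_p : v p%:R = p%:R^-1)
    (Kbar : closedFieldType) (iota : {rmorphism K -> Kbar})
    (Kbar_algebraic : forall x : Kbar, algebraicOver iota x)
    (w : nonarch_abs R Kbar) (w_extends_v : forall a : K, w (iota a) = v a)
    (n : nat) (n_gt0 : (0 < n)%N)
    (rho : 'I_n -> R) (rho_gt0 : forall k, 0 < rho k) :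
  is_abelian (Crho p v iota w rho_gt0).
Proof. exact: Crho_abelian. Qed.
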